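(* Let $n\ge2$. Any linear web (of codimension one) on an open set of $\mathbb{P}_n$ (in particular any algebraic web on $\mathbb{P}_n$) is totally linearizable, hence dicritical.
   Context: Contact elements. Let $M$ be an $n$-dimensional complex manifold. $\widetilde M=\mathbb{P}(T^*M)$ is the manifold of contact elements: a point over $m\in M$ is an $(n-1)$-dimensional subspace of $T_mM$; $\pi:\widetilde M\to M$ is the projection. In local coordinates $x=(x_1,\dots,x_n)$ on $M$, the contact element at $x$ which is the kernel of $dx_n-\sum_{\alpha=1}^{n-1}p_\alpha dx_\alpha$ has coordinates $(x,p)$; $\eta=dx_n-\sum_\alpha p_\alpha dx_\alpha$ is the local contact form. Webs. Let $W\subset\widetilde M$ be an analytic subvariety of pure dimension $n$, $W'$ its regular part, $\pi_W=\pi|_W$, and $\Gamma_W$ (critical set) the set of points of $W$ where $W$ is singular or where $d\pi_W:TW'\to TM$ is not an isomorphism. The caustic is $\pi(\Gamma_W)$; put $M_0=M\setminus\pi(\Gamma_W)$ and $W_0=\pi_W^{-1}(M_0)$. $W$ is a $d$-web (of codimension one) on $M$, $d\ge1$, if: (o) $\pi_W$ is surjective; (i) the restriction $\eta_W$ of $\eta$ to $W'$ satisfies $\eta_W\wedge d\eta_W\equiv0$; (ii) $\pi_W:W_0\to M_0$ is a $d$-fold covering; (iii) $\Gamma_W$ is empty or has dimension at most $n-1$; (iv) for every $m\in M$, $W\cap\pi^{-1}(m)$ is an algebraic subset of dimension $0$ and degree $d$ (counted with multiplicity) in $\mathbb{P}T_m^*M$. The kernel of $\eta_W$ defines a (possibly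 singular) foliation $\widetilde{\mathcal F}$ on $W'$, and locally near a point of $M_0$ it projects to $d$ regular codimension one foliations $\mathcal F_i$. A leaf of the web is a hypersurface of $M$ whose intersection with $M_0$ is locally a leaf of one of the $\mathcal F_i$. Dicriticity. $W$ is dicritical on an irreducible component $C$ of $W$ if the restriction of $\widetilde{\mathcal F}$ to the regular part $C'$ of $C$ is non-singular (i.e. $\eta|_{C'}$ vanishes nowhere); $W$ is dicritical if it is so on every irreducible component. Linearity. A linear web on an open set of $\mathbb{P}_n$ is a web all of whose leaves are pieces of hyperplanes. An algebraic $d$-web on $\mathbb{P}_n$ is a web whose leaves are the hyperplanes belonging to some algebraic curve of degree $d$ in the dual projective space $\mathbb{P}'_n$ of hyperplanes. A web on $M$ is totally linearizable if near any point of $M$ (not only of $M_0$) there exist local holomorphic coordinates with respect to which the leaves of the web have an affine equation.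
   Formalization: Dicritical is read as: the foliation is non-singular on C', i.e. η|_{C'} = fω with ω nowhere zero and f not identically 0 on any open set; the gloss ''η vanishes nowhere'' makes the claim false for the web of tangents to a conic. *)

(* Defs.v *)
From HB Require Import structures.
From mathcomp Require Import all_boot all_order all_algebra.
From mathcomp Require Import all_classical all_reals all_analysis.
From mathcomp Require Import complex.
Set Implicit Arguments.
Unset Strict Implicit.
Unset Printing Implicit Defensive.
Import Order.TTheory GRing.Theory Num.Theory.
Import numFieldNormedType.Exports.
Local Open Scope classical_set_scope.
Local Open Scope ring_scope.

(* R[i], seen as a numFieldType so as to inherit the topology and the norm that
   the library puts on every numFieldType. *)
Definition Cplx (R : realType) : numFieldType := R[i].

(* Meaningful when D is open: complex (Frechet) differentiability at every
   point of an open set is holomorphy. *)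
Definition holo (R : realType) (V W : normedModType (Cplx R)) (D : set V)
  (f : V -> W) := forall x, D x -> differentiable f x.

(* psi : D -> A `&` B is a holomorphic parametrization of the part of A lying
   in the open set B, and chi is a holomorphic extension to B of its inverse.
   Hence A `&` B is an embedded complex submanifold of dimension k of B, with
   tangent space at psi t the image of 'd psi t; conversely every embedded
   submanifold is locally of this form. *)
Definition local_param (R : realType) (N k : nat) (A : set 'rV[Cplx R]_N)
    (D : set 'rV[Cplx R]_k) (psi : 'rV[Cplx R]_k -> 'rV[Cplx R]_N)
    (B : set 'rV[Cplx R]_N) (chi : 'rV[Cplx R]_N -> 'rV[Cplx R]_k) :=
  [/\ open D /\ open B, holo D psi, holo B chi, psi @` D = A `&` B &
      forall t, D t -> chi (psi t) = t].

Section AnalyticSets.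
(* par is a family of inverse charts, each of them defined on all of C^N, of a
   complex manifold X of dimension N. *)
Variables (R : realType) (X : topologicalType) (N : nat) (I : Type).
Variable par : I -> 'rV[Cplx R]_N -> X.
Implicit Types (A Om : set X) (w : X).

Definition analytic_subset Om A := A `<=` Om /\
  forall i z, Om (par i z) -> exists (B : set 'rV[Cplx R]_N) (k : nat)
    (F : 'rV[Cplx R]_N -> 'rV[Cplx R]_k),
    [/\ open B, B z, holo B F & forall y, B y -> (A (par i y) <-> F y = 0)].

Definition param_at A w (k : nat) (i : I) (D : set 'rV[Cplx R]_k)
    (psi : 'rV[Cplx R]_k -> 'rV[Cplx R]_N) (t : 'rV[Cplx R]_k) :=
  [/\ exists B chi, local_param (par i @^-1` A) D psi B chi, D t &
      par i (psi t) = w].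

Definition regular_at A w (k : nat) :=
  exists i (D : set 'rV[Cplx R]_k) psi t, param_at A w i D psi t.

Definition reg A := [set w | exists k, regular_at A w k].

(* The dimension of an analytic set is that of its regular points, which form
   a dense subset. *)
Definition dim_at A w (k : nat) :=
  (forall U, open U -> U w -> exists2 w', U w' & regular_at A w' k) /\
  exists U, [/\ open U, U w &
    forall w' l, U w' -> regular_at A w' l -> (l <= k)%N].

Definition pure_dim A (k : nat) := forall w, A w -> dim_at A w k.

Definition dim_le A (k : nat) := forall w l, regular_at A w l -> (l <= k)%N.

End AnalyticSets.

Definition chart_open (R : realType) (X : Type) (N : nat) (I : Type)
  (par : I -> 'rV[Cplx R]_N -> X) (U : set X) := forall i, open (par i @^-1` U).

Section ProjectiveSpace.
Variables (R : realType) (n : nat).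

(* Lines of C^(n+1). The dual projective space is the same type: the point
   spanned by a nonzero covector A stands for the hyperplane
   \sum_k A_k X_k = 0. *)
Record projspace := Projspace {
  line : {vspace 'rV[Cplx R]_n.+1};
  line_dim : \dim line = 1%N }.

Definition aff_row (i : 'I_n.+1) (x : 'rV[Cplx R]_n) : 'rV[Cplx R]_n.+1 :=
  \row_k (if unlift i k is Some l then x 0 l else 1).

Lemma aff_row_dim i x : \dim <[aff_row i x]>%VS = 1%N.
Proof.
rewrite dim_vline; have [e|//] := eqVneq (aff_row i x) 0.
by move/rowP/(_ i): e => /eqP; rewrite !mxE unlift_none oner_eq0.
Qed.

(* Inverse of the affine chart X_i != 0, where x_l = X_(lift i l) / X_i. *)
Definition aff i x : projspace := Projspace (aff_row_dim i x).

Definition incident (x h : projspace) := forall X A : 'rV[Cplx R]_n.+1,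
  X \in line x -> A \in line h -> \sum_k X 0 k * A 0 k = 0.

Definition hyperplane (h : projspace) : set projspace := [set x | incident x h].

(* P(T^*P_n): the cotangent space at the line L is, up to the twist by L, the
   annihilator of L in the dual of C^(n+1), so that a contact element at x is
   the same thing as a projective hyperplane passing through x (the one to
   which it is tangent). *)
Record contact := Contact {
  base : projspace;
  dir : projspace;
  contact_inc : incident base dir }.

(* dx_j - \sum_a p_a dx_a evaluated at the vector u, where a runs over the
   indices different from j, listed by lift j. *)
Definition eta (j : 'I_n) (p : 'rV[Cplx R]_n.-1) (u : 'rV[Cplx R]_n) : Cplx R :=
  u 0 j - \sum_a p 0 a * u 0 (lift j a).

(* dx_j - \sum_a p_a dx_a has exterior derivative \sum_a dx_a /\ dp_a; here
   v = (u, q) and v' = (u', q') are vectors in the coordinates (x, p). *)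
Definition deta (j : 'I_n) (v v' : 'rV[Cplx R]_(n + n.-1)) : Cplx R :=
  \sum_a (lsubmx v 0 (lift j a) * rsubmx v' 0 a
          - rsubmx v 0 a * lsubmx v' 0 (lift j a)).

(* Projective covector of the affine hyperplane eta j p (y - x) = 0. *)
Definition con_row (i : 'I_n.+1) (j : 'I_n) (x : 'rV[Cplx R]_n)
    (p : 'rV[Cplx R]_n.-1) : 'rV[Cplx R]_n.+1 :=
  \row_k (if unlift i k is Some l then eta j p (delta_mx 0 l)
          else - eta j p x).

Lemma eta_sum j p u : eta j p u = \sum_l u 0 l * eta j p (delta_mx 0 l).
Proof.
rewrite (bigD1_ord j) //= /eta; congr (_ + _).
  rewrite mxE !eqxx big1 ?subr0 ?mulr1 // => a _.
  by rewrite mxE eqxx eq_sym (negPf (neq_lift j a)) mulr0.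
rewrite -sumrN; apply: eq_bigr => a _.
rewrite mxE eqxx (negPf (neq_lift j a)) sub0r (bigD1 a) //= mxE !eqxx.
rewrite mulr1 big1 ?addr0 ?mulrN 1?mulrC // => b ba.
by rewrite mxE eqxx (inj_eq lift_inj) (negPf ba) mulr0.
Qed.

Lemma con_row_dim i j x p : \dim <[con_row i j x p]>%VS = 1%N.
Proof.
rewrite dim_vline; have [e|//] := eqVneq (con_row i j x p) 0.
move/rowP/(_ (lift i j)): e => /eqP; rewrite !mxE liftK /eta !mxE !eqxx.
rewrite big1 ?subr0 ?oner_eq0 // => a _.
by rewrite !mxE eq_sym (negPf (neq_lift j a)) mulr0.
Qed.

Lemma con_inc i j x p : incident (aff i x) (Projspace (con_row_dim i j x p)).
Proof.
move=> X A /vlineP[a ->] /vlineP[b ->].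
rewrite (bigD1_ord i) //= !mxE unlift_none mulr1 (eta_sum j p x).
rewrite mulrN mulrN mulr_sumr mulr_sumr addrC; apply/eqP.
rewrite subr_eq0; apply/eqP/eq_bigr => l _; rewrite !mxE liftK.
by rewrite mulrACA -!mulrA.
Qed.

(* Inverse of the chart (x, p) of the manifold of contact elements, built on
   the affine chart ij.1 of P_n: kernel of eta ij.2 p at x. *)
Definition con (ij : 'I_n.+1 * 'I_n) (z : 'rV[Cplx R]_(n + n.-1)) : contact :=
  Contact (@con_inc ij.1 ij.2 (lsubmx z) (rsubmx z)).

HB.instance Definition _ := gen_eqMixin projspace.
HB.instance Definition _ := gen_choiceMixin projspace.
HB.instance Definition _ := gen_eqMixin contact.
HB.instance Definition _ := gen_choiceMixin contact.

Lemma chart_openT X N I (par : I -> 'rV[Cplx R]_N -> X) : chart_open par setT.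
Proof. by move=> i; rewrite preimage_setT; exact: openT. Qed.

Lemma chart_openI X N I (par : I -> 'rV[Cplx R]_N -> X) :
  setI_closed (chart_open par).
Proof. by move=> A B oA oB i; rewrite preimage_setI; exact: openI. Qed.

Lemma chart_open_bigU X N I (par : I -> 'rV[Cplx R]_N -> X) J
    (f : J -> set X) : (forall j, chart_open par (f j)) ->
  chart_open par (\bigcup_j f j).
Proof.
by move=> oF i; rewrite preimage_bigcup; apply: bigcup_open => j _; exact: oF.
Qed.

HB.instance Definition _ := @isOpenTopological.Build projspace (chart_open aff)
  (@chart_openT _ _ _ aff) (@chart_openI _ _ _ aff)
  (@chart_open_bigU _ _ _ aff).
HB.instance Definition _ := @isOpenTopological.Build contact (chart_open con)
  (@chart_openT _ _ _ con) (@chart_openI _ _ _ con)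
  (@chart_open_bigU _ _ _ con).

End ProjectiveSpace.

Arguments projspace : clear implicits.
Arguments contact : clear implicits.
Arguments aff {R n}.
Arguments con {R n}.

Section Webs.
Variables (R : realType) (n : nat).
Implicit Types (M : set (projspace R n)) (W : set (contact R n)) (d : nat).

Definition etale_at W (w : contact R n) :=
  exists ij (D : set 'rV[Cplx R]_n) psi t, param_at con W w ij D psi t /\
    bijective (fun v => lsubmx ('d psi t v)).

Definition critical W := [set w | W w /\ ~ etale_at W w].

Definition caustic W := @base R n @` critical W.

Definition M0 M W := M `\` caustic W.

Definition W0 M W := W `&` (@base R n @^-1` M0 M W).

Definition integrable W := forall w k ij (D : set 'rV[Cplx R]_k) psi t,
  param_at con W w ij D psi t -> forall v1 v2 v3,
  let dpsi v := 'd psi t v : 'rV[Cplx R]_(n + n.-1) in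
  let e v := eta ij.2 (rsubmx (psi t)) (lsubmx (dpsi v)) in
  let de v v' := deta ij.2 (dpsi v) (dpsi v') in
  e v1 * de v2 v3 - e v2 * de v1 v3 + e v3 * de v1 v2 = 0.

(* The contact elements form a Hausdorff space, so the images of finitely many
   pairwise disjoint continuous sections are the sheets of a covering. *)
Definition covering d M W := forall m, M0 M W m ->
  exists (U : set (projspace R n)) (s : 'I_d -> projspace R n -> contact R n),
    [/\ open U, U m, U `<=` M0 M W,
        forall k y, U y -> [/\ {for y, continuous (s k)}, base (s k y) = y &
          forall l, s k y = s l y -> k = l] &
        forall w, U (base w) -> (W0 M W w <-> exists k, w = s k (base w))].

(* Intersection multiplicity at w of W with the fibre through w, as the local
   degree at w of the projection of W: the number of points of W close to w
   over a point of M0 M W close to base w. *)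
Definition fibre_mult M W (w : contact R n) (k : nat) :=
  exists V : set (contact R n), [/\ open V, V w &
    forall V', open V' -> V' w -> V' `<=` V -> exists U : set (projspace R n),
      [/\ open U, U (base w) & forall m, U m -> M0 M W m ->
          (W `&` V' `&` (@base R n @^-1` [set m]) #= `I_k)%card]].

Definition fibre_degree d M W := forall m, M m ->
  exists (s : seq (contact R n)) (mu : contact R n -> nat),
    [/\ uniq s, forall w, w \in s <-> W w /\ base w = m,
        forall w, w \in s -> (0 < mu w)%N /\ fibre_mult M W w (mu w) &
        (\sum_(w <- s) mu w = d)%N].

Record web d M W : Prop := Web {
  web_analytic : analytic_subset con (@base R n @^-1` M) W;
  web_dim : pure_dim con W n;
  web_surj : @base R n @` W = M;
  web_integrable : integrable W;
  web_covering : covering d M W;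
  web_critical : dim_le con (critical W) n.-1;
  web_degree : fibre_degree d M W }.

(* S is near y a hypersurface whose tangent space at y is the contact element
   w. *)
Definition tangent_at (S : set (projspace R n)) (y : projspace R n)
    (w : contact R n) :=
  exists ij z (D : set 'rV[Cplx R]_n.-1) psi t,
    [/\ w = con ij z, param_at aff S y ij.1 D psi t &
        forall v, eta ij.2 (rsubmx z) ('d psi t v) = 0].

(* S `&` M0 M W is locally an integral hypersurface of the foliation of M
   attached to some sheet s of the web. S is not required to be closed in M or
   maximal, so that every plaque of the web is a leaf. Connectedness and
   density of S `&` M0 M W make S an irreducible hypersurface which is not
   contained in the caustic, where being a leaf has no meaning. *)
Definition leaf M W (S : set (projspace R n)) :=
  [/\ exists Om, [/\ open Om, Om `<=` M & analytic_subset aff Om S],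
      pure_dim aff S n.-1,
      S `&` M0 M W !=set0 /\ connected (S `&` M0 M W),
      S `<=` closure (S `&` M0 M W) &
      forall x, (S `&` M0 M W) x ->
        exists (U : set (projspace R n)) (s : projspace R n -> contact R n),
          [/\ open U, U x, U `<=` M0 M W,
              forall y, U y ->
                [/\ {for y, continuous s}, W (s y) & base (s y) = y] &
              forall y, (S `&` U) y -> tangent_at S y (s y)]].

Definition linear_web d M W := web d M W /\
  forall S, leaf M W S -> exists h, S `<=` hyperplane h.

(* chi is a system of holomorphic coordinates, with inverse psi, on the
   neighbourhood aff i @` B of m. *)
Definition totally_linearizable M W := forall m, M m ->
  exists i (D B : set 'rV[Cplx R]_n) (psi chi : 'rV[Cplx R]_n -> 'rV[Cplx R]_n),
    [/\ local_param setT D psi B chi, (aff i @` B) m, aff i @` B `<=` M &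
        forall S, leaf M W S -> S `<=` aff i @` B ->
          exists (a : 'rV[Cplx R]_n) (b : Cplx R), a != 0 /\
            forall z, B z -> S (aff i z) -> \sum_l a 0 l * chi z 0 l = b].

(* The irreducible components of W are the closures, in the manifold of
   contact elements over M, of the connected components of its regular
   part. *)
Definition irreducible_component M W (C : set (contact R n)) :=
  exists2 w, reg con W w & C = closure (connected_component (reg con W) w)
                               `&` (@base R n @^-1` M).

(* The foliation ker eta of the regular part of C is non-singular at w: near
   w it is the kernel of a nowhere vanishing holomorphic 1-form omega. The
   restriction of eta is f * omega, with f not identically zero; f may vanish
   along a hypersurface, as it does on the critical set of the web of tangents
   to a conic, without the foliation being singular there. *)
Definition nonsingular_at (C : set (contact R n)) (w : contact R n) :=
  exists k ij (D : set 'rV[Cplx R]_k) psi t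
         (omega : 'rV[Cplx R]_k -> 'rV[Cplx R]_k)
         (f : 'rV[Cplx R]_k -> (Cplx R)^o),
    [/\ param_at con C w ij D psi t, holo D omega /\ holo D f,
        forall s, D s -> omega s != 0,
        forall s v, D s -> eta ij.2 (rsubmx (psi s)) (lsubmx ('d psi s v)) =
                           f s * \sum_l omega s 0 l * v 0 l &
        forall E, open E -> E `<=` D -> E !=set0 ->
          exists2 s, E s & f s != 0].

Definition dicritical_on (C : set (contact R n)) :=
  forall w, reg con C w -> nonsingular_at C w.

Definition dicritical M W :=
  forall C, irreducible_component M W C -> dicritical_on C.

Definition homogeneous_poly (e : nat) (f : 'rV[Cplx R]_n.+1 -> Cplx R) :=
  exists c : {ffun 'I_n.+1 -> 'I_e.+1} -> Cplx R, forall A,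
    f A = \sum_(m : {ffun 'I_n.+1 -> 'I_e.+1} | (\sum_k m k == e)%N)
            c m * \prod_k A 0 k ^+ m k.

Definition algebraic_subset (Z : set (projspace R n)) :=
  exists N (e : 'I_N -> nat) (f : 'I_N -> 'rV[Cplx R]_n.+1 -> Cplx R),
    (forall l, homogeneous_poly (e l) (f l)) /\
    forall h, Z h <-> forall A l, A \in line h -> f l A = 0.

(* The hyperplanes of the dual projective space are the points x of P_n; a
   generic one meets a curve of degree d in d points. *)
Definition dual_curve d (Z : set (projspace R n)) :=
  [/\ algebraic_subset Z, pure_dim aff Z 1 &
      exists G : set (projspace R n), [/\ open G, dense G &
        forall x, G x -> (Z `&` [set h | incident x h] #= `I_d)%card]].

(* A hyperplane contained in the caustic is not a leaf: this happens for
   finitely many elements of the curve, for instance for its nodes. *)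
Definition algebraic_web d W := web d setT W /\
  exists Z, [/\ dual_curve d Z,
    forall S, leaf setT W S -> exists2 h, Z h & S `<=` hyperplane h &
    forall h, Z h -> hyperplane h `&` M0 setT W !=set0 ->
      leaf setT W (hyperplane h)].

End Webs.

(* Main.v *)
(* Above the complement of the caustic, W is locally a graph p = g(x). The
   kernel of eta integrates there, by Frobenius, into plaques, which are leaves
   and hence pieces of hyperplanes; so p is constant along the plaques, that
   is, every dp_a vanishes on the kernel of eta. Such points are dense in W:
   the critical set has smaller dimension, and the caustic has empty interior
   because at most d disjoint sheets of W can lie over an open subset of M.
   Given a parametrization psi of the regular part of an irreducible component,
   the minors of the pullbacks of eta and dp_a thus vanish on a dense set, and
   everywhere by continuity. Where the pullback of eta vanishes, that of some
   dp_a does not, since otherwise d psi would embed C^n into the kernel of eta,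
   of dimension n - 1; so eta is a multiple of dp_a, which defines the
   foliation without singularity. Total linearizability holds in the affine
   coordinates themselves.
   As holomorphy means mere differentiability here, Cauchy's formula is what
   gives the regularity needed by the inverse function theorem, by Frobenius
   and by the continuity argument. *)

(* A component C can be smooth at a point where W is not, for instance where two branches cross, or
   where the projection to M degenerates. No foliation of M is available there, and C may differ
   from W nearby. Hence the detour through points of C near which C coincides with W, which are
   etale and lie outside the caustic. What passes to the limit from such points is the vanishing of
   the minors of eta and dp_a, a closed condition; the inclusion of the kernel of eta in that of
   dp_a is not closed, since the kernel jumps where the pullback of eta vanishes. The caustic is not
   known beforehand to be thin, as projections may enlarge closures; only the degree of the fibres
   controls it. Cauchy's formula is needed just for the first derivative at the centre of a circle.
   Applied on every complex line through a point, it bounds and differentiates directional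
   derivatives, so that several variables are handled without power series. Real and imaginary parts
   are estimated separately, which costs factors of 2 but reduces everything to real integrals and
   the real mean value theorem. *)
Require Import Defs.
From HB Require Import structures.
From mathcomp Require Import all_boot all_order all_algebra.
From mathcomp Require Import all_classical all_reals all_analysis.
From mathcomp Require Import complex.
From mathcomp Require Import ring lra.
Set Implicit Arguments.
Unset Strict Implicit.
Unset Printing Implicit Defensive.
Import Order.TTheory GRing.Theory Num.Theory.
Import numFieldNormedType.Exports.
Local Open Scope classical_set_scope.
Local Open Scope ring_scope.

(** * The real-valued norm and the calculus of differentials *)

(* The norms of the library take their values in R[i]; nr is the same norm with
   values in R, where the order is total. *)
Definition nr (R : realType) (V : normedModType (Cplx R)) (x : V) : R :=
  complex.Re (`|x| : R[i]).

Section RealNorm.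
Variable R : realType.
Local Notation C := (Cplx R).
Implicit Types V W : normedModType C.

Lemma nrE V (x : V) : `|x| = (nr x)%:C%C :> R[i].
Proof. by rewrite /nr RRe_real //; exact/ger0_real/normr_ge0. Qed.

Lemma nr_ge0 V (x : V) : 0 <= nr x.
Proof. by rewrite -ler0c -nrE; exact: normr_ge0. Qed.
Hint Resolve nr_ge0 : core.

Lemma nrD V (x y : V) : nr (x + y) <= nr x + nr y.
Proof. by rewrite -lecR rmorphD /= -!nrE ler_normD. Qed.

Lemma nrN V (x : V) : nr (- x) = nr x.
Proof. by rewrite /nr normrN. Qed.

Lemma nrB V (x y : V) : nr (x - y) <= nr x + nr y.
Proof. by rewrite -(nrN y) nrD. Qed.

Lemma nr_dist V (x y : V) : nr (x - y) = nr (y - x).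
Proof. by rewrite -opprB nrN. Qed.

Lemma nr_tri V (y x z : V) : nr (x - z) <= nr (x - y) + nr (y - z).
Proof. by rewrite -[x - z](subrKA y) nrD. Qed.

Lemma nr0 V : nr (0 : V) = 0.
Proof. by rewrite /nr normr0. Qed.

Lemma nr_eq0 V (x : V) : (nr x == 0) = (x == 0).
Proof.
apply/eqP/eqP => [x0|->]; last exact: nr0.
by apply/eqP; rewrite -normr_eq0 [`|x|]nrE x0.
Qed.

Lemma nr_gt0 V (x : V) : (0 < nr x) = (x != 0).
Proof. by rewrite lt_def nr_ge0 andbT nr_eq0. Qed.

Lemma nrZ V (a : C) (x : V) : nr (a *: x) = nr a * nr x.
Proof. by apply: complexI; rewrite -nrE rmorphM /= -!nrE normrZ. Qed.

Lemma nrM (a b : C) : nr (a * b) = nr a * nr b.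
Proof. by apply: complexI; rewrite -nrE rmorphM /= -!nrE normrM. Qed.

Lemma nr1 : nr (1 : C) = 1.
Proof. by apply: complexI; rewrite -nrE normr1. Qed.

Lemma nr_real (r : R) : nr (r%:C%C : C) = `|r|.
Proof. by rewrite /nr normc_def /= expr0n addr0 sqrtr_sqr. Qed.

Lemma nr_sqrt (z : C) :
  nr z = Num.sqrt (complex.Re z ^+ 2 + complex.Im z ^+ 2).
Proof. by rewrite /nr normc_def. Qed.

Lemma Re_le_nr (z : C) : `|complex.Re z| <= nr z.
Proof.
rewrite nr_sqrt -sqrtr_sqr ler_sqrt ?lerDl ?sqr_ge0 //.
by rewrite addr_ge0 ?sqr_ge0.
Qed.

Lemma Im_le_nr (z : C) : `|complex.Im z| <= nr z.
Proof.
rewrite nr_sqrt -sqrtr_sqr ler_sqrt ?lerDr ?sqr_ge0 //.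
by rewrite addr_ge0 ?sqr_ge0.
Qed.

Lemma nr_i : nr ('i%C : C) = 1.
Proof. by rewrite nr_sqrt /= expr0n add0r expr1n sqrtr1. Qed.

Lemma nr_le_ReIm (z : C) : nr z <= `|complex.Re z| + `|complex.Im z|.
Proof.
rewrite {1}[z]complexE (le_trans (nrD _ _)) // nrM nr_i mul1r.
by rewrite !nr_real.
Qed.

Lemma nr_sum V (I : Type) (r : seq I) (P : pred I) (F : I -> V) :
  nr (\sum_(i <- r | P i) F i) <= \sum_(i <- r | P i) nr (F i).
Proof.
elim/big_ind2: _ => [|x a y b xa yb|//]; first by rewrite nr0.
by rewrite (le_trans (nrD _ _)) // lerD.
Qed.

Lemma nr_coord m n (A : 'M[C]_(m, n)) i j : nr (A i j) <= nr A.
Proof.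
rewrite leNgt; apply/negP; move: {2}(nr _) (erefl (nr (A i j))) => e eE Ae.
have : ball (0 : 'M[C]_(m, n)) (e%:C%C : C) A.
  by rewrite mx_norm_ball /ball_ /= sub0r normrN nrE ltcR -eE.
by case=> _ /(_ i j); rewrite -ball_normE /= mxE sub0r normrN nrE ltcR eE ltxx.
Qed.

Lemma nr_mx_le m n (A : 'M[C]_(m, n)) e : 0 <= e ->
  (forall i j, nr (A i j) <= e) -> nr A <= e.
Proof.
move=> e0 Ae; have [A0|/mx_norm_neq0[ij Aij]] := eqVneq (mx_norm A) 0.
  by rewrite (mx_norm_eq0 A0) nr0.
suff -> : nr A = nr (A ij.1 ij.2) by [].
by rewrite /nr -Aij.
Qed.

Lemma nr_mx_lt m n (A : 'M[C]_(m, n)) e : 0 < e ->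
  (forall i j, nr (A i j) < e) -> nr A < e.
Proof.
move=> e0 Ae; have [A0|/mx_norm_neq0[ij Aij]] := eqVneq (mx_norm A) 0.
  by rewrite (mx_norm_eq0 A0) nr0.
suff -> : nr A = nr (A ij.1 ij.2) by [].
by rewrite /nr -Aij.
Qed.

Lemma nbhs_nrP V (x : V) (P : set V) :
  nbhs x P <-> exists2 d : R, 0 < d & forall y, nr (y - x) < d -> P y.
Proof.
split=> [/nbhs_normP[/= e e0 eP]|[d d0 dP]]; last first.
  apply/nbhs_normP; exists (d%:C%C : C); first by rewrite /= ltcR.
  by move=> y /=; rewrite distrC nrE ltcR => /dP.
have er : e = (complex.Re (e : R[i]))%:C%C by rewrite RRe_real // gtr0_real.
exists (complex.Re (e : R[i])); first by rewrite -ltcR -er.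
by move=> y yx; apply: eP; rewrite /= distrC nrE er ltcR.
Qed.

Lemma nr_open V (x : V) (d : R) : open [set y | nr (y - x) < d].
Proof.
rewrite openE => y /= yd; apply/nbhs_nrP; exists (d - nr (y - x)).
  by rewrite subr_gt0.
by move=> z zy; rewrite /= (le_lt_trans (nr_tri y z x)) // -ltrBrDr.
Qed.

Lemma continuous_nrP V W (f : V -> W) x : {for x, continuous f} <->
  forall e : R, 0 < e -> exists2 d : R, 0 < d &
    forall y, nr (y - x) < d -> nr (f y - f x) < e.
Proof.
split=> [fx e e0|fx A /nbhs_nrP[e e0 eA]].
  have /fx/nbhs_nrP[d d0 dP] : nbhs (f x) [set y | nr (y - f x) < e].
    by apply/nbhs_nrP; exists e.
  by exists d.
have [d d0 dP] := fx e e0.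
by apply/nbhs_nrP; exists d => // y /dP/eA.
Qed.

(** Neither linearity nor continuity of [L] is built in, so that the estimate can be proved first
    and the linear structure supplied afterwards. *)
Definition has_diff V W (f : V -> W) (x : V) (L : V -> W) :=
  forall e : R, 0 < e -> exists2 d : R, 0 < d &
    forall h, nr h < d -> nr (f (x + h) - f x - L h) <= e * nr h.

Lemma diff_has_diff V W (f : V -> W) x :
  differentiable f x -> has_diff f x ('d f x).
Proof.
move=> /diff_locallyP[_ /eqaddoP fx] e e0.
have /fx/nbhs_nrP[d d0 dP] : 0 < (e%:C%C : C) by rewrite ltcR.
exists d => // h hd; have := dP h; rewrite subr0 => /(_ hd) /=.
rewrite /shift /cst /= [`|id h|]nrE -rmorphM /= => H.
rewrite -lecR -nrE; apply: le_trans H.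
by rewrite -[leRHS]/(`|f (h + x) - (f x + 'd f x h)|) (addrC h) opprD addrA.
Qed.

Lemma has_diffP V W (f : V -> W) x (L : {linear V -> W}) :
  continuous L -> has_diff f x L ->
  differentiable f x /\ 'd f x = L :> (V -> W).
Proof.
move=> Lc fL; have fo : f \o shift x = cst (f x) + L +o_ 0 id.
  apply/eqaddoP => e e0.
  have er : e = (complex.Re (e : R[i]))%:C%C by rewrite RRe_real // gtr0_real.
  have /fL[d d0 dP] : 0 < complex.Re (e : R[i]) by rewrite -ltcR -er.
  apply/nbhs_nrP; exists d => // h; rewrite subr0 => /dP.
  rewrite -lecR rmorphM /= -er -[(nr h)%:C%C]nrE -nrE => H; apply: le_trans H.
  by rewrite -[leLHS]/(`|f (h + x) - (f x + L h)|) opprD addrA (addrC h).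
have dL := diff_unique Lc fo.
by split=> //; apply/diff_locallyP; rewrite dL.
Qed.

Lemma linear_bounded_continuous V W (L : {linear V -> W}) (K : R) :
  (forall h, nr (L h) <= K * nr h) -> continuous L.
Proof.
move=> LK x; apply/continuous_nrP => e e0.
have K0 : 0 < `|K| + 1 by rewrite ltr_wpDl.
exists (e / (`|K| + 1)); first by rewrite divr_gt0.
move=> y; rewrite ltr_pdivlMr // => yx; rewrite -linearB.
rewrite (le_lt_trans (LK _)) // (le_lt_trans _ yx) // mulrC ler_wpM2l //.
by rewrite (le_trans (ler_norm _)) // lerDl.
Qed.

Lemma linear_rV_bounded n W (L : {linear 'rV[C]_n -> W}) :
  exists2 K : R, 0 < K & forall h, nr (L h) <= K * nr h.
Proof.
exists (1 + \sum_i nr (L (delta_mx 0 i))).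
  by rewrite ltr_pwDl // sumr_ge0.
move=> h; rewrite {1}[h]row_sum_delta linear_sum (le_trans (nr_sum _ _ _)) //.
rewrite mulrDl mul1r ler_wpDl // mulr_suml ler_sum // => i _.
by rewrite linearZ nrZ mulrC ler_wpM2l // nr_coord.
Qed.

Lemma linear_rV_continuous n W (L : {linear 'rV[C]_n -> W}) : continuous L.
Proof.
by have [K _ LK] := linear_rV_bounded L; exact: linear_bounded_continuous LK.
Qed.

(** In finite dimension a linear candidate is automatically continuous. *)
Lemma has_diff_rV n W (f : 'rV[C]_n -> W) x (L : 'rV[C]_n -> W) :
  linear L -> has_diff f x L ->
  differentiable f x /\ 'd f x = L :> ('rV[C]_n -> W).
Proof.
move=> linL fL.
pose LM := GRing.isLinear.Build _ _ _ _ _ linL.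
pose LL : {linear 'rV[C]_n -> W} := HB.pack L LM.
by apply: (@has_diffP _ _ f x LL) => //; exact: linear_rV_continuous.
Qed.

Lemma has_diff_C W (f : C -> W) x (c : W) :
  has_diff f x (fun h => h *: c) ->
  differentiable f x /\ forall h, 'd f x h = h *: c.
Proof.
move=> fL; have lin : linear (fun h : C => h *: c).
  by move=> a u v; rewrite scalerDl scalerA.
pose LM := GRing.isLinear.Build _ _ _ _ _ lin.
pose LL : {linear C -> W} := HB.pack (fun h : C => h *: c) LM.
have [|//|fx dE] := @has_diffP _ _ f x LL.
  apply: (@linear_bounded_continuous _ _ LL (nr c)) => h.
  by rewrite nrZ mulrC.
by split=> // h; rewrite dE.
Qed.

(** Quadratic remainders are the form in which [taylor2] gives differentiability: the constant is
    uniform in a parameter, hence survives integrals and limits. *)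
Lemma has_diff_sqr V W (f : V -> W) x (L : V -> W) (K d : R) : 0 < d ->
  (forall h, nr h < d -> nr (f (x + h) - f x - L h) <= K * nr h ^+ 2) ->
  has_diff f x L.
Proof.
move=> d0 fK e e0; have K0 : 0 < `|K| + 1 by rewrite ltr_wpDl.
exists (Num.min d (e / (`|K| + 1))).
  by rewrite lt_min d0 divr_gt0.
move=> h; rewrite lt_min => /andP[/fK fh]; rewrite ltr_pdivlMr // => he.
rewrite (le_trans fh) // expr2 mulrA ler_wpM2r // (le_trans _ (ltW he)) //.
rewrite mulrC ler_wpM2l // (le_trans (ler_norm _)) // lerDl //.
Qed.

Lemma differentiable_rVP V n (f : V -> 'rV[C]_n) x :
  differentiable f x <-> forall i, differentiable (fun y => f y 0 i : C) x.
Proof.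
split=> [fx i|fx].
  have cx := @differentiable_coord C 1 n (f x) 0 i.
  exact: (@differentiable_comp C V _ C f (fun N : 'rV[C]_n => N 0 i) x fx cx).
have -> : f = fun y => \sum_i (f y 0 i) *: delta_mx 0 i.
  by apply/funext => y; rewrite -row_sum_delta.
have -> : (fun y => \sum_i (f y 0 i) *: delta_mx 0 i) =
    \sum_i (fun y => (f y 0 i) *: (delta_mx 0 i : 'rV[C]_n)).
  by apply/funext => y; rewrite fct_sumE.
apply: (@differentiable_sum C V 'rV[C]_n n
  (fun i y => f y 0 i *: (delta_mx 0 i : 'rV[C]_n))) => i.
exact: (@differentiableZl C V 'rV[C]_n (fun y => f y 0 i) _ x (fx i)).
Qed.

Lemma diff_coord V n (f : V -> 'rV[C]_n) x v i :
  differentiable f x -> 'd f x v 0 i = 'd (fun y => f y 0 i : C) x v.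
Proof.
move=> fx; have cx := @differentiable_coord C 1 n (f x) 0 i.
have lin : linear (fun N : 'rV[C]_n => N 0 i : C) by move=> a u w; rewrite !mxE.
pose LM := GRing.isLinear.Build _ _ _ _ _ lin.
pose LL : {linear 'rV[C]_n -> C} := HB.pack (fun N : 'rV[C]_n => N 0 i : C) LM.
have LLc : continuous LL by exact: linear_rV_continuous.
have E : 'd (LL \o f) x = 'd LL (f x) \o 'd f x :> (V -> C).
  by apply: diff_comp => //; exact: linear_differentiable.
have -> : 'd (fun y => f y 0 i : C) x v = 'd (LL \o f) x v by [].
by rewrite E -[RHS]/('d LL (f x) ('d f x v)) (diff_lin (f x) LLc).
Qed.

Lemma diff_compE (U V W : normedModType C) (f : U -> V) (g : V -> W) x :
  differentiable f x -> differentiable g (f x) ->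
  differentiable (fun y => g (f y)) x /\
  forall v, 'd (fun y => g (f y)) x v = 'd g (f x) ('d f x v).
Proof.
move=> fx gx; split; first exact: (@differentiable_comp _ _ _ _ f g x fx gx).
by move=> v; exact: (congr1 (fun F : U -> W => F v) (@diff_comp _ _ _ _ f g x fx gx)).
Qed.

Lemma diff_addE V W (f g : V -> W) x :
  differentiable f x -> differentiable g x ->
  differentiable (fun y => f y + g y) x /\
  forall v, 'd (fun y => f y + g y) x v = 'd f x v + 'd g x v.
Proof.
move=> fx gx; split; first exact: (@differentiableD _ _ _ f g x fx gx).
by move=> v; exact: (congr1 (fun F : V -> W => F v) (@diffD _ _ _ f g x fx gx)).
Qed.

Lemma diff_subE V W (f g : V -> W) x :
  differentiable f x -> differentiable g x ->
  differentiable (fun y => f y - g y) x /\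
  forall v, 'd (fun y => f y - g y) x v = 'd f x v - 'd g x v.
Proof.
move=> fx gx; split; first exact: (@differentiableB _ _ _ f g x fx gx).
by move=> v; exact: (congr1 (fun F : V -> W => F v) (@diffB _ _ _ f g x fx gx)).
Qed.

Lemma diff_mulE V (f g : V -> C) x :
  differentiable f x -> differentiable g x ->
  differentiable (fun y => f y * g y : C) x /\
  forall v, 'd (fun y => f y * g y : C) x v = f x * 'd g x v + g x * 'd f x v.
Proof.
move=> fx gx; split; first exact: (@differentiableM _ _ f g x fx gx).
by move=> v; exact: (congr1 (fun F : V -> C => F v) (@diffM _ _ f g x fx gx)).
Qed.

Lemma diff_invE V (f : V -> C) x : differentiable f x -> f x != 0 ->
  differentiable (fun y => (f y)^-1 : C) x.
Proof. by move=> fx f0; exact: (@differentiableV _ _ f x fx f0). Qed.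

Local Opaque diff.

Lemma diff_sumE V W n (f : 'I_n -> V -> W) x :
  (forall i, differentiable (f i) x) ->
  differentiable (fun y => \sum_i f i y) x /\
  forall v, 'd (fun y => \sum_i f i y) x v = \sum_i 'd (f i) x v.
Proof.
move=> fx; suff H (s : seq 'I_n) : differentiable (fun y => \sum_(i <- s) f i y) x /\
  forall v, 'd (fun y => \sum_(i <- s) f i y) x v = \sum_(i <- s) 'd (f i) x v by exact: H.
elim: s => [|i s [IHd IHE]].
  have -> : (fun y => \sum_(i <- [::]) f i y) = cst 0 by apply/funext => y; rewrite big_nil.
  split; first exact: differentiable_cst.
  move=> v; rewrite big_nil.
  exact: (congr1 (fun F : V -> W => F v) (@diff_cst _ V W 0 x)).
have -> : (fun y => \sum_(j <- i :: s) f j y) = fun y => f i y + \sum_(j <- s) f j y.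
  by apply/funext => y; rewrite big_cons.
have [cd cE] := diff_addE (fx i) IHd.
split.
  exact: cd.
move=> v.
rewrite big_cons.
rewrite -IHE.
exact: cE.
Qed.

Lemma diff_linE n W (L : 'rV[C]_n -> W) x : linear L ->
  differentiable L x /\ forall v, 'd L x v = L v.
Proof.
move=> lin; have [|fd dE] := @has_diff_rV n W L x L lin; last first.
  by split=> [|v]; [exact: fd|rewrite dE].
pose LM := GRing.isLinear.Build _ _ _ _ _ lin.
pose LL : {linear 'rV[C]_n -> W} := HB.pack L LM.
move=> e e0; exists 1 => // h _; have E : L (x + h) = L x + L h := linearD LL x h.
rewrite E (addrC (L x)) addrK.
by rewrite subrr nr0 mulr_ge0 // ltW.
Qed.

(** Differentiability bundled with a pointwise formula for the differential, so that differentials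
    of compound expressions are computed by composing lemmas. *)
Definition diff_at V W (f : V -> W) (x : V) (df : V -> W) :=
  differentiable f x /\ forall v, 'd f x v = df v.

Lemma diff_at_d V W (f : V -> W) x : differentiable f x -> diff_at f x ('d f x).
Proof. by move=> fx; split. Qed.

Lemma diff_at_eq V W (f : V -> W) x df dg :
  (forall v, df v = dg v) -> diff_at f x df -> diff_at f x dg.
Proof.
move=> E [fx fE]; split; first exact: fx.
by move=> v; exact: etrans (fE v) (E v).
Qed.

Lemma diff_at_comp (U V W : normedModType C) (f : U -> V) (g : V -> W) x df dg :
  diff_at f x df -> diff_at g (f x) dg ->
  diff_at (fun y => g (f y)) x (fun v => dg (df v)).
Proof.
move=> [fx fE] [gx gE]; have [cd cE] := diff_compE fx gx; split; first exact: cd.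
by move=> v; rewrite -(fE v); exact: etrans (cE v) (gE _).
Qed.

Lemma diff_at_add V W (f g : V -> W) x df dg :
  diff_at f x df -> diff_at g x dg ->
  diff_at (fun y => f y + g y) x (fun v => df v + dg v).
Proof.
move=> [fx fE] [gx gE]; have [cd cE] := diff_addE fx gx; split; first exact: cd.
by move=> v; rewrite -(fE v) -(gE v); exact: cE.
Qed.

Lemma diff_at_sub V W (f g : V -> W) x df dg :
  diff_at f x df -> diff_at g x dg ->
  diff_at (fun y => f y - g y) x (fun v => df v - dg v).
Proof.
move=> [fx fE] [gx gE]; have [cd cE] := diff_subE fx gx; split; first exact: cd.
by move=> v; rewrite -(fE v) -(gE v); exact: cE.
Qed.

Lemma diff_at_mul V (f g : V -> C) x df dg :
  diff_at f x df -> diff_at g x dg ->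
  diff_at (fun y => f y * g y : C) x (fun v => f x * dg v + g x * df v).
Proof.
move=> [fx fE] [gx gE]; have [cd cE] := diff_mulE fx gx; split; first exact: cd.
by move=> v; rewrite -(fE v) -(gE v); exact: cE.
Qed.

Lemma diff_at_sum V W n (f : 'I_n -> V -> W) x df :
  (forall i, diff_at (f i) x (df i)) ->
  diff_at (fun y => \sum_i f i y) x (fun v => \sum_i df i v).
Proof.
move=> fx; have [sd sE] := diff_sumE (fun i => proj1 (fx i)).
split; first exact: sd.
move=> v; apply: etrans (sE v) _; apply: eq_bigr => i _; exact: (proj2 (fx i) v).
Qed.

Lemma diff_at_cst V W (a : W) (x : V) : diff_at (fun=> a) x (fun=> 0).
Proof.
split; first exact: differentiable_cst.
by move=> v; exact: (congr1 (fun F : V -> W => F v) (@diff_cst _ V W a x)).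
Qed.

Lemma diff_at_lin n W (L : 'rV[C]_n -> W) x : linear L -> diff_at L x L.
Proof. by move=> lin; exact: diff_linE. Qed.

Lemma diff_at_id V (x : V) : diff_at id x id.
Proof.
have id_d : differentiable (id : V -> V) x by [].
split; first exact: id_d.
by move=> v; rewrite diff_val.
Qed.

Lemma diff_at_coord V n (f : V -> 'rV[C]_n) x df i :
  diff_at f x df -> diff_at (fun y => f y 0 i : C) x (fun v => df v 0 i).
Proof.
move=> [fx fE]; split; first by move/differentiable_rVP: fx.
by move=> v; rewrite -fE; exact: esym (diff_coord v i fx).
Qed.

Lemma diff_at_rV V n (f df : V -> 'rV[C]_n) x :
  (forall i, diff_at (fun y => f y 0 i : C) x (fun v => df v 0 i)) ->
  diff_at f x df.
Proof.
move=> fi; have fx : differentiable f x.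
  by apply/differentiable_rVP => i; exact: (proj1 (fi i)).
split; first exact: fx.
move=> v; apply/rowP => i; apply: etrans (diff_coord v i fx) _.
exact: (proj2 (fi i) v).
Qed.

Lemma diff_at_has V W (f : V -> W) x df : diff_at f x df -> has_diff f x df.
Proof.
move=> [fx fE] e e0; have [d d0 dP] := diff_has_diff fx e0.
by exists d => // h /dP; rewrite fE.
Qed.

Lemma diff_at_unique V W (f : V -> W) x df dg :
  diff_at f x df -> diff_at f x dg -> forall v, df v = dg v.
Proof. by move=> [_ fE] [_ gE] v; rewrite -fE -gE. Qed.

End RealNorm.
#[global] Hint Extern 0 (is_true (_ <= nr _)) => solve [apply: nr_ge0] : core.

(** * Integrals of complex-valued functions of a real variable *)

Notation Re := complex.Re.
Notation Im := complex.Im.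

Section RealIntegral.
Variable R : realType.
Implicit Types (a b c : R) (g h : R -> R).

(** Continuity relative to the segment: values outside [a, b] do not count. *)
Definition rcont a b g := forall x, a <= x <= b -> forall e : R, 0 < e ->
  exists2 d : R, 0 < d & forall y, a <= y <= b -> `|y - x| < d -> `|g y - g x| < e.

Definition rint a b g : R := \int[lebesgue_measure]_(x in `[a, b]) g x.

Lemma rcont_within a b g : rcont a b g -> {within `[a, b], continuous g}.
Proof.
move=> gc; apply/subspace_continuousP => x; rewrite /= in_itv /= => xab.
apply/cvgrPdist_lt => e e0; have [d d0 dP] := gc x xab e e0.
near=> y; rewrite distrC; apply: dP.
  have : `[a, b]%classic y by near: y; exact: withinT.
  by rewrite /= in_itv.
near: y; apply: cvg_within; apply/nbhs_normP; exists d => //= y.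
by rewrite distrC.
Unshelve. all: by end_near. Qed.

Lemma rcont_integrable a b g : rcont a b g ->
  lebesgue_measure.-integrable `[a, b] (EFin \o g).
Proof.
move=> gc; apply: continuous_compact_integrable; first exact: segment_compact.
exact: rcont_within.
Qed.

Lemma rint_split a b c g : a <= c -> c <= b -> rcont a b g ->
  rint a b g = rint a c g + rint c b g.
Proof.
move=> ac cb gc; apply/eqP; rewrite addrC -subr_eq; apply/eqP.
rewrite /rint Rintegral_itvB ?bnd_simp //; last exact: rcont_integrable.
apply: Rintegral_itv_obnd_cbnd; apply: integrableS (rcont_integrable gc) => //.
by apply: subset_itv; rewrite bnd_simp.
Qed.

Lemma rintD a b g h : rcont a b g -> rcont a b h ->
  rint a b (fun x => g x + h x) = rint a b g + rint a b h.
Proof. by move=> gc hc; rewrite /rint RintegralD //; exact: rcont_integrable. Qed.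

Lemma rintB a b g h : rcont a b g -> rcont a b h ->
  rint a b (fun x => g x - h x) = rint a b g - rint a b h.
Proof. by move=> gc hc; rewrite /rint RintegralB //; exact: rcont_integrable. Qed.

Lemma rintZ a b g r : rcont a b g -> rint a b (fun x => r * g x) = r * rint a b g.
Proof. by move=> gc; rewrite /rint RintegralZl //; exact: rcont_integrable. Qed.

Lemma rint_eq a b g h : (forall x, a <= x <= b -> g x = h x) ->
  rint a b g = rint a b h.
Proof.
move=> gh; apply: eq_Rintegral => x; rewrite inE /= in_itv /=; exact: gh.
Qed.

Lemma rint_cst a b r : a <= b -> rint a b (fun=> r) = r * (b - a).
Proof.
move=> ab; rewrite /rint Rintegral_cst //.
have -> : fine (lebesgue_measure (`[a, b]%classic : set R)) = b - a.
  rewrite lebesgue_measure_itv /= lte_fin.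
  by move: ab; rewrite le_eqVlt => /predU1P[->|->//]; rewrite ltxx subrr.
by [].
Qed.

Lemma rcont_cst a b r : rcont a b (fun=> r).
Proof. by move=> x _ e e0; exists 1 => // y _ _; rewrite subrr normr0. Qed.

Lemma rint_le a b g h : rcont a b g -> rcont a b h ->
  (forall x, a <= x <= b -> g x <= h x) -> rint a b g <= rint a b h.
Proof.
move=> gc hc gh; apply: le_Rintegral => //; first exact: rcont_integrable.
  exact: rcont_integrable.
Qed.

Lemma rint_bound a b g M : a <= b -> rcont a b g ->
  (forall x, a <= x <= b -> `|g x| <= M) -> `|rint a b g| <= M * (b - a).
Proof.
move=> ab gc gM; rewrite ler_norml -mulNr -!rint_cst //.
apply/andP; split; apply: rint_le => //; try exact: rcont_cst.
  by move=> x /gM; rewrite ler_norml => /andP[].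
by move=> x /gM; rewrite ler_norml => /andP[].
Qed.

Definition rder (H : R -> R) x (c : R) := forall e : R, 0 < e ->
  exists2 d : R, 0 < d & forall k, `|k| < d ->
    `|H (x + k) - H x - k * c| <= e * `|k|.

Lemma rder_is_derive H x c : rder H x c -> is_derive x 1 H c.
Proof.
move=> Hc; suff : h^-1 *: (H (h *: 1 + x) - H x) @[h --> 0^'] --> c.
  by move=> Hl; apply: DeriveDef; [apply/cvg_ex; exists c|apply/cvg_lim].
apply/cvgrPdist_le => e e0; have [d d0 dP] := Hc e e0.
near=> h; have h0 : h != 0 by near: h; exact: nbhs_dnbhs_neq.
have hd : `|h| < d by near: h; exact: dnbhs0_lt.
have := dP h hd; rewrite -ler_pdivrMr ?normr_gt0 // -normfV -normrM.
move=> H1; apply: le_trans H1; rewrite distrC le_eqVlt; apply/orP; left; apply/eqP.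
by congr (`| _ |); rewrite [h *: 1]mulr1 [_ *: _]mulrC (addrC h); field.
Unshelve. all: by end_near. Qed.

Lemma is_derive_rder (H : R -> R) (x c : R) : is_derive x 1 H c -> rder H x c.
Proof.
move=> [dH Hc] e e0.
have : h^-1 *: (H (h *: 1 + x) - H x) @[h --> 0^'] --> c.
  by rewrite -Hc; exact: dH.
move=> /cvgrPdist_le/(_ e e0) /nbhs_normP[d /= d0 dP].
exists d => // k kd; have [->|k0] := eqVneq k 0.
  by rewrite addr0 mul0r subr0 subrr normr0 mulr0.
have := dP k; rewrite /= sub0r normrN => /(_ kd k0).
rewrite -ler_pdivrMr ?normr_gt0 // -normfV -normrM distrC.
move=> H1; apply: le_trans H1; rewrite le_eqVlt; apply/orP; left; apply/eqP.
by congr (`| _ |); rewrite [k *: 1]mulr1 [_ *: _]mulrC (addrC k); field.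
Qed.

Lemma rder_continuous H x c : rder H x c -> {for x, continuous H}.
Proof.
move=> /rder_is_derive[dH _]; apply: differentiable_continuous.
exact/derivable1_diffP.
Qed.

Lemma rder_MVT H h a b : a <= b -> (forall x, a <= x <= b -> rder H x (h x)) ->
  exists2 x, a <= x <= b & H b - H a = h x * (b - a).
Proof.
move=> ab Hh; have [||x xab E] := @MVT_segment R H h a b ab.
- move=> x; rewrite in_itv /= => /andP[ax xb]; apply: rder_is_derive.
  by apply: Hh; rewrite !ltW.
- apply: continuous_subspace_itv => x; rewrite in_itv /= => /Hh.
  exact: rder_continuous.
- by exists x => //; move: xab; rewrite in_itv.
Qed.

Lemma rint_FTC H h a b : a <= b -> rcont a b h ->
  (forall x, a <= x <= b -> rder H x (h x)) -> rint a b h = H b - H a.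
Proof.
rewrite le_eqVlt => /predU1P[->|ab] hc Hh.
  by rewrite /rint set_itv1 Rintegral_set1 subrr.
have hH x : a <= x <= b -> {for x, continuous H}.
  by move=> /Hh/rder_continuous.
rewrite /rint /Rintegral (@continuous_FTC2 _ h H a b) //.
- exact: rcont_within.
- split.
  + move=> x; rewrite in_itv /= => /andP[ax xb].
    by have [] := rder_is_derive (Hh x _); rewrite ?ltW.
  + by apply: cvg_at_right_filter; apply: hH; rewrite lexx ltW.
  + by apply: cvg_at_left_filter; apply: hH; rewrite lexx ltW.
- move=> x; rewrite in_itv /= => /andP[ax xb].
  have xab : a <= x <= b by rewrite !ltW.
  by have [_ <-] := rder_is_derive (Hh x xab); rewrite derive1E.
Qed.

End RealIntegral.

(** * Integration and mean value inequality by real and imaginary parts *)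

Section ComplexIntegral.
Variable R : realType.
Local Notation C := (Cplx R).
Implicit Types (a b c : R) (g h : R -> C).

Definition ccont (V : normedModType C) a b (h : R -> V) := forall x, a <= x <= b -> forall e : R, 0 < e ->
  exists2 d : R, 0 < d & forall y, a <= y <= b -> `|y - x| < d -> nr (h y - h x) < e.

Lemma ccont_comp (V W : normedModType C) a b (g : V -> W) (p : R -> V) :
  ccont a b p -> (forall x, a <= x <= b -> {for p x, continuous g}) ->
  ccont a b (fun x => g (p x)).
Proof.
move=> pc gc x xab e e0; have /continuous_nrP/(_ e e0)[d d0 dP] := gc x xab.
have [d' d'0 d'P] := pc x xab d d0.
by exists d' => // y yab yx; apply: dP; exact: d'P.
Qed.

Definition cint a b h : C :=
  (rint a b (fun x => Re (h x)) +i* rint a b (fun x => Im (h x)))%C.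

Lemma ReB (z w : C) : Re (z - w) = Re z - Re w.
Proof. by case: z w => [? ?] [? ?]. Qed.

Lemma ImB (z w : C) : Im (z - w) = Im z - Im w.
Proof. by case: z w => [? ?] [? ?]. Qed.

Lemma ccont_Re a b h : ccont a b h -> rcont a b (fun x => Re (h x)).
Proof.
move=> hc x xab e e0; have [d d0 dP] := hc x xab e e0.
exists d => // y yab yx; rewrite -ReB.
by rewrite (le_lt_trans (Re_le_nr _)) // dP.
Qed.

Lemma ccont_Im a b h : ccont a b h -> rcont a b (fun x => Im (h x)).
Proof.
move=> hc x xab e e0; have [d d0 dP] := hc x xab e e0.
exists d => // y yab yx; rewrite -ImB.
by rewrite (le_lt_trans (Im_le_nr _)) // dP.
Qed.
Hint Resolve ccont_Re ccont_Im : core.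

Lemma ccont_sub a b a' b' h : a <= a' -> b' <= b ->
  ccont a b h -> ccont a' b' h.
Proof.
move=> aa bb gc x /andP[ax xb] e /(gc x _ e)[|d d0 dP].
  by rewrite (le_trans aa ax) (le_trans xb bb).
exists d => // y /andP[ay yb]; apply: dP.
by rewrite (le_trans aa ay) (le_trans yb bb).
Qed.

Lemma ccont_cst a b (z : C) : ccont a b (fun=> z).
Proof. by move=> x _ e e0; exists 1 => // y _ _; rewrite subrr nr0. Qed.

Lemma ccontD a b g h : ccont a b g -> ccont a b h ->
  ccont a b (fun x => g x + h x).
Proof.
move=> gc hc x xab e e0.
have e2 : 0 < e / 2 by rewrite divr_gt0.
have [d d0 dP] := gc x xab _ e2; have [d' d'0 dP'] := hc x xab _ e2.
exists (Num.min d d'); first by rewrite lt_min d0.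
move=> y yab; rewrite lt_min => /andP[/dP -/(_ yab) h1 /dP' -/(_ yab) h2].
have -> : g y + h y - (g x + h x) = (g y - g x) + (h y - h x) by ring.
by rewrite (le_lt_trans (nrD _ _)) // (splitr e) ltrD.
Qed.

Lemma ccontM a b g h : ccont a b g -> ccont a b h ->
  ccont a b (fun x => g x * h x).
Proof.
move=> gc hc x xab e e0.
set G := nr (g x) + 1; set H := nr (h x) + 1.
have G0 : 0 < G by rewrite ltr_wpDl.
have H0 : 0 < H by rewrite ltr_wpDl.
have eH : 0 < Num.min 1 (e / 2 / H) by rewrite lt_min ltr01 !divr_gt0.
have eG : 0 < e / 2 / G by rewrite !divr_gt0.
have [d d0 dP] := hc x xab _ eG; have [d' d'0 dP'] := gc x xab _ eH.
exists (Num.min d d'); first by rewrite lt_min d0.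
move=> y yab; rewrite lt_min => /andP[/dP -/(_ yab) h1 /dP' -/(_ yab)].
rewrite lt_min => /andP[h2 h3].
have -> : g y * h y - g x * h x = g y * (h y - h x) + (g y - g x) * h x by ring.
rewrite (le_lt_trans (nrD _ _)) // !nrM (splitr e) ler_ltD //.
  rewrite (@le_trans _ _ (G * nr (h y - h x))) // ?ler_wpM2r //.
    rewrite -[g y](subrK (g x)) (le_trans (nrD _ _)) // addrC lerD2l ltW //.
  by rewrite mulrC -ler_pdivlMr // ltW.
rewrite (@le_lt_trans _ _ (nr (g y - g x) * H)) // ?ler_wpM2l // ?lerDl //.
by rewrite -ltr_pdivlMr.
Qed.

Lemma ccontN a b h : ccont a b h -> ccont a b (fun x => - h x).
Proof.
move=> hc x xab e e0; have [d d0 dP] := hc x xab e e0.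
by exists d => // y yab yx; rewrite -opprD nrN dP.
Qed.

Lemma ccontB a b g h : ccont a b g -> ccont a b h ->
  ccont a b (fun x => g x - h x).
Proof. by move=> gc hc; exact: ccontD gc (ccontN hc). Qed.

Lemma ccont_eq a b g h : (forall x, a <= x <= b -> g x = h x) ->
  ccont a b g -> ccont a b h.
Proof.
move=> gh gc x xab e e0; have [d d0 dP] := gc x xab e e0.
by exists d => // y yab yx; rewrite -!gh // dP.
Qed.

Lemma ccont_sum a b (I : Type) (s : seq I) (F : I -> R -> C) :
  (forall i, ccont a b (F i)) -> ccont a b (fun x => \sum_(i <- s) F i x).
Proof.
move=> Fc; elim: s => [|i s IH].
  by apply: (ccont_eq _ (@ccont_cst a b 0)) => x _; rewrite big_nil.
by apply: (ccont_eq _ (ccontD (Fc i) IH)) => x _; rewrite big_cons.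
Qed.

Lemma cint_split a b c h : a <= c -> c <= b -> ccont a b h ->
  cint a b h = cint a c h + cint c b h.
Proof.
move=> ac cb hc.
by rewrite /cint (rint_split ac cb (ccont_Re hc)) (rint_split ac cb (ccont_Im hc)).
Qed.

Lemma cintD a b g h : ccont a b g -> ccont a b h ->
  cint a b (fun x => g x + h x) = cint a b g + cint a b h.
Proof.
move=> gc hc; apply/eqP; rewrite eq_complex /= -!rintD; auto.
by apply/andP; split; apply/eqP/rint_eq => x _; case: (g x) (h x) => [? ?] [? ?].
Qed.

Lemma cintZ a b z h : ccont a b h ->
  cint a b (fun x => z * h x) = z * cint a b h.
Proof.
case: z => z1 z2 hc; apply/eqP; rewrite eq_complex /=.
have rc r k : rcont a b k -> rcont a b (fun x => r * k x).
  move=> kc x xab e e0.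
  have r0 : 0 < `|r| + 1 by rewrite ltr_wpDl.
  have [|d d0 dP] := kc x xab (e / (`|r| + 1)); first by rewrite divr_gt0.
  exists d => // y yab yx; rewrite -mulrBr normrM.
  have := dP y yab yx; rewrite ltr_pdivlMr // mulrC; apply: le_lt_trans.
  by rewrite ler_wpM2r // lerDl.
rewrite -!rintZ; auto; rewrite -rintB -?rintD; auto.
by apply/andP; split; apply/eqP/rint_eq => x _; case: (h x) => [? ?].
Qed.

Lemma cintB a b g h : ccont a b g -> ccont a b h ->
  cint a b (fun x => g x - h x) = cint a b g - cint a b h.
Proof.
move=> gc hc; rewrite -mulN1r -cintZ // -cintD //; last first.
  by apply: (ccont_eq _ (ccontN hc)) => x _; rewrite mulN1r.
by congr cint; apply/funext => x; rewrite mulN1r.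
Qed.

Lemma cint_eq a b g h : (forall x, a <= x <= b -> g x = h x) ->
  cint a b g = cint a b h.
Proof.
by move=> gh; congr Complex; apply: rint_eq => x /gh ->.
Qed.

Lemma cint_cst a b z : a <= b -> cint a b (fun=> z) = z * (b - a)%:C%C.
Proof.
by move=> ab; rewrite /cint !rint_cst //; case: z => z1 z2; simpc.
Qed.

(** The factor 2 is the price of bounding the real and imaginary parts separately; it propagates to
    the Cauchy estimates. *)
Lemma cint_bound a b h M : a <= b -> ccont a b h ->
  (forall x, a <= x <= b -> nr (h x) <= M) ->
  nr (cint a b h) <= 2 * M * (b - a).
Proof.
move=> ab hc hM; rewrite (le_trans (nr_le_ReIm _)) //= -mulrA mulr_natl mulr2n.
by apply: lerD; apply: rint_bound; auto => x /hM; apply: le_trans;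
  rewrite ?Re_le_nr ?Im_le_nr.
Qed.

Definition cder (H : R -> C) x (c : C) := forall e : R, 0 < e ->
  exists2 d : R, 0 < d & forall k : R, `|k| < d ->
    nr (H (x + k) - H x - k%:C%C * c) <= e * `|k|.

Lemma ReM_real (r : R) (z : C) : Re (r%:C%C * z) = r * Re z.
Proof. by case: z => ? ? /=; rewrite mul0r subr0. Qed.

Lemma ImM_real (r : R) (z : C) : Im (r%:C%C * z) = r * Im z.
Proof. by case: z => ? ? /=; rewrite mul0r addr0. Qed.

Lemma cder_Re H x (c : C) : cder H x c -> rder (fun x => Re (H x)) x (Re c).
Proof.
move=> Hc e e0; have [d d0 dP] := Hc e e0; exists d => // k /dP.
by apply: le_trans; rewrite -ReM_real -!ReB Re_le_nr.
Qed.

Lemma cder_Im H x (c : C) : cder H x c -> rder (fun x => Im (H x)) x (Im c).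
Proof.
move=> Hc e e0; have [d d0 dP] := Hc e e0; exists d => // k /dP.
by apply: le_trans; rewrite -ImM_real -!ImB Im_le_nr.
Qed.

Lemma cint_FTC H h a b : a <= b -> ccont a b h ->
  (forall x, a <= x <= b -> cder H x (h x)) -> cint a b h = H b - H a.
Proof.
move=> ab hc Hh; apply/eqP; rewrite eq_complex /= ReB ImB.
rewrite (rint_FTC ab (ccont_Re hc) (fun x xab => cder_Re (Hh x xab))).
by rewrite (rint_FTC ab (ccont_Im hc) (fun x xab => cder_Im (Hh x xab))) !eqxx.
Qed.

(** The mean value theorem gives different intermediate points for the real and the imaginary part,
    whence again a factor 2. *)
Lemma cder_MVI H h a b M : a <= b ->
  (forall x, a <= x <= b -> cder H x (h x)) ->
  (forall x, a <= x <= b -> nr (h x) <= M) -> nr (H b - H a) <= 2 * M * (b - a).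
Proof.
move=> ab Hh hM; rewrite (le_trans (nr_le_ReIm _)) // ReB ImB.
have [x xab ->] := rder_MVT ab (fun x xab => cder_Re (Hh x xab)).
have [y yab ->] := rder_MVT ab (fun x xab => cder_Im (Hh x xab)).
rewrite -mulrA mulr_natl mulr2n !normrM (ger0_norm (_ : 0 <= b - a)) ?subr_ge0 //.
rewrite lerD // ler_wpM2r ?subr_ge0 //.
  exact: le_trans (Re_le_nr _) (hM _ xab).
exact: le_trans (Im_le_nr _) (hM _ yab).
Qed.

Lemma cder_ccont H h a b : (forall x, a <= x <= b -> cder H x (h x)) ->
  ccont a b H.
Proof.
move=> Hh x /Hh Hx e e0; have [d d0 dP] := Hx 1 ltr01.
set K := 1 + nr (h x) + 1.
have K0 : 0 < K by rewrite !ltr_wpDl // ?addr_ge0.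
exists (Num.min d (e / K)); first by rewrite lt_min d0 divr_gt0.
move=> y _; rewrite lt_min ltr_pdivlMr // => /andP[yd]; apply: le_lt_trans.
have := dP _ yd; rewrite mul1r addrCA subrr addr0 => H1.
have -> : H y - H x = (H y - H x - (y - x)%:C%C * h x) + (y - x)%:C%C * h x.
  by ring.
rewrite (le_trans (nrD _ _)) // nrM nr_real /K !mulrDr mulr1.
rewrite (le_trans (lerD H1 (lexx _))) // lerDl //.
Qed.

End ComplexIntegral.

(** * Goursat's theorem on rectangles *)

Section Goursat.
Variable R : realType.
Local Notation C := (Cplx R).

Lemma half_expn_lt (w d : R) : 0 < d -> exists k, w / 2 ^+ k < d.
Proof.
move=> d0; have [w0|w0] := leP w 0.
  by exists 0%N; rewrite expr0 divr1 (le_lt_trans w0).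
exists (Num.truncn (w / d)).+1; rewrite ltr_pdivrMr ?exprn_gt0 // mulrC.
rewrite -ltr_pdivrMr // (lt_trans (truncnS_gt _)) //.
by rewrite -natrX ltr_nat ltn_expl.
Qed.

(** The left end points increase and stay below all right end points, so their supremum lies in
    every interval. This serves both for bisection and, in [complete_geoR], for completeness. *)
Lemma nested_point (u : nat -> R) (w : R) :
  (forall k, u k <= u k.+1) ->
  (forall k, u k.+1 + w / 2 ^+ k.+1 <= u k + w / 2 ^+ k) -> 0 <= w ->
  exists L, forall k, u k <= L <= u k + w / 2 ^+ k.
Proof.
move=> up down w0; have um j k : (j <= k)%N -> u j <= u k.
  by move=> /subnKC <-; elim: (k - j)%N => [|m IH]; rewrite ?addn0 // addnS (le_trans IH).
have dm j k : (j <= k)%N -> u k + w / 2 ^+ k <= u j + w / 2 ^+ j.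
  by move=> /subnKC <-; elim: (k - j)%N => [|m IH]; rewrite ?addn0 // addnS (le_trans (down _)).
have wk k : 0 <= w / 2 ^+ k by rewrite divr_ge0 // exprn_ge0.
have jk j k : u j <= u k + w / 2 ^+ k.
  have [/um jk|/ltnW/dm kj] := leqP j k; first by rewrite (le_trans jk) // lerDl.
  by rewrite (le_trans _ kj) // lerDl.
exists (sup (range u)) => k; apply/andP; split.
  by apply: ub_le_sup; [exists (u 0%N + w / 2 ^+ 0) => _ [j _ <-]|exists k].
by apply: ge_sup; [exists (u 0%N), 0%N|move=> _ [j _ <-]].
Qed.

Variable G : R -> R -> C.

(* Complex differentiability at x + i y of a function of two real variables. *)
Definition hder x y (z : C) := forall e : R, 0 < e -> exists2 d : R, 0 < d &
  forall h k : R, `|h| < d -> `|k| < d ->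
    nr (G (x + h) (y + k) - G x y - (h +i* k)%C * z) <= e * (`|h| + `|k|).

(** The integral of G dz counterclockwise along the boundary of [a, b] x [c, d], with dz = i dy on
    the vertical sides. *)
Definition boundary_int a b c d : C := cint a b (fun x => G x c - G x d) +
  'i%C * cint c d (fun y => G b y - G a y).

Lemma hder_horizontal x y z : hder x y z -> cder (G ^~ y) x z.
Proof.
move=> Gz e e0; have [d d0 dP] := Gz e e0; exists d => // k kd.
by have := dP k 0 kd; rewrite normr0 !addr0 complexr0 => /(_ d0).
Qed.

Lemma hder_vertical x y z : hder x y z -> cder (G x) y ('i%C * z).
Proof.
move=> Gz e e0; have [d d0 dP] := Gz e e0; exists d => // k kd.
have := dP 0 k; rewrite normr0 addr0 add0r => /(_ d0 kd).
by have -> : (0 +i* k)%C * z = k%:C%C * ('i%C * z) by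
  rewrite mulrA; congr (_ * _); simpc.
Qed.

Section Rectangle.
Variables (a0 b0 c0 d0 : R).
Hypothesis Gd : forall x y, a0 <= x <= b0 -> c0 <= y <= d0 -> exists z, hder x y z.

Let Gh a b y : a0 <= a -> b <= b0 -> c0 <= y <= d0 -> ccont a b (G ^~ y).
Proof.
move=> aa bb yy; apply: (ccont_sub aa bb).
pose h x := get (hder x y).
apply: (@cder_ccont _ _ h) => x xx; apply: hder_horizontal.
exact: getPex (Gd xx yy).
Qed.

Let Gv c d x : c0 <= c -> d <= d0 -> a0 <= x <= b0 -> ccont c d (G x).
Proof.
move=> cc dd xx; apply: (ccont_sub cc dd).
pose h y := 'i%C * get (hder x y).
apply: (@cder_ccont _ _ h) => y yy; apply: hder_vertical.
exact: getPex (Gd xx yy).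
Qed.

Lemma boundary_int_split_x a m b c d : a0 <= a -> a <= m -> m <= b -> b <= b0 ->
  c0 <= c -> c <= d -> d <= d0 ->
  boundary_int a b c d = boundary_int a m c d + boundary_int m b c d.
Proof.
move=> aa am mb bb cc cd dd.
rewrite /boundary_int (cint_split am mb); last first.
  by apply: ccontB; apply: Gh; try (apply/andP; split); lra.
have -> : cint c d (fun y => G b y - G a y) =
    cint c d (fun y => G b y - G m y) + cint c d (fun y => G m y - G a y).
  rewrite -cintD; last first.
  - by apply: ccontB; apply: Gv; try (apply/andP; split); lra.
  - by apply: ccontB; apply: Gv; try (apply/andP; split); lra.
  by apply: cint_eq => y _; ring.
by ring.
Qed.

Lemma boundary_int_split_y a b c m d : a0 <= a -> a <= b -> b <= b0 ->
  c0 <= c -> c <= m -> m <= d -> d <= d0 ->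
  boundary_int a b c d = boundary_int a b c m + boundary_int a b m d.
Proof.
move=> aa ab bb cc cm md dd.
rewrite /boundary_int (cint_split cm md); last first.
  by apply: ccontB; apply: Gv; try (apply/andP; split); lra.
have -> : cint a b (fun x => G x c - G x d) =
    cint a b (fun x => G x c - G x m) + cint a b (fun x => G x m - G x d).
  rewrite -cintD; last first.
  - by apply: ccontB; apply: Gh; try (apply/andP; split); lra.
  - by apply: ccontB; apply: Gh; try (apply/andP; split); lra.
  by apply: cint_eq => y _; ring.
by ring.
Qed.

Lemma boundary_int_quad a c w v : 0 <= w -> 0 <= v ->
  a0 <= a -> a + (w + w) <= b0 -> c0 <= c -> c + (v + v) <= d0 ->
  boundary_int a (a + (w + w)) c (c + (v + v)) =
    (boundary_int a (a + w) c (c + v) +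
     boundary_int a (a + w) (c + v) (c + v + v)) +
    (boundary_int (a + w) (a + w + w) c (c + v) +
     boundary_int (a + w) (a + w + w) (c + v) (c + v + v)).
Proof.
move=> w0 v0 aa bb cc dd.
rewrite (addrA a) (addrA c) (@boundary_int_split_x a (a + w)); [|lra..].
by congr (_ + _); apply: boundary_int_split_y; lra.
Qed.

(** The affine part of G at (x, y) integrates to zero along the boundary, and the remainder is small
    compared with the side lengths. *)
Lemma boundary_int_local x y : a0 <= x <= b0 -> c0 <= y <= d0 ->
  forall e : R, 0 < e -> exists2 r : R, 0 < r & forall a b c d,
    a0 <= a -> a <= x <= b -> b <= b0 -> c0 <= c -> c <= y <= d -> d <= d0 ->
    b - a < r -> d - c < r ->
    nr (boundary_int a b c d) <= e * ((b - a) + (d - c)) ^+ 2.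
Proof.
move=> xx yy e e0; have [z Gz] := Gd xx yy.
(* The 4 absorbs the two opposite sides subtracted in each integrand and the factor 2 of
   [cint_bound]. *)
have [|r r0 rP] := Gz (e / 4); first by rewrite divr_gt0.
exists r => // a b c d aa /andP[ax xb] bb cc /andP[cy yd] dd abr cdr.
have ab := le_trans ax xb; have cd := le_trans cy yd.
pose E u v := G u v - G x y - ((u - x) +i* (v - y))%C * z.
have EP u v : a <= u <= b -> c <= v <= d -> nr (E u v) <= e / 4 * ((b - a) + (d - c)).
  move=> /andP[au ub] /andP[cv vd].
  have ux : `|u - x| <= b - a by rewrite ler_norml; lra.
  have vy : `|v - y| <= d - c by rewrite ler_norml; lra.
  have := rP (u - x) (v - y) (le_lt_trans ux abr) (le_lt_trans vy cdr).
  rewrite (addrC x) (addrC y) !subrK => /le_trans; apply.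
  by rewrite ler_wpM2l ?lerD // ltW // divr_gt0.
have caab : a <= a <= b by rewrite lexx.
have cbab : a <= b <= b by rewrite ab lexx.
have cccd : c <= c <= d by rewrite lexx.
have cdcd : c <= d <= d by rewrite cd lexx.
have c0c : c0 <= c <= d0 by rewrite cc (le_trans cd).
have d0d : c0 <= d <= d0 by rewrite dd (le_trans cc).
have a0a : a0 <= a <= b0 by rewrite aa (le_trans ab).
have b0b : a0 <= b <= b0 by rewrite bb (le_trans aa).
have Eu u : G u c - G u d = E u c - E u d + (c%:C%C - d%:C%C) * 'i%C * z.
  rewrite /E.
  have -> : ((u - x) +i* (c - y))%C = (u - x)%:C%C + (c%:C%C - y%:C%C) * 'i%C :> C by simpc.
  have -> : ((u - x) +i* (d - y))%C = (u - x)%:C%C + (d%:C%C - y%:C%C) * 'i%C :> C by simpc.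
  by ring.
have Ev v : G b v - G a v = E b v - E a v + (b%:C%C - a%:C%C) * z.
  rewrite /E.
  have -> : ((b - x) +i* (v - y))%C = (b%:C%C - x%:C%C) + (v - y)%:C%C * 'i%C :> C by simpc.
  have -> : ((a - x) +i* (v - y))%C = (a%:C%C - x%:C%C) + (v - y)%:C%C * 'i%C :> C by simpc.
  by ring.
have Euc : ccont a b (fun u => E u c - E u d).
  apply: (@ccont_eq _ a b (fun u => G u c - G u d - (c%:C%C - d%:C%C) * 'i%C * z)).
    by move=> u _; rewrite Eu addrK.
  by apply: ccontB; [apply: ccontB; apply: Gh|exact: ccont_cst].
have Evc : ccont c d (fun v => E b v - E a v).
  apply: (@ccont_eq _ c d (fun v => G b v - G a v - (b%:C%C - a%:C%C) * z)).
    by move=> v _; rewrite Ev addrK.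
  by apply: ccontB; [apply: ccontB; apply: Gv|exact: ccont_cst].
have hE : cint a b (fun u => G u c - G u d) = cint a b (fun u => E u c - E u d) +
    (c%:C%C - d%:C%C) * 'i%C * z * (b - a)%:C%C.
  rewrite -cint_cst // -cintD //; last exact: ccont_cst.
  by apply: cint_eq => u _; rewrite Eu.
have vE : cint c d (fun v => G b v - G a v) = cint c d (fun v => E b v - E a v) +
    (b%:C%C - a%:C%C) * z * (d - c)%:C%C.
  rewrite -cint_cst // -cintD //; last exact: ccont_cst.
  by apply: cint_eq => v _; rewrite Ev.
have hB : nr (cint a b (fun u => E u c - E u d)) <=
    2 * (2 * (e / 4 * ((b - a) + (d - c)))) * (b - a).
  apply: cint_bound => // u uab.
  by rewrite (le_trans (nrB _ _)) // mulr_natl mulr2n lerD // EP.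
have vB : nr (cint c d (fun v => E b v - E a v)) <=
    2 * (2 * (e / 4 * ((b - a) + (d - c)))) * (d - c).
  apply: cint_bound => // v vcd.
  by rewrite (le_trans (nrB _ _)) // mulr_natl mulr2n lerD // EP.
rewrite /boundary_int hE vE.
(* The two contributions of the linear part are opposite to each other. *)
have -> : cint a b (fun u => E u c - E u d) +
    (c%:C%C - d%:C%C) * 'i%C * z * (b - a)%:C%C +
    'i%C * (cint c d (fun v => E b v - E a v) + (b%:C%C - a%:C%C) * z * (d - c)%:C%C) =
    cint a b (fun u => E u c - E u d) + 'i%C * cint c d (fun v => E b v - E a v).
  by rewrite !rmorphB /=; ring.
rewrite (le_trans (nrD _ _)) // nrM nr_i mul1r (le_trans (lerD hB vB)) //.
by rewrite expr2; clear hE vE hB vB rP EP Gz Eu Ev Euc Evc; lra.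
Qed.

Lemma boundary_int_eq0 : a0 <= b0 -> c0 <= d0 -> boundary_int a0 b0 c0 d0 = 0.
Proof.
move=> ab cd; apply/eqP; rewrite -nr_eq0; apply/eqP.
set q := nr _; set w := b0 - a0; set v := d0 - c0.
have w0 : 0 <= w by rewrite subr_ge0.
have v0 : 0 <= v by rewrite subr_ge0.
have p2 k : 0 < (2 : R) ^+ k by rewrite exprn_gt0.
have half u k : u / 2 ^+ k.+1 + u / 2 ^+ k.+1 = u / 2 ^+ k :> R.
  by rewrite exprS; field; rewrite gt_eqF // p2.
pose good k (p : R * R) :=
  [/\ a0 <= p.1, p.1 + w / 2 ^+ k <= b0, c0 <= p.2, p.2 + v / 2 ^+ k <= d0 &
    q / 4 ^+ k <= nr (boundary_int p.1 (p.1 + w / 2 ^+ k) p.2 (p.2 + v / 2 ^+ k))].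
(* The property [good] is a premise under the existential, so that [choice] gives a function defined
   on all pairs. *)
have step (kp : nat * (R * R)) : exists p', good kp.1 kp.2 ->
    [/\ good kp.1.+1 p', kp.2.1 <= p'.1, kp.2.2 <= p'.2,
        p'.1 + w / 2 ^+ kp.1.+1 <= kp.2.1 + w / 2 ^+ kp.1 &
        p'.2 + v / 2 ^+ kp.1.+1 <= kp.2.2 + v / 2 ^+ kp.1].
  case: kp => k [a c] /=.
  have [gk|ngk] := pselect (good k (a, c)); last by exists (a, c).
  have [/= ga gb gc gd gq] := gk.
  set w' := w / 2 ^+ k.+1; set v' := v / 2 ^+ k.+1.
  have ww : w / 2 ^+ k = w' + w' by rewrite half.
  have vv : v / 2 ^+ k = v' + v' by rewrite half.
  have w'0 : 0 <= w' by rewrite divr_ge0 // ltW.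
  have v'0 : 0 <= v' by rewrite divr_ge0 // ltW.
  rewrite {}ww {}vv in gb gd gq *.
  have E := boundary_int_quad w'0 v'0 ga gb gc gd.
  have q4 : q / 4 ^+ k = 4 * (q / 4 ^+ k.+1).
    by rewrite exprS; field; rewrite expf_neq0.
  pose Q := q / 4 ^+ k.+1.
  have pick a1 c1 : a <= a1 -> a1 <= a + w' -> c <= c1 -> c1 <= c + v' ->
     Q <= nr (boundary_int a1 (a1 + w') c1 (c1 + v')) ->
     exists p', good k (a, c) -> [/\ good k.+1 p', a <= p'.1, c <= p'.2,
        p'.1 + w' <= a + (w' + w') & p'.2 + v' <= c + (v' + v')].
    move=> a1a a1w c1c c1v Qp; exists (a1, c1) => _.
    have la : a0 <= a1 by exact: le_trans a1a.
    have lc : c0 <= c1 by exact: le_trans c1c.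
    have lb : a1 + w' <= a + (w' + w') by rewrite addrA lerD2r.
    have ld : c1 + v' <= c + (v' + v') by rewrite addrA lerD2r.
    split=> //; split=> //=; first exact: le_trans gb.
    exact: le_trans gd.
  have aw : a <= a + w' by rewrite lerDl.
  have cv : c <= c + v' by rewrite lerDl.
  have [h1|h1] := leP Q (nr (boundary_int a (a + w') c (c + v'))).
    exact: (pick a c).
  have [h2|h2] := leP Q (nr (boundary_int a (a + w') (c + v') (c + v' + v'))).
    exact: (pick a (c + v')).
  have [h3|h3] := leP Q (nr (boundary_int (a + w') (a + w' + w') c (c + v'))).
    exact: (pick (a + w') c).
  have [h4|h4] := leP Q (nr (boundary_int (a + w') (a + w' + w') (c + v') (c + v' + v'))).
    exact: (pick (a + w') (c + v')).
  (* If all four quarters fell short of [Q], so would their sum, against the bound carried by the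
     large rectangle. *)
  exfalso; move: gq; rewrite E q4 -/Q leNgt => /negP; apply.
  have -> : 4 * Q = (Q + Q) + (Q + Q) by ring.
  apply: le_lt_trans (ltrD (ltrD h1 h2) (ltrD h3 h4)).
  exact: le_trans (nrD _ _) (lerD (nrD _ _) (nrD _ _)).
have [f fP] := choice step.
pose s := fix s k := if k is k'.+1 then f (k', s k') else (a0, c0).
have gs k : good k (s k).
  elim: k => [|k IH] /=; last by have [] := fP (k, s k) IH.
  by split => //=; rewrite ?expr0 ?divr1 /w /v ?(addrC a0) ?(addrC c0) ?subrK.
have [x xP] : exists x, forall k, (s k).1 <= x <= (s k).1 + w / 2 ^+ k.
  by apply: (@nested_point (fun k => (s k).1)) => // k /=; have [] := fP (k, s k) (gs k).
have [y yP] : exists y, forall k, (s k).2 <= y <= (s k).2 + v / 2 ^+ k.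
  by apply: (@nested_point (fun k => (s k).2)) => // k /=; have [] := fP (k, s k) (gs k).
have xx : a0 <= x <= b0.
  by have := xP 0%N; rewrite /= expr0 divr1 /w (addrC a0) subrK.
have yy : c0 <= y <= d0.
  by have := yP 0%N; rewrite /= expr0 divr1 /v (addrC c0) subrK.
apply/eqP; rewrite eq_le nr_ge0 andbT -/q leNgt; apply/negP => q0.
(* This makes e (w + v)^2 smaller than q, so the local bound at scale 2^-k falls below the q / 4^k
   guaranteed by [good]; the added 1 keeps the denominator positive for a degenerate rectangle. *)
pose e := q / (2 * ((w + v) ^+ 2 + 1)).
have e0 : 0 < e by rewrite divr_gt0 // mulr_gt0 // ltr_wpDl // sqr_ge0.
have [r r0 rP] := boundary_int_local xx yy e0.
have [k kr] := half_expn_lt (w + v) r0.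
have [ga gb gc gd gq] := gs k.
have wk : w / 2 ^+ k <= (w + v) / 2 ^+ k by rewrite ler_wpM2r ?lerDl // invr_ge0 ltW.
have vk : v / 2 ^+ k <= (w + v) / 2 ^+ k by rewrite ler_wpM2r ?lerDr // invr_ge0 ltW.
have := rP _ _ _ _ ga (xP k) gb gc (yP k) gd.
rewrite ![_ + _ - _]addrAC !subrr !add0r => /(_ (le_lt_trans wk kr) (le_lt_trans vk kr)).
move=> /(le_trans gq); rewrite -mulrDl exprMn.
have -> : (2 ^+ k)^-1 ^+ 2 = (4 ^+ k)^-1 :> R.
  by rewrite exprVn -exprM mulnC exprM; congr ((_ ^+ k)^-1); ring.
rewrite mulrA ler_pM2r ?invr_gt0 ?exprn_gt0 // /e leNgt => /negP; apply.
rewrite mulrAC ltr_pdivrMr; last by rewrite mulr_gt0 // ltr_wpDl // sqr_ge0.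
by rewrite ltr_pM2l //; have := sqr_ge0 (w + v); lra.
Qed.

End Rectangle.
End Goursat.

Local Opaque diff.

(** * Cauchy's formula *)

Section Cauchy.
Variable R : realType.
Local Notation C := (Cplx R).

Definition cexp (x y : R) : C := (expR x)%:C%C * (cos y +i* sin y)%C.

Lemma cexpD x y h k : cexp (x + h) (y + k) = cexp x y * cexp h k.
Proof.
rewrite /cexp expRD cosD sinD mulrACA rmorphM /=; congr (_ * _).
by apply/eqP; rewrite eq_complex /= eqxx [X in _ == X]addrC !(mulrC (cos y)) eqxx.
Qed.

Lemma cexp0 : cexp 0 0 = 1.
Proof. by rewrite /cexp expR0 cos0 sin0 complexr0 mulr1. Qed.

Lemma cexpN x y : cexp x y * cexp (- x) (- y) = 1.
Proof. by rewrite -cexpD !subrr cexp0. Qed.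

Lemma nr_cexp x y : nr (cexp x y) = expR x.
Proof.
rewrite /cexp nrM nr_real ger0_norm ?expR_ge0 // nr_sqrt /= cos2Dsin2 sqrtr1.
by rewrite mulr1.
Qed.

Lemma cexp_2pi x : cexp x (2 * pi) = cexp x 0.
Proof. by rewrite /cexp mulr_natl cos2pi sin2pi cos0 sin0. Qed.

Lemma cexp_N2pi x : cexp x (- (2 * pi)) = cexp x 0.
Proof. by rewrite /cexp mulr_natl cosN sinN cos2pi sin2pi cos0 sin0 oppr0. Qed.

Lemma hder_cexp0 : hder cexp 0 0 1.
Proof.
move=> e e0; pose e' := Num.min 1 (e / 6).
have e'0 : 0 < e' by rewrite lt_min ltr01 divr_gt0.
have [d d0 dP] := is_derive_rder (is_derive_expR (0 : R)) e'0.
have [d1 d10 d1P] := is_derive_rder (is_derive_cos (0 : R)) e'0.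
have [d2 d20 d2P] := is_derive_rder (is_derive_sin (0 : R)) e'0.
exists (Num.min (Num.min d d1) (Num.min d2 (e' / 2))).
  by rewrite !lt_min d0 d10 d20 divr_gt0.
move=> h k; rewrite !lt_min => /andP[/andP[hd _] /andP[_ he]] /andP[/andP[_ kd1] /andP[kd2 ke]].
have := dP h hd; have := d1P k kd1; have := d2P k kd2.
rewrite !add0r expR0 cos0 sin0 oppr0 mulr0 !mulr1 !subr0 addr0 => Hs Hc He.
rewrite cexp0 (le_trans (nr_le_ReIm _)) // /cexp /=.
rewrite !mul0r subr0 addr0 subr0.
have e1 : e' <= 1 by rewrite ge_min lexx.
have e6 : e' * 6 <= e by rewrite -ler_pdivlMr // ge_min lexx orbT.
have h0 : 0 <= `|h| by []. have k0 : 0 <= `|k| by [].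
have E1 : `|expR h - 1| <= e' .
  have -> : expR h - 1 = (expR h - 1 - h) + h by ring.
  rewrite (le_trans (ler_normD _ _)) // (le_trans (lerD He (lexx _))) //.
  have : e' * `|h| <= 1 * `|h| by rewrite ler_wpM2r.
  lra.
have E2 : `|expR h| <= 2.
  have -> : expR h = (expR h - 1) + 1 by ring.
  by rewrite (le_trans (ler_normD _ _)) // normr1; lra.
have -> : expR h * cos k - 1 - h = expR h * (cos k - 1) + (expR h - 1 - h) by ring.
have -> : expR h * sin k - k = expR h * (sin k - k) + (expR h - 1) * k by ring.
have H1 : `|expR h * (cos k - 1)| <= 2 * (e' * `|k|) by rewrite normrM ler_pM.
have H2 : `|expR h * (sin k - k)| <= 2 * (e' * `|k|) by rewrite normrM ler_pM.
have H3 : `|(expR h - 1) * k| <= e' * `|k| by rewrite normrM ler_wpM2r.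
have N1 := ler_normD (expR h * (cos k - 1)) (expR h - 1 - h).
have N2 := ler_normD (expR h * (sin k - k)) ((expR h - 1) * k).
have Hk : e' * 6 * (`|h| + `|k|) <= e * (`|h| + `|k|) by rewrite ler_wpM2r // addr_ge0.
have eh : 0 <= e' * `|h| by rewrite mulr_ge0 // ltW.
have ek : 0 <= e' * `|k| by rewrite mulr_ge0 // ltW.
rewrite (le_trans _ Hk) // (le_trans (lerD N1 N2)) //.
clear -H1 H2 H3 He eh ek.
lra.
Qed.

Lemma hder_comp (g : R -> R -> C) (u : C -> C) x y z c :
  hder g x y z -> has_diff u (g x y) (fun h => h * c) ->
  hder (fun x y => u (g x y)) x y (z * c).
Proof.
move=> gz uc e e0.
pose K := nr z + 1; have K0 : 0 < K by rewrite ltr_wpDl.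
have [|d d0 dP] := uc (e / 2 / K); first by rewrite !divr_gt0.
have c1 : 0 < nr c + 1 by rewrite ltr_wpDl.
have [|d1 d10 d1P] := gz (Num.min 1 (e / 2 / (nr c + 1))).
  by rewrite lt_min ltr01 !divr_gt0.
exists (Num.min d1 (d / 2 / K)); first by rewrite lt_min d10 !divr_gt0.
move=> h k; rewrite !lt_min => /andP[hd1 hd] /andP[kd1 kd].
have H := d1P h k hd1 kd1; set S := `|h| + `|k| in H *.
have S0 : 0 <= S by rewrite addr_ge0.
set D := g (x + h) (y + k) - g x y in H.
set p := (h +i* k)%C : C in H *.
have zS : nr (p * z) <= S * nr z.
  by rewrite nrM ler_wpM2r // (le_trans (nr_le_ReIm _)).
have DK : nr D <= K * S.
  rewrite -[D](subrK (p * z)) (le_trans (nrD _ _)) //.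
  rewrite (le_trans (lerD H zS)) //.
  have -> : K * S = S + S * nr z by rewrite /K; ring.
  by rewrite lerD2r -[leRHS]mul1r ler_wpM2r // ge_min lexx.
have Dd : nr D < d.
  rewrite (le_lt_trans DK) // mulrC -ltr_pdivlMr //.
  by rewrite [d / K](_ : _ = d / 2 / K + d / 2 / K) ?ltrD //; field; rewrite gt_eqF.
have := dP D Dd; have -> : g x y + D = g (x + h) (y + k) by rewrite /D addrC subrK.
move=> uD.
have -> : u (g (x + h) (y + k)) - u (g x y) - p * (z * c) =
  (u (g (x + h) (y + k)) - u (g x y) - D * c) + (D - p * z) * c by ring.
have eS : e * S = e / 2 * S + e / 2 * S by field.
rewrite eS (le_trans (nrD _ _)) // lerD //.
  rewrite (le_trans uD) // -mulrA ler_wpM2l //; first by rewrite ltW // divr_gt0.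
  by rewrite mulrC ler_pdivrMr // mulrC.
rewrite nrM (le_trans (ler_wpM2r _ H)) // mulrAC ler_wpM2r //.
rewrite (@le_trans _ _ (e / 2 / (nr c + 1) * nr c)) //.
  by rewrite ler_wpM2r // ge_min lexx orbT.
have e2 : 0 <= e / 2 by rewrite ltW // divr_gt0.
by rewrite -mulrA ler_piMr // mulrC ler_pdivrMr // mul1r lerDl.
Qed.

Lemma hderM (f g : R -> R -> C) x y z w : hder f x y z -> hder g x y w ->
  hder (fun x y => f x y * g x y) x y (f x y * w + z * g x y).
Proof.
move=> fz gw e e0.
pose F := nr (f x y) + 1; pose G := nr (g x y) + 1; pose Z := nr z + 1; pose W := nr w + 1.
have F0 : 0 < F by rewrite ltr_wpDl. have G0 : 0 < G by rewrite ltr_wpDl.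
have Z0 : 0 < Z by rewrite ltr_wpDl. have W0 : 0 < W by rewrite ltr_wpDl.
have [|d d0 dP] := fz (Num.min 1 (e / 4 / G)); first by rewrite lt_min ltr01 !divr_gt0.
have [|d1 d10 d1P] := gw (Num.min 1 (e / 4 / F)); first by rewrite lt_min ltr01 !divr_gt0.
exists (Num.min (Num.min d d1) (e / 4 / (Z * W))).
  by rewrite !lt_min d0 d10 !divr_gt0 // mulr_gt0.
move=> h k; rewrite !lt_min => /andP[/andP[hd hd1] hz] /andP[/andP[kd kd1] kz].
have H := dP h k hd kd; have H1 := d1P h k hd1 kd1.
set S := `|h| + `|k| in H H1 *; have S0 : 0 <= S by rewrite addr_ge0.
set Df := f (x + h) (y + k) - f x y in H; set Dg := g (x + h) (y + k) - g x y in H1.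
set q := (h +i* k)%C : C in H H1 *.
have qS : nr q <= S by rewrite (le_trans (nr_le_ReIm _)).
have DfZ : nr Df <= Z * S.
  rewrite -[Df](subrK (q * z)) (le_trans (nrD _ _)) // (le_trans (lerD H (lexx _))) //.
  have -> : Z * S = S + S * nr z by rewrite /Z; ring.
  rewrite nrM lerD // ?ler_wpM2r //.
  by rewrite -[leRHS]mul1r ler_wpM2r // ge_min lexx.
have DgW : nr Dg <= W * S.
  rewrite -[Dg](subrK (q * w)) (le_trans (nrD _ _)) // (le_trans (lerD H1 (lexx _))) //.
  have -> : W * S = S + S * nr w by rewrite /W; ring.
  rewrite nrM lerD // ?ler_wpM2r //.
  by rewrite -[leRHS]mul1r ler_wpM2r // ge_min lexx.
have -> : f (x + h) (y + k) * g (x + h) (y + k) - f x y * g x y -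
    q * (f x y * w + z * g x y) =
    f x y * (Dg - q * w) + (Df - q * z) * g x y + Df * Dg by rewrite /Df /Dg; ring.
have e4 : e * S = e / 4 * S + e / 4 * S + (e / 2 * S) by field.
rewrite e4 (le_trans (nrD _ _)) // !nrM lerD //.
  rewrite (le_trans (nrD _ _)) // !nrM lerD //.
    rewrite (@le_trans _ _ (F * nr (Dg - q * w))) ?ler_wpM2r ?lerDl //.
    rewrite mulrC -ler_pdivlMr // (le_trans H1) // [leRHS]mulrAC ler_wpM2r //.
    by rewrite ge_min lexx orbT.
  rewrite (@le_trans _ _ (nr (Df - q * z) * G)) ?ler_wpM2l ?lerDl //.
  rewrite -ler_pdivlMr // (le_trans H) // [leRHS]mulrAC ler_wpM2r //.
  by rewrite ge_min lexx orbT.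
rewrite (le_trans (ler_pM _ _ DfZ DgW)) // mulrACA mulrA ler_wpM2r //.
have : S < e / 4 / (Z * W) + e / 4 / (Z * W) by rewrite /S ltrD.
have -> : e / 4 / (Z * W) + e / 4 / (Z * W) = e / 2 / (Z * W).
  by field; rewrite !gt_eqF.
by rewrite ltr_pdivlMr ?mulr_gt0 // mulrC => /ltW.
Qed.

Lemma hderN (g : R -> R -> C) x y z : hder g (- x) (- y) z ->
  hder (fun x y => g (- x) (- y)) x y (- z).
Proof.
move=> gz e e0; have [d d0 dP] := gz e e0; exists d => // h k hd kd.
have := dP (- h) (- k); rewrite !normrN => /(_ hd kd); rewrite !opprD.
by have -> : (- h +i* - k)%C * z = (h +i* k)%C * - z by rewrite mulrN -mulNr; simpc.
Qed.

Lemma hder_cexp x y : hder cexp x y (cexp x y).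
Proof.
move=> e e0; have [|d d0 dP] := hder_cexp0 (e := e / expR x).
  by rewrite divr_gt0 // expR_gt0.
exists d => // h k hd kd; have := dP h k hd kd; rewrite !add0r cexp0 mulr1 => H.
have -> : cexp (x + h) (y + k) - cexp x y - (h +i* k)%C * cexp x y =
  cexp x y * (cexp h k - 1 - (h +i* k)%C) by rewrite cexpD; ring.
by rewrite nrM nr_cexp mulrC -ler_pdivlMr ?expR_gt0 // [leRHS]mulrAC.
Qed.

Let circle_alg (a b e c k : C) :
  (a - b - e * c) * k = a * k - c * (e * k) - b * k.
Proof. by ring. Qed.

Lemma pi2_ge0 : 0 <= 2 * pi :> R.
Proof. by rewrite mulr_ge0 // pi_ge0. Qed.

Lemma ccont_vertical (g : R -> R -> C) x a b :
  (forall y, a <= y <= b -> exists z, hder g x y z) -> ccont a b (g x).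
Proof.
move=> gd; pose h y := 'i%C * get (hder g x y).
apply: (@cder_ccont _ _ h) => y yy; apply: hder_vertical.
exact: getPex (gd y yy).
Qed.

(* After the change of variable w |-> exp w, the horizontal sides of the
   rectangle cancel by periodicity, so that the integral over the circle of
   radius exp a does not depend on a; it is computed by letting a tend to
   minus infinity. *)
Lemma cauchy_derivative (u : C -> C) (r : R) (c : C) : 0 < r ->
  (forall z, nr z <= r -> exists c', has_diff u z (fun h => h * c')) ->
  has_diff u 0 (fun h => h * c) ->
  cint 0 (2 * pi) (fun t => u (cexp (ln r) t) * cexp 0 (- t)) = (2 * pi * r)%:C%C * c.
Proof.
move=> r0 ud uc; set b := ln r.
(* G dw is the pullback of u (z) / z^2 dz by z = exp w. *)
pose G x y := u (cexp x y) * cexp (- x) (- y).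
have er : expR b = r by rewrite lnK.
have Gd x y : x <= b -> exists z, hder G x y z.
  move=> xb; have [c' uc'] : exists c', has_diff u (cexp x y) (fun h => h * c').
    by apply: ud; rewrite nr_cexp -er ler_expR.
  eexists; apply: hderM; first exact: hder_comp (hder_cexp x y) uc'.
  exact/hderN/hder_cexp.
have Jc a : a <= b -> ccont 0 (2 * pi) (G a).
  by move=> ab; apply: ccont_vertical => y _; exact: Gd.
have J a : a <= b -> cint 0 (2 * pi) (G b) = cint 0 (2 * pi) (G a).
  move=> ab; have Gd' x y : a <= x <= b -> 0 <= y <= 2 * pi -> exists z, hder G x y z.
    by move=> /andP[_ /Gd].
  have := boundary_int_eq0 Gd' ab pi2_ge0; rewrite /boundary_int.
  have -> : cint a b (fun x => G x 0 - G x (2 * pi)) = 0.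
    rewrite -[RHS](mul0r (b - a)%:C%C) -cint_cst //; apply: cint_eq => x _.
    by rewrite /G cexp_2pi oppr0 cexp_N2pi subrr.
  rewrite add0r (cintB (Jc b (lexx b)) (Jc a ab)).
  move/eqP; rewrite mulf_eq0 -nr_eq0 nr_i oner_eq0 /= subr_eq0.
  by move/eqP.
have cN x : ccont 0 (2 * pi) (fun y => cexp (- x) (- y)).
  apply: (@ccont_vertical (fun x y => cexp (- x) (- y))) => y _.
  by eexists; exact/hderN/hder_cexp.
(* On a vertical line the periodic function i exp (- w) is a primitive. *)
have I0 x : cint 0 (2 * pi) (fun y => cexp (- x) (- y)) = 0.
  rewrite (@cint_FTC _ (fun y => 'i%C * cexp (- x) (- y)) _ _ _ pi2_ge0) //.
    by rewrite cexp_N2pi oppr0 subrr.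
  move=> y _; have /hder_vertical H := hderN (hder_cexp (- x) (- y)).
  move=> e e0; have [d d0 dP] := H e e0; exists d => // k /dP.
  have -> : 'i%C * cexp (- x) (- (y + k)) - 'i%C * cexp (- x) (- y) -
      k%:C%C * cexp (- x) (- y) = 'i%C * (cexp (- x) (- (y + k)) -
      cexp (- x) (- y) - k%:C%C * ('i%C * - cexp (- x) (- y))) +
      (- ('i%C * 'i%C) - 1) * (k%:C%C * cexp (- x) (- y)) :> C by ring.
  have -> : - ('i%C * 'i%C) - 1 = 0 :> C by rewrite -expr2 sqr_i opprK subrr.
  by rewrite mul0r addr0 nrM nr_i mul1r.
have JE : cint 0 (2 * pi) (G b) = (2 * pi)%:C%C * c.
  apply/eqP; rewrite -subr_eq0 -nr_eq0 eq_le nr_ge0 andbT leNgt; apply/negP => q0.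
  set q := nr _ in q0; have pp : 0 < 2 * pi :> R by rewrite mulr_gt0 // pi_gt0.
  (* With this e the bound 2 e (2 pi) on q equals q / 2, a contradiction. *)
  pose e := q / (4 * (2 * pi)).
  have e0 : 0 < e by rewrite divr_gt0 // mulr_gt0.
  pose u0 : C := u 0.
  have [d d0 dP] : exists2 d : R, 0 < d &
      forall h, nr h < d -> nr (u h - u0 - h * c) <= e * nr h.
    by have [d d0 dP] := uc e e0; exists d => // h /dP; rewrite add0r.
  move: u0 dP => u0 dP.
  pose a := Num.min b (ln (d / 2)).
  have ab : a <= b by rewrite ge_min lexx.
  have ad : expR a < d.
    rewrite (@le_lt_trans _ _ (expR (ln (d / 2)))) ?ler_expR ?ge_min ?lexx ?orbT //.
    by rewrite lnK ?posrE ?divr_gt0 // ltr_pdivrMr // ltr_pMr // ltr1n.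
  (* Subtracting the Taylor polynomial of u at 0: its constant term integrates to zero by [I0], its
     linear term gives 2 pi c. *)
  have E : cint 0 (2 * pi) (fun y => (u (cexp a y) - u0 - cexp a y * c) * cexp (- a) (- y)) =
     cint 0 (2 * pi) (G b) - (2 * pi)%:C%C * c.
    have I1 : cint 0 (2 * pi) (fun y => u0 * cexp (- a) (- y)) = 0.
      by rewrite (cintZ _ (cN a)) I0 mulr0.
    have I2 : cint 0 (2 * pi) (fun=> c) = (2 * pi)%:C%C * c.
      by rewrite (cint_cst _ pi2_ge0) subr0 mulrC.
    have c1 := @ccont_cst R 0 (2 * pi) c.
    have c2 := ccontB (Jc a ab) c1.
    have c3 := ccontM (@ccont_cst R 0 (2 * pi) u0) (cN a).
    rewrite (J a ab) -[RHS]subr0 -I1 -I2 -(cintB (Jc a ab) c1) -(cintB c2 c3).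
    apply: cint_eq => y _; rewrite /G.
    have E1 := cexpN a y; set K := cexp (- a) (- y) in E1 *.
    transitivity (u (cexp a y) * K - c * (cexp a y * K) - u0 * K).
      exact: circle_alg.
    by rewrite E1 mulr1.
  have : q <= 2 * e * (2 * pi - 0).
    rewrite /q -E; apply: cint_bound; first exact: pi2_ge0.
      apply: (@ccont_eq _ 0 (2 * pi) (fun y => G a y - c - u0 * cexp (- a) (- y))).
        move=> y _; rewrite /G.
        have E1 := cexpN a y; set K := cexp (- a) (- y) in E1 *.
        transitivity (u (cexp a y) * K - c * (cexp a y * K) - u0 * K).
          by rewrite E1 mulr1.
        by rewrite circle_alg.
      apply: ccontB; first by apply: ccontB; [exact: Jc|exact: ccont_cst].
      exact: ccontM (@ccont_cst _ _ _ _) (cN a).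
    move=> y _; have := dP (cexp a y); rewrite nr_cexp => /(_ ad).
    by rewrite nrM nr_cexp expRN -ler_pdivlMr ?invr_gt0 ?expR_gt0 // invrK.
  rewrite subr0 /e leNgt => /negP; apply.
  have pn : (pi : R) != 0 by rewrite gt_eqF // pi_gt0.
  rewrite (_ : 2 * _ * _ = q / 2); last first.
    by move: (pi : R) pn => p pn; field.
  by rewrite ltr_pdivrMr // ltr_pMr // ltr1n.
(* The integrand of the statement lacks the factor exp (- b) = 1 / r that G carries. *)
have -> : (2 * pi * r)%:C%C * c = r%:C%C * cint 0 (2 * pi) (G b) :> C.
  by rewrite JE rmorphM /=; ring.
rewrite -cintZ; last exact: Jc.
apply: cint_eq => y _; rewrite /G -[in RHS](add0r (- y)) -[- b]addr0 cexpD.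
rewrite [cexp (- b) 0]/cexp cos0 sin0 complexr0 mulr1 expRN er.
have -> : r%:C%C * (u (cexp b y) * ((r^-1)%:C%C * cexp 0 (- y))) =
   (r%:C%C * (r^-1)%:C%C) * (u (cexp b y) * cexp 0 (- y)) :> C by ring.
by rewrite -rmorphM /= divff ?gt_eqF // mul1r.
Qed.

End Cauchy.

(** * Cauchy estimates and Taylor's formula in several variables *)

Section SeveralVariables.
Variable R : realType.
Local Notation C := (Cplx R).

Lemma has_diff_line (V : normedModType C) (f : V -> C) (x v : V) (z : C) :
  differentiable f (x + z *: v) ->
  has_diff (fun w : C => f (x + w *: v)) z (fun k => k * 'd f (x + z *: v) v).
Proof.
move=> /diff_has_diff fd e e0; have v0 : 0 < nr v + 1 by rewrite ltr_wpDl.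
have [|d d0 dP] := fd (e / (nr v + 1)); first by rewrite divr_gt0.
exists (d / (nr v + 1)); first by rewrite divr_gt0.
move=> k; rewrite ltr_pdivlMr // => kd.
have kv : nr (k *: v) <= nr k * (nr v + 1).
  by rewrite nrZ ler_wpM2l // lerDl.
have := dP (k *: v) (le_lt_trans kv kd); rewrite linearZ scalerDl addrA /=.
move=> /le_trans; apply; rewrite nrZ mulrAC ler_pdivrMr // -!mulrA.
by rewrite ler_wpM2l ?(ltW e0) // ler_wpM2l // lerDl.
Qed.

Lemma has_diff_cder (u : C -> C) (t : R) (c : C) :
  has_diff u t%:C%C (fun k => k * c) -> cder (fun t : R => u t%:C%C) t c.
Proof.
move=> uc e e0; have [d d0 dP] := uc e e0; exists d => // k kd.
by have := dP k%:C%C; rewrite nr_real rmorphD /= => /(_ kd).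
Qed.

Lemma cder_line (V : normedModType C) (f : V -> C) (x v : V) (t : R) :
  differentiable f (x + (t%:C%C : C) *: v) ->
  cder (fun t : R => f (x + (t%:C%C : C) *: v)) t ('d f (x + (t%:C%C : C) *: v) v).
Proof. by move=> /has_diff_line/has_diff_cder. Qed.

Lemma diff_MVI (V : normedModType C) (f : V -> C) (x v : V) (K : R) :
  (forall t : R, 0 <= t <= 1 -> differentiable f (x + (t%:C%C : C) *: v) /\
    nr ('d f (x + (t%:C%C : C) *: v) v) <= K) -> nr (f (x + v) - f x) <= 2 * K.
Proof.
move=> fK; have := @cder_MVI _ _ (fun t : R => 'd f (x + (t%:C%C : C) *: v) v) 0 1 K ler01
  (fun t ht => cder_line (proj1 (fK t ht))) (fun t ht => proj2 (fK t ht)).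
by rewrite /= scale1r scale0r addr0 subr0 mulr1.
Qed.

Lemma nr_scale_le (V : normedModType C) (t : R) (v : V) : 0 <= t <= 1 ->
  nr ((t%:C%C : C) *: v) <= nr v.
Proof.
by move=> /andP[t0 t1]; rewrite nrZ nr_real ger0_norm // ler_piMl.
Qed.

Lemma cexp_circle (r t : R) : 0 < r -> nr (cexp (ln r) t) = r.
Proof. by move=> r0; rewrite nr_cexp lnK. Qed.

Lemma ccont_circle (x a b : R) : ccont a b (fun t => cexp x t).
Proof. by apply: ccont_vertical => y _; eexists; exact: hder_cexp. Qed.

Lemma ccont_circleN (a b : R) : ccont a b (fun t => cexp 0 (- t) : C).
Proof.
apply: (@ccont_eq _ a b (fun y => cexp (- 0) (- y))) => [x _|]; first by rewrite oppr0.
apply: (@ccont_vertical _ (fun x y => cexp (- x) (- y))) => y _.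
by eexists; exact/hderN/hder_cexp.
Qed.

Section Estimates.
Variable V : normedModType C.
Implicit Types (f : V -> C) (x v h k : V) (s M : R).

Definition holo_le f x s M := forall y, nr (y - x) <= s ->
  differentiable f y /\ nr (f y) <= M.

(** The one-variable formula on the complex line x + C v, where the derivative at 0 is the
    directional derivative. *)
Lemma cauchy_formula f x v r : 0 < r ->
  (forall y, nr (y - x) <= r * nr v -> differentiable f y) ->
  cint 0 (2 * pi) (fun t => f (x + cexp (ln r) t *: v) * cexp 0 (- t)) =
  (2 * pi * r)%:C%C * 'd f x v.
Proof.
move=> r0 fd; apply: (@cauchy_derivative R (fun w => f (x + w *: v))) => //.
  move=> z zr; exists ('d f (x + z *: v) v); apply: has_diff_line; apply: fd.
  by rewrite addrC addKr nrZ ler_wpM2r.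
have E : x + (0 : C) *: v = x by rewrite scale0r addr0.
have := @has_diff_line _ f x v 0; rewrite E; apply; apply: fd.
by rewrite subrr nr0 mulr_ge0 // ltW.
Qed.

Lemma ccont_circle_comp f x v r a b : 0 < r ->
  (forall y, nr (y - x) <= r * nr v -> {for y, continuous f}) ->
  ccont a b (fun t => f (x + cexp (ln r) t *: v)).
Proof.
move=> r0 fc.
have [v0|v0] := eqVneq v 0.
  apply: (@ccont_eq _ a b (fun=> f x)); last exact: ccont_cst.
  by move=> t _; rewrite v0 scaler0 addr0.
have nv : 0 < nr v by rewrite nr_gt0.
apply: (@ccont_comp _ V C a b f (fun t => x + cexp (ln r) t *: v)).
  move=> t tab e e0.
  have [|d d0 dP] := @ccont_circle (ln r) a b t tab (e / nr v); first by rewrite divr_gt0.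
  exists d => // y yab yt; rewrite opprD addrACA subrr add0r -scalerBl nrZ.
  by rewrite -ltr_pdivlMr // dP.
by move=> t _; apply: fc; rewrite addrC addKr nrZ cexp_circle.
Qed.

Lemma pi2_gt0 : 0 < 2 * pi :> R.
Proof. by rewrite mulr_gt0 // pi_gt0. Qed.

(** Cauchy's formula on the circle of radius s / |h| in the direction h, the largest one that stays
    in the ball of radius s. *)
Lemma cauchy_est f x s M h : 0 < s -> holo_le f x s M ->
  nr ('d f x h) <= 2 * M / s * nr h.
Proof.
move=> s0 fM; have [->|h0] := eqVneq h 0; first by rewrite linear0 !nr0 mulr0.
have nh : 0 < nr h by rewrite nr_gt0.
pose r := s / nr h; have r0 : 0 < r by rewrite divr_gt0.
have rh : r * nr h = s by rewrite /r divfK // gt_eqF.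
have fd y : nr (y - x) <= r * nr h -> differentiable f y.
  by rewrite rh => /fM[].
have := @cint_bound _ 0 (2 * pi) (fun t => f (x + cexp (ln r) t *: h) * cexp 0 (- t)) M (@pi2_ge0 R).
rewrite cauchy_formula // nrM nr_real subr0 => H.
have {H} : `|2 * pi * r| * nr ('d f x h) <= 2 * M * (2 * pi).
  apply: H; first apply: ccontM.
  - by apply: ccont_circle_comp => // y /fd; exact: differentiable_continuous.
  - exact: ccont_circleN.
  move=> t _; rewrite nrM nr_cexp expR0 mulr1.
  by apply: (proj2 (fM _ _)); rewrite addrC addKr nrZ cexp_circle // rh.
have pr : 0 <= 2 * pi * r by rewrite mulr_ge0 ?(ltW r0) // pi2_ge0.
rewrite ger0_norm //.
have p0 := pi2_gt0; rewrite mulrC [leRHS]mulrC => H.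
have : 2 * pi * (r * nr ('d f x h)) <= 2 * pi * (2 * M).
  by apply: le_trans H; rewrite mulrA mulrC.
rewrite ler_pM2l // mulrC -ler_pdivlMr // => /le_trans; apply.
by rewrite /r invf_div mulrA mulrAC.
Qed.

Lemma holo_le_sub f x y s s' M : nr (y - x) + s' <= s ->
  holo_le f x s M -> holo_le f y s' M.
Proof.
move=> ys fM z zy; apply: fM; rewrite (le_trans (nr_tri y z x)) //.
by rewrite addrC (le_trans _ ys) // lerD2l.
Qed.

Lemma holo_le_lip f x s M h : 0 < s -> holo_le f x (2 * s) M -> nr h <= s ->
  nr (f (x + h) - f x) <= 4 * M / s * nr h.
Proof.
move=> s0 fM hs; have -> : 4 * M / s * nr h = 2 * (2 * M / s * nr h) by ring.
apply: diff_MVI => t t01; have ht := nr_scale_le h t01.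
have xt : nr (x + (t%:C%C : C) *: h - x) <= s by rewrite addrC addKr (le_trans ht).
split; first by apply: (proj1 (fM _ _)); rewrite (le_trans xt) //; lra.
apply: cauchy_est => //; apply: (holo_le_sub _ fM); lra.
Qed.

Lemma differentiable_shift f x k : differentiable f (x + k) ->
  differentiable (fun y => f (y + k)) x /\
  forall h, 'd (fun y => f (y + k)) x h = 'd f (x + k) h.
Proof.
move=> fd; have [|//|d dE] := @has_diffP _ _ _ (fun y => f (y + k)) x ('d f (x + k)).
- exact: diff_continuous.
- move=> e e0; have [d d0 dP] := diff_has_diff fd e0; exists d => // h /dP.
  by rewrite (addrAC x h).
- by split => // h; rewrite dE.
Qed.

(** Cauchy's estimate is applied to the increment y |-> f (y + k) - f y, whose size is controlled by
    |k|. The radius 3 s makes room for y at distance s from x, and then for the ball of radius 2 s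
    that [holo_le_lip] wants around y. *)
Lemma diff_lip f x s M h k : 0 < s -> holo_le f x (3 * s) M -> nr k <= s ->
  nr ('d f (x + k) h - 'd f x h) <= 8 * M / s ^+ 2 * nr k * nr h.
Proof.
move=> s0 fM ks.
have fk y : nr (y - x) <= s -> differentiable f y /\ differentiable f (y + k).
  move=> ys; split; first by apply: (proj1 (fM _ _)); lra.
  apply: (proj1 (fM _ _)); rewrite addrAC (le_trans (nrD _ _)) //; lra.
pose g : V -> C := (fun y => f (y + k)) - f.
have gd y : nr (y - x) <= s -> differentiable g y.
  move=> /fk[fy /differentiable_shift[fyk _]].
  exact: (@differentiableB _ _ _ (fun y => f (y + k)) f).
have xx : nr (x - x) <= s by rewrite subrr nr0 ltW.
have dg : 'd g x h = 'd f (x + k) h - 'd f x h.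
  have [fy /differentiable_shift[fyk dE]] := fk x xx.
  have E := @diffB _ _ _ (fun y => f (y + k)) f x fyk fy.
  transitivity (('d (fun y => f (y + k)) x \- 'd f x) h); first exact: (congr1 (fun F : V -> C => F h) E).
  by congr (_ - _); exact: dE.
rewrite -dg; have -> : 8 * M / s ^+ 2 * nr k * nr h = 2 * (4 * M / s * nr k) / s * nr h.
  by field; rewrite gt_eqF.
have gE y : g y = f (y + k) - f y by [].
clearbody g.
apply: (@cauchy_est g x s (4 * M / s * nr k) h s0) => y ys; split; first exact: gd.
rewrite gE; apply: (@holo_le_lip f y s M k s0) => //; apply: (holo_le_sub _ fM); lra.
Qed.

Lemma taylor2 f x s M h : 0 < s -> holo_le f x (3 * s) M -> nr h <= s ->
  nr (f (x + h) - f x - 'd f x h) <= 16 * M / s ^+ 2 * nr h ^+ 2.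
Proof.
move=> s0 fM hs.
have -> : 16 * M / s ^+ 2 * nr h ^+ 2 = 2 * (8 * M / s ^+ 2 * nr h * nr h) * (1 - 0).
  by field; rewrite gt_eqF.
have M0 : 0 <= M.
  by apply: le_trans (proj2 (fM x _)); rewrite ?nr_ge0 // subrr nr0 mulr_ge0 // ltW.
(* The derivative of H is the variation of ['d f] between x and x + t h, which [diff_lip] bounds by
   a multiple of |h|^2. *)
pose H (t : R) := f (x + (t%:C%C : C) *: h) - t%:C%C * 'd f x h.
have -> : f (x + h) - f x - 'd f x h = H 1 - H 0.
  by rewrite /H scale1r scale0r addr0 mul1r mul0r subr0 addrAC.
apply: (@cder_MVI _ _ (fun t : R => 'd f (x + (t%:C%C : C) *: h) h - 'd f x h)) => //.
  move=> t t01; have ht := nr_scale_le h t01.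
  have fd : differentiable f (x + (t%:C%C : C) *: h).
    apply: (proj1 (fM _ _)); rewrite addrC addKr; lra.
  move=> e e0; have [d d0 dP] := cder_line fd e0; exists d => // k /dP.
  rewrite /H rmorphD /= => H1; apply: le_trans H1; rewrite le_eqVlt; apply/orP; left; apply/eqP.
  by congr nr; ring.
move=> t t01; have ht := nr_scale_le h t01.
rewrite (le_trans (diff_lip _ s0 fM _)) ?(le_trans ht) // ler_wpM2r //.
by rewrite ler_wpM2l // !mulr_ge0 // invr_ge0 sqr_ge0.
Qed.

Lemma nbhs_holo_le (D : set V) f x : open D -> holo D f -> D x ->
  exists s M, 0 < s /\ holo_le f x s M /\ forall y, nr (y - x) <= s -> D y.
Proof.
move=> oD fD Dx; have /differentiable_continuous/continuous_nrP/(_ 1 ltr01)[d d0 dP] := fD x Dx.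
have /nbhs_nrP[r r0 rD] : nbhs x D by exact: open_nbhs_nbhs.
exists (Num.min d r / 2), (nr (f x) + 1); rewrite divr_gt0 ?lt_min ?d0 //; split=> //.
have m2 : Num.min d r / 2 < Num.min d r.
  by rewrite ltr_pdivrMr // ltr_pMr ?ltr1n // lt_min d0.
have lt y : nr (y - x) <= Num.min d r / 2 -> nr (y - x) < d /\ nr (y - x) < r.
  by move=> /le_lt_trans/(_ m2); rewrite lt_min => /andP.
split=> y /lt[yd yr]; last exact: rD.
split; first exact/fD/rD.
rewrite -[f y](subrK (f x)) (le_trans (nrD _ _)) // addrC lerD2l ltW //.
exact: dP.
Qed.

End Estimates.

Lemma cint_linear (V : normedModType C) (a b : R) (L : R -> V -> C) :
  (forall t, a <= t <= b -> linear (L t)) -> (forall v, ccont a b (L ^~ v)) ->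
  linear (fun v => cint a b (L ^~ v)).
Proof.
move=> Llin Lc r u v.
transitivity (r * cint a b (L^~ u) + cint a b (L^~ v)); last by [].
rewrite -cintZ // -cintD //; last exact: ccontM (@ccont_cst _ _ _ _) (Lc u).
by apply: cint_eq => t tab; rewrite (Llin t tab).
Qed.

(** Differentiation under the integral sign, from a quadratic remainder uniform in t. *)
Lemma cint_differentiable n (a b : R) (F : R -> 'rV[C]_n -> C)
    (L : R -> 'rV[C]_n -> C) x (K d : R) : a <= b -> 0 < d ->
  (forall t, a <= t <= b -> linear (L t)) -> (forall v, ccont a b (L ^~ v)) ->
  (forall h, nr h < d -> ccont a b (F ^~ (x + h))) ->
  (forall t h, a <= t <= b -> nr h < d ->
    nr (F t (x + h) - F t x - L t h) <= K * nr h ^+ 2) ->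
  differentiable (fun y => cint a b (F ^~ y)) x /\
  forall h, 'd (fun y => cint a b (F ^~ y)) x h = cint a b (L ^~ h).
Proof.
move=> ab d0 Llin Lc Fc FK.
have lin := cint_linear Llin Lc.
have [|fd dE] := @has_diff_rV R n C (fun y => cint a b (F ^~ y)) x _ lin.
  apply: (@has_diff_sqr _ _ _ _ _ _ (2 * K * (b - a)) d) => // h hd.
  have F0 : ccont a b (F ^~ x) by have := Fc 0; rewrite addr0; apply; rewrite nr0.
  have cF := Fc h hd; rewrite -cintB // -cintB //; last exact: ccontB.
  rewrite [leRHS](_ : _ = 2 * (K * nr h ^+ 2) * (b - a)); last by ring.
  apply: cint_bound => //; first by apply: ccontB => //; exact: ccontB.
  by move=> t tab; exact: FK.
by split=> // h; rewrite dE.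
Qed.

Let mulVr_real (a : R) (z : C) : a != 0 -> (a^-1)%:C%C * (a%:C%C * z) = z.
Proof. by move=> a0; rewrite mulrA -rmorphM /= mulVf // mul1r. Qed.

(** Cauchy's formula writes the directional derivative at y as an integral of f over a circle
    translated with y, and this can be differentiated under the integral sign. All higher regularity
    comes from here. *)
Lemma holo_diff n (D : set 'rV[C]_n) (f : 'rV[C]_n -> C) v :
  open D -> holo D f -> holo D (fun x => 'd f x v : C).
Proof.
move=> oD fD x Dx; have [s [M [s0 [fM sD]]]] := nbhs_holo_le oD fD Dx.
(* The circle of radius r in the direction v stays within s / 8 of its centre; the added 1 covers v
   = 0. *)
pose r := s / 8 / (nr v + 1).
have v1 : 0 < nr v + 1 by rewrite ltr_wpDl.
have r0 : 0 < r by rewrite !divr_gt0.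
have rv : r * nr v <= s / 8.
  by rewrite /r mulrAC ler_pdivrMr // ler_wpM2l ?lerDl // ltW // divr_gt0.
have s8 : 0 < s / 8 by rewrite divr_gt0.
have nv := nr_ge0 v.
have far y : nr (y - x) <= s / 4 -> holo_le f y (3 * (s / 8)) M.
  move=> ys; apply: (holo_le_sub _ fM); lra.
have far1 y : nr (y - x) <= s / 4 -> differentiable f y.
  by move=> /far H; apply: (proj1 (H y _)); rewrite subrr nr0 mulr_ge0 // ltW.
have circ t : nr (x + cexp (ln r) t *: v - x) <= s / 8.
  by rewrite addrC addKr nrZ cexp_circle.
pose F (t : R) (y : 'rV[C]_n) := f (y + cexp (ln r) t *: v) * cexp 0 (- t).
pose L (t : R) (h : 'rV[C]_n) := 'd f (x + cexp (ln r) t *: v) h * cexp 0 (- t) : C.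
have dc y h : nr (y - x) <= s / 8 -> {for y, continuous (fun y => 'd f y h : C)}.
  move=> yx; apply/continuous_nrP => e e0.
  have fy : holo_le f y (3 * (s / 8)) M by apply: far; lra.
  pose K := 8 * M / (s / 8) ^+ 2 * nr h.
  have K1 : 0 < `|K| + 1 by rewrite ltr_wpDl.
  exists (Num.min (s / 8) (e / (`|K| + 1))); first by rewrite lt_min s8 divr_gt0.
  move=> z; rewrite lt_min => /andP[/ltW zs]; rewrite ltr_pdivlMr // => zK.
  have := diff_lip h s8 fy zs; rewrite (addrC y) subrK => /le_lt_trans; apply.
  apply: le_lt_trans zK; rewrite [leLHS]mulrAC -/K mulrC ler_wpM2l //.
  by rewrite (le_trans (ler_norm _)) // lerDl.
have [||||Fd dF] := @cint_differentiable n 0 (2 * pi) F L x (16 * M / (s / 8) ^+ 2) (s / 8) (@pi2_ge0 R) s8.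
- by move=> t _ c u w; rewrite /L linearP mulrDl; congr (_ + _); exact: (esym (mulrA _ _ _)).
- move=> h; pose g y : C := 'd f y h.
  have gc y : nr (y - x) <= r * nr v -> {for y, continuous g}.
    by move=> yr; apply: dc; rewrite (le_trans yr).
  exact: (ccontM (@ccont_circle_comp _ g x v r 0 (2 * pi) r0 gc) (@ccont_circleN 0 (2 * pi))).
- move=> h hs.
  have gc y : nr (y - (x + h)) <= r * nr v -> {for y, continuous f}.
    move=> yr; apply: differentiable_continuous; apply: far1.
    rewrite (le_trans (nr_tri (x + h) y x)) // [x + h - x]addrC addKr; lra.
  exact: (ccontM (@ccont_circle_comp _ f (x + h) v r 0 (2 * pi) r0 gc) (@ccont_circleN 0 (2 * pi))).
- move=> t h _ hs; rewrite /F /L -!mulrBl nrM nr_cexp expR0 mulr1.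
  have -> : x + h + cexp (ln r) t *: v = x + cexp (ln r) t *: v + h by rewrite addrAC.
  apply: (@taylor2 _ f _ (s / 8) M h s8 _ (ltW hs)).
  by apply: far; have := circ t; lra.
have p0 : 2 * pi * r != 0 by rewrite mulf_neq0 // gt_eqF // pi2_gt0.
pose c := ((2 * pi * r)^-1)%:C%C : C.
pose J y := cint 0 (2 * pi) (F ^~ y).
have dJ y : nr (y - x) < s / 8 -> 'd f y v = c * J y.
  move=> ys; have fy z : nr (z - y) <= r * nr v -> differentiable f z.
    move=> zr; apply: far1; rewrite (le_trans (nr_tri y z x)) //; lra.
  have JE : J y = (2 * pi * r)%:C%C * 'd f y v := cauchy_formula r0 fy.
  by rewrite JE; exact: esym (mulVr_real _ p0).
have cd : differentiable (c *: J) x := @differentiableZ _ _ _ J c x Fd.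
move: J dJ cd => J dJ cd.
(* The integral represents the derivative only near x, so differentiability is transferred through
   increments shorter than s / 8. *)
have [||fd _] := @has_diffP _ _ _ (fun y => 'd f y v : C) x ('d (c *: J) x); last exact: fd.
  exact: diff_continuous cd.
move=> e e0; have [d d0 dP] := diff_has_diff cd e0.
exists (Num.min d (s / 8)); first by rewrite lt_min d0.
move=> h; rewrite lt_min => /andP[hd hs].
have dx : 'd f x v = c * J x by apply: dJ; rewrite subrr nr0.
have dxh : 'd f (x + h) v = c * J (x + h) by apply: dJ; rewrite [x + h]addrC addrK.
have H : nr (c * J (x + h) - c * J x - 'd (c *: J) x h) <= e * nr h by exact: dP.
have E (a1 a2 b1 b2 w : C) : a1 = b1 -> a2 = b2 -> nr (b1 - b2 - w) <= e * nr h ->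
  nr (a1 - a2 - w) <= e * nr h by move=> -> ->.
exact: (E _ _ _ _ _ dxh dx H).
Qed.

End SeveralVariables.

(** * The holomorphic inverse function theorem *)

Section Limits.
Variable R : realType.
Local Notation C := (Cplx R).

Lemma le_geo (x y B : R) : (forall k, x <= y + B / 2 ^+ k) -> x <= y.
Proof.
move=> H; rewrite leNgt; apply/negP => yx.
have [k] : exists k, B / 2 ^+ k < x - y by apply: half_expn_lt; rewrite subr_gt0.
by rewrite ltrBrDl ltNge H.
Qed.

Lemma eq_geo (V : normedModType C) (x y : V) (B : R) :
  (forall k, nr (x - y) <= B / 2 ^+ k) -> x = y.
Proof.
move=> H; apply/eqP; rewrite -subr_eq0 -nr_eq0 eq_le nr_ge0 andbT.
by apply: (@le_geo _ _ B) => k; rewrite add0r.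
Qed.

(** The intervals of radius 2 A / 2^k around v k are nested, because a step is at most A / 2^k = 2 A
    / 2^k - 2 A / 2^k.+1. *)
Lemma complete_geoR (v : nat -> R) (A : R) : 0 <= A ->
  (forall k, `|v k.+1 - v k| <= A / 2 ^+ k) ->
  exists l, forall k, `|l - v k| <= 2 * A / 2 ^+ k.
Proof.
move=> A0 vA; have half k : A / 2 ^+ k = A / 2 ^+ k.+1 + A / 2 ^+ k.+1.
  by rewrite exprS; field; rewrite expf_neq0.
have [|||l lP] := @nested_point _ (fun k => v k - 2 * A / 2 ^+ k) (4 * A).
- move=> k; have := vA k; have := half k; rewrite ler_norml -!mulrA => E /andP[].
  lra.
- move=> k; have := vA k; have := half k; rewrite ler_norml -!mulrA => E /andP[].
  lra.
- by rewrite mulr_ge0.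
exists l => k; have := lP k; rewrite ler_norml -!mulrA => /andP[].
by move=> a b; apply/andP; split; lra.
Qed.

Lemma complete_geoC (u : nat -> C) (A : R) :
  (forall k, nr (u k.+1 - u k) <= A / 2 ^+ k) ->
  exists l, forall k, nr (l - u k) <= 4 * A / 2 ^+ k.
Proof.
move=> uA; have A0 : 0 <= A.
  by have := uA 0%N; rewrite expr0 divr1; apply: le_trans.
have [|a aP] := @complete_geoR (fun k => Re (u k)) A A0.
  by move=> k; rewrite -ReB; exact: le_trans (Re_le_nr _) (uA k).
have [|b bP] := @complete_geoR (fun k => Im (u k)) A A0.
  by move=> k; rewrite -ImB; exact: le_trans (Im_le_nr _) (uA k).
exists (a +i* b)%C => k; rewrite (le_trans (nr_le_ReIm _)) // ReB ImB /=.
have -> : 4 * A / 2 ^+ k = 2 * A / 2 ^+ k + 2 * A / 2 ^+ k by ring.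
exact: lerD.
Qed.

Lemma complete_geo n (u : nat -> 'rV[C]_n) (A : R) :
  (forall k, nr (u k.+1 - u k) <= A / 2 ^+ k) ->
  exists l, forall k, nr (l - u k) <= 4 * A / 2 ^+ k.
Proof.
move=> uA; have A0 : 0 <= A.
  by have := uA 0%N; rewrite expr0 divr1; apply: le_trans.
have ex i : exists l : C, forall k, nr (l - u k 0 i) <= 4 * A / 2 ^+ k.
  apply: complete_geoC => k; have := nr_coord (u k.+1 - u k) 0 i.
  by rewrite !mxE => /le_trans; apply.
have [l lP] := choice ex; exists (\row_i l i) => k.
apply: nr_mx_le; first by rewrite divr_ge0 ?mulr_ge0 // exprn_ge0.
by move=> i j; rewrite !mxE ord1; exact: lP.
Qed.

(** By Cauchy's estimate the differentials converge geometrically as well; the second-order Taylor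
    bound, uniform in k, then passes to the limit. *)
Lemma holo_limitC n (U : set 'rV[C]_n) (f : nat -> 'rV[C]_n -> C)
    (g : 'rV[C]_n -> C) (A B M : R) : open U ->
  (forall k, holo U (f k)) -> (forall k y, U y -> nr (f k y) <= M) ->
  (forall k y, U y -> nr (f k.+1 y - f k y) <= A / 2 ^+ k) ->
  (forall k y, U y -> nr (g y - f k y) <= B / 2 ^+ k) -> holo U g.
Proof.
move=> oU fh fM fA gB x Ux.
have [s' [M' [s'0 [_ sU]]]] := nbhs_holo_le oU (fh 0%N) Ux.
pose s := s' / 3; have s0 : 0 < s by rewrite divr_gt0.
have s3 : 3 * s = s' by rewrite /s; field.
have hl k : holo_le (f k) x (3 * s) M.
  by move=> y; rewrite s3 => /sU Uy; split; [exact: fh|exact: fM].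
have sU1 y : nr (y - x) <= s -> U y.
  by move=> ys; apply: sU; rewrite -s3 (le_trans ys) //; lra.
have dA k h : nr ('d (f k.+1) x h - 'd (f k) x h : C) <= 2 * A / s * nr h / 2 ^+ k.
  have E := @diffB _ _ _ (f k.+1) (f k) x (fh _ _ Ux) (fh _ _ Ux).
  have H : nr ('d (f k.+1 - f k) x h : C) <= 2 * (A / 2 ^+ k) / s * nr h.
    apply: (@cauchy_est _ _ (f k.+1 - f k) x s (A / 2 ^+ k) h s0) => y ys.
    split; last exact: fA (sU1 _ ys).
    by apply: differentiableB; apply: fh; exact: sU1.
  have -> : 2 * A / s * nr h / 2 ^+ k = 2 * (A / 2 ^+ k) / s * nr h by ring.
  have E1 := congr1 (fun F : 'rV[C]_n -> C => F h) E.
  have E2 (a b : C) : a = b -> nr a <= 2 * (A / 2 ^+ k) / s * nr h ->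
    nr b <= 2 * (A / 2 ^+ k) / s * nr h by move=> ->.
  exact: (E2 _ _ E1 H).
have [L LP] := choice (fun h => complete_geoC (fun k => dA k h)).
have linL : linear L.
  move=> c u v; transitivity (c * L u + L v); last by [].
  apply: (@eq_geo _ _ _ (4 * (2 * A / s * nr (c *: u + v)) + (nr c * (4 * (2 * A / s * nr u)) + 4 * (2 * A / s * nr v)))) => k.
  set dk := fun h => 'd (f k) x h : C.
  have dkE : dk (c *: u + v) = c * dk u + dk v.
    exact: (linearP ('d (f k) x) c u v).
  have H h : nr (L h - dk h) <= 4 * (2 * A / s * nr h) / 2 ^+ k by exact: LP.
  clearbody dk.
  have -> : L (c *: u + v) - (c * L u + L v) = (L (c *: u + v) - dk (c *: u + v)) -
    (c * (L u - dk u) + (L v - dk v)) by rewrite dkE; ring.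
  rewrite (le_trans (nrB _ _)) // mulrDl lerD // mulrDl.
  rewrite (le_trans (nrD _ _)) // lerD // nrM -mulrA ler_wpM2l //.
have gB' y : nr (y - x) <= s -> forall k, nr (g y - f k y) <= B / 2 ^+ k.
  by move=> /sU1 Uy k; exact: gB.
have [|//] := @has_diff_rV _ _ _ g x L linL.
apply: (@has_diff_sqr _ _ _ _ _ _ (16 * M / s ^+ 2) s) => // h /ltW hs.
apply: (@le_geo _ _ (B + B + 4 * (2 * A / s * nr h))) => k.
have T := taylor2 s0 (hl k) hs.
have H := LP h k.
have xh : nr (x + h - x) <= s by rewrite addrC addKr.
have xx : nr (x - x) <= s by rewrite subrr nr0 ltW.
have G1 := gB' _ xh k; have G2 := gB' _ xx k.
move: T H G1 G2; move: (g (x + h)) (g x) (f k (x + h)) (f k x) ('d (f k) x h : C) (L h).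
move=> a b a' b' l' l T H G1 G2.
have -> : a - b - l = (a' - b' - l') + ((a - a') - (b - b') - (l - l')) by ring.
rewrite (le_trans (nrD _ _)) // lerD // (mulrDl (B + B)) (mulrDl B).
by rewrite (le_trans (nrB _ _)) // lerD // (le_trans (nrB _ _)) // lerD.
Qed.

Lemma holo_limit n m (U : set 'rV[C]_n) (f : nat -> 'rV[C]_n -> 'rV[C]_m)
    (g : 'rV[C]_n -> 'rV[C]_m) (A B M : R) : open U ->
  (forall k, holo U (f k)) -> (forall k y, U y -> nr (f k y) <= M) ->
  (forall k y, U y -> nr (f k.+1 y - f k y) <= A / 2 ^+ k) ->
  (forall k y, U y -> nr (g y - f k y) <= B / 2 ^+ k) -> holo U g.
Proof.
move=> oU fh fM fA gB x Ux; apply/differentiable_rVP => i.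
apply: (@holo_limitC n U (fun k y => f k y 0 i) (fun y => g y 0 i) A B M) => //.
- by move=> k y Uy; move/differentiable_rVP: (fh k y Uy); apply.
- by move=> k y Uy; rewrite (le_trans (nr_coord _ _ _)) // fM.
- move=> k y Uy; have := nr_coord (f k.+1 y - f k y) 0 i.
  by rewrite !mxE => /le_trans; apply; exact: fA.
- move=> k y Uy; have := nr_coord (g y - f k y) 0 i.
  by rewrite !mxE => /le_trans; apply; exact: gB.
Qed.

(** The radius (1 + \sum_j 1 / r_j)^-1 lies below every r_i and makes sense also for an empty
    family. *)
Lemma finite_radius n (P : 'I_n -> R -> Prop) :
  (forall i, exists2 r : R, 0 < r & P i r) ->
  (forall i r r', 0 < r' -> r' <= r -> P i r -> P i r') ->
  exists2 r : R, 0 < r & forall i, P i r.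
Proof.
move=> ex mono.
have exr i : exists r : R, 0 < r /\ P i r by have [r] := ex i; exists r.
have [r rP] := choice exr.
have S0 : 0 < 1 + \sum_j (r j)^-1.
  by rewrite ltr_pwDl // sumr_ge0 // => i _; rewrite invr_ge0 ltW // (proj1 (rP i)).
exists (1 + \sum_j (r j)^-1)^-1; first by rewrite invr_gt0.
move=> i; have [ri Pi] := rP i; apply: mono Pi; first by rewrite invr_gt0.
rewrite -[leRHS]invrK lef_pV2 ?posrE ?invr_gt0 //.
rewrite (bigD1 i) //= addrCA lerDl addr_ge0 // sumr_ge0 // => j _.
by rewrite invr_ge0 ltW // (proj1 (rP j)).
Qed.

Lemma ball_segment (V : normedModType C) (x y z : V) (r t : R) :
  nr (y - x) <= r -> nr (z - x) <= r -> 0 <= t <= 1 ->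
  nr (z + (t%:C%C : C) *: (y - z) - x) <= r.
Proof.
move=> yr zr t01.
have -> : z + (t%:C%C : C) *: (y - z) - x = (1 - t)%:C%C *: (z - x) + (t%:C%C : C) *: (y - x).
  rewrite rmorphB /= scalerBl scale1r -[RHS]addrA [- _ + _]addrC -scalerBr.
  by rewrite addrAC; congr (_ + _ *: _); rewrite opprB addrA subrK.
move: t01 => /andP[t0 t1]; rewrite (le_trans (nrD _ _)) // !nrZ !nr_real.
rewrite (ger0_norm t0) ger0_norm ?subr_ge0 //.
have -> : r = (1 - t) * r + t * r by ring.
by rewrite lerD // ler_wpM2l // subr_ge0.
Qed.

(** The differential is itself Lipschitz by [diff_lip], so it is at most e / 2 near a point where it
    vanishes; the mean value inequality doubles this. *)
Lemma flat_lip n m (D : set 'rV[C]_n) (f : 'rV[C]_n -> 'rV[C]_m) x (e : R) :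
  open D -> holo D f -> D x -> (forall v, 'd f x v = 0) -> 0 < e ->
  exists2 r : R, 0 < r & forall y z, nr (y - x) <= r -> nr (z - x) <= r ->
    D y /\ nr (f y - f z) <= e * nr (y - z).
Proof.
move=> oD fD Dx d0 e0.
pose P i r := forall y z, nr (y - x) <= r -> nr (z - x) <= r ->
    nr (f y 0 i - f z 0 i) <= e * nr (y - z).
have [|i r r' _ r'r Pr y z yr zr|r r0 rP] := @finite_radius m P.
- move=> i; pose g y : C := f y 0 i.
  have gD : holo D g by move=> y Dy; move/differentiable_rVP: (fD y Dy); apply.
  have [s' [M [s'0 [gM sD]]]] := nbhs_holo_le oD gD Dx.
  pose s := s' / 3; have s0 : 0 < s by rewrite divr_gt0.
  have s3 : 3 * s = s' by rewrite /s; field.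
  rewrite -s3 in gM sD.
  pose K := 8 * M / s ^+ 2.
  have K1 : 0 < `|K| + 1 by rewrite ltr_wpDl.
  have dg v : 'd g x v = 0 :> C.
    have H := diff_coord v i (fD x Dx); rewrite d0 mxE in H; exact: esym.
  pose r := Num.min s (e / 2 / (`|K| + 1)).
  have r0 : 0 < r by rewrite lt_min s0 !divr_gt0.
  have rs : r <= s by rewrite ge_min lexx.
  have rK : K * r <= e / 2.
    rewrite (@le_trans _ _ ((`|K| + 1) * r)) //.
      by rewrite ler_wpM2r ?(ltW r0) // (le_trans (ler_norm _)) // lerDl.
    by rewrite mulrC -ler_pdivlMr // ge_min lexx orbT.
  exists r => // y z yr zr.
  have bd w h : nr (w - x) <= r -> nr ('d g w h : C) <= e / 2 * nr h.
    move=> wr; have ws : nr (w - x) <= s by exact: le_trans rs.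
    have xw : x + (w - x) = w by rewrite addrC subrK.
    have := diff_lip h s0 gM ws; rewrite xw => H.
    have E (a b : C) c : b = 0 -> nr (a - b) <= c -> nr a <= c.
      by move=> ->; rewrite subr0.
    apply: le_trans (E _ _ _ (dg h) H) _.
    rewrite ler_wpM2r //; have [K0|/ltW K0] := leP 0 K.
      by apply: le_trans rK; rewrite ler_wpM2l.
    by apply: (@le_trans _ _ 0); [exact: mulr_le0_ge0|rewrite ltW // divr_gt0].
  have zy : z + (y - z) = y by rewrite addrC subrK.
  have -> : e * nr (y - z) = 2 * (e / 2 * nr (y - z)) by field.
  rewrite -[f y 0 i]/(g y) -[f z 0 i]/(g z) -[in g y]zy.
  apply: (@diff_MVI _ _ g z (y - z) (e / 2 * nr (y - z))) => t t01.
  have tr : nr (z + (t%:C%C : C) *: (y - z) - x) <= r by exact: ball_segment.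
  split; last exact: bd.
  by apply: gD; apply: sD; lra.
- by apply: Pr; exact: le_trans r'r.
have /nbhs_nrP[d d_gt0 dD] : nbhs x D by exact: open_nbhs_nbhs.
exists (Num.min r (d / 2)); first by rewrite lt_min r0 divr_gt0.
move=> y z; rewrite !le_min => /andP[yr yd] /andP[zr _]; split.
  by apply: dD; rewrite (le_lt_trans yd) // ltr_pdivrMr // ltr_pMr ?ltr1n.
apply: nr_mx_le; first by rewrite mulr_ge0 // ltW.
by move=> i j; rewrite !mxE ord1; exact: rP.
Qed.

Lemma mulmx_has_diff n m (B : 'M[C]_(n, m)) (x : 'rV[C]_n) :
  differentiable (fun y : 'rV[C]_n => y *m B) x /\
  forall v, 'd (fun y : 'rV[C]_n => y *m B) x v = v *m B.
Proof.
have lin : linear (fun y : 'rV[C]_n => y *m B).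
  by move=> a u v; rewrite mulmxDl scalemxAl.
have [|fd dE] := @has_diff_rV R n _ (fun y : 'rV[C]_n => y *m B) x _ lin.
  move=> e e0; exists 1 => // h _.
  by rewrite mulmxDl (addrC (x *m B)) addrK subrr nr0 mulr_ge0 // ltW.
by split=> // v; rewrite dE.
Qed.

(* The inverse is the limit of the iteration s |-> s - (X s - x) B, where B is
   the inverse of the differential of X at s0. *)
Lemma inverse_function n (X : 'rV[C]_n -> 'rV[C]_n) D s0 :
  open D -> holo D X -> D s0 -> (forall v, 'd X s0 v = 0 -> v = 0) ->
  exists E U (Y : 'rV[C]_n -> 'rV[C]_n),
    [/\ [/\ open E, open U, E s0, E `<=` D & U (X s0)], holo U Y,
        forall x, U x -> E (Y x) /\ X (Y x) = x &
        forall s, E s -> U (X s) -> Y (X s) = s].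
Proof.
move=> oD XD Ds inj.
pose A := lin1_mx ('d X s0); have AE v : v *m A = 'd X s0 v by rewrite mul_rV_lin1.
have Au : A \in unitmx.
  by rewrite -row_free_unit; apply: inj_row_free => v; rewrite AE; exact: inj.
pose B := invmx A.
(* Solving X s = x means finding a fixed point of s |-> x B - rho s, and rho has zero differential
   at s0. *)
pose rho s := X s *m B - s.
have rho_d s : D s -> differentiable rho s /\ forall v, 'd rho s v = 'd X s v *m B - v.
  move=> /XD Xs; have [Bd BE] := mulmx_has_diff B (X s).
  have [cd cE] : differentiable (fun y => X y *m B) s /\
      forall v, 'd (fun y => X y *m B) s v = 'd X s v *m B.
    have [cd cE] := diff_compE Xs Bd; split; first exact: cd.
    by move=> v; rewrite -BE; exact: cE.
  have [id_d idE] := @diff_linE R n _ id s (fun a u v => erefl).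
  have [rd rE] := diff_subE cd id_d.
  split; first exact: rd.
  move=> v; apply: etrans (rE v) _; congr (_ - _); last exact: idE.
  exact: cE.
have rhoD : holo D rho by move=> s /rho_d[].
have rho0 v : 'd rho s0 v = 0.
  have [_ dE] := rho_d s0 Ds; apply: etrans (dE v) _.
  by rewrite -AE -mulmxA mulmxV // mulmx1 subrr.
(* A Lipschitz constant 1/4 makes the iteration converge faster than 2^-k, and together with |x B -
   X s0 B| < r / 4 it keeps the iterates within r / 2 of s0. *)
have [|r r0 rP] := flat_lip oD rhoD Ds rho0 (e := 1 / 4); first by rewrite divr_gt0.
have rs : nr (s0 - s0) <= r by rewrite subrr nr0 ltW.
pose E := [set s : 'rV[C]_n | nr (s - s0) < r].
pose U := [set x : 'rV[C]_n | nr (x *m B - X s0 *m B) < r / 4].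
have oU : open U.
  have -> : U = (fun x : 'rV[C]_n => x *m B) @^-1` [set y | nr (y - X s0 *m B) < r / 4] by [].
  apply: open_comp; last exact: nr_open.
  by move=> x _; apply: differentiable_continuous; have [] := mulmx_has_diff B x.
pose f := fix f k x := if k is k'.+1 then x *m B - rho (f k' x) else s0.
have fS k x : f k.+1 x = x *m B - rho (f k x) by [].
have fr k x : U x -> nr (f k x - s0) <= r / 2.
  move=> Ux; elim: k => [|k IH].
    by rewrite /= subrr nr0 ltW // divr_gt0.
  rewrite fS; have -> : x *m B - rho (f k x) - s0 =
    (x *m B - X s0 *m B) - (rho (f k x) - rho s0).
    rewrite /rho; move: (x *m B) (X s0 *m B) (X (f k x) *m B - f k x) => a b c.
    by apply/rowP => j; rewrite !mxE; ring.
  have fkr : nr (f k x - s0) <= r by rewrite (le_trans IH) //; lra.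
  have [_ H] := rP _ _ fkr rs.
  rewrite (le_trans (nrB _ _)) //.
  have Ux' : nr (x *m B - X s0 *m B) < r / 4 by exact: Ux.
  lra.
have frr k x : U x -> nr (f k x - s0) <= r.
  by move=> Ux; rewrite (le_trans (fr k x Ux)) //; lra.
have fgeo k x : U x -> nr (f k.+1 x - f k x) <= r / 2 ^+ k.
  move=> Ux; elim: k => [|k IH]; first by rewrite expr0 divr1; exact: frr.
  have -> : f k.+2 x - f k.+1 x = - (rho (f k.+1 x) - rho (f k x)).
    rewrite (fS k.+1) [X in _ - X = _](fS k).
    move: (x *m B) (rho (f k.+1 x)) (rho (f k x)) => a b c.
    by apply/rowP => j; rewrite !mxE; ring.
  rewrite nrN.
  have [_ H] := rP _ _ (frr k.+1 x Ux) (frr k x Ux).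
  rewrite (le_trans H) //; have -> : r / 2 ^+ k.+1 = 1 / 2 * (r / 2 ^+ k).
    by rewrite exprS; field; rewrite expf_neq0.
  have := nr_ge0 (f k.+1 x - f k x); lra.
have exY x : exists l, U x -> forall k, nr (l - f k x) <= 4 * r / 2 ^+ k.
  have [Ux|nUx] := pselect (U x); last by exists 0.
  by have [l lP] := complete_geo (fun k => fgeo k x Ux); exists l.
have [Y YP] := choice exY.
have Yr x : U x -> nr (Y x - s0) <= r / 2.
  move=> Ux; apply: (@le_geo _ _ (4 * r)) => k.
  rewrite (le_trans (nr_tri (f k x) _ _)) // addrC lerD //; first exact: fr.
  exact: YP.
have Yrr x : U x -> nr (Y x - s0) <= r.
  by move=> Ux; rewrite (le_trans (Yr x Ux)) //; lra.
have Yfix x : U x -> Y x = x *m B - rho (Y x).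
  move=> Ux; apply: (@eq_geo _ _ _ (4 * r + 4 * r)) => k.
  have -> : Y x - (x *m B - rho (Y x)) = (Y x - f k.+1 x) + (rho (Y x) - rho (f k x)).
    rewrite fS; move: (Y x) (x *m B) (rho (Y x)) (rho (f k x)) => a b c d'.
    by apply/rowP => j; rewrite !mxE; ring.
  have [_ H] := rP _ _ (Yrr x Ux) (frr k x Ux).
  have G := YP x Ux k; have G1 := YP x Ux k.+1.
  rewrite (le_trans (nrD _ _)) // mulrDl lerD //.
    rewrite (le_trans G1) // ler_wpM2l ?mulr_ge0 ?(ltW r0) // lef_pV2 ?posrE ?exprn_gt0 //.
    by rewrite ler_eXn2l ?ltr1n.
  rewrite (le_trans H) // (le_trans _ G) //.
  have := nr_ge0 (Y x - f k x); lra.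
exists E, U, Y; split.
- split=> //.
  + exact: nr_open.
  + by rewrite /E /= subrr nr0.
  + by move=> s Es; have [] := rP s s0 (ltW Es) rs.
  + by rewrite /U /= subrr nr0 divr_gt0.
- apply: (@holo_limit n n U f Y r (4 * r) (nr s0 + r)) => //.
  + elim=> [|k IH] x Ux; first exact: differentiable_cst.
    have [Bd _] := mulmx_has_diff B x.
    have Dk : D (f k x) by have [] := rP _ _ (frr k x Ux) rs.
    have [c1 _] := diff_compE (IH x Ux) (rhoD _ Dk).
    by have [] := diff_subE Bd c1.
  + move=> k y Uy; rewrite -[f k y](subrK s0) (le_trans (nrD _ _)) // addrC lerD2l.
    exact: frr.
  + by move=> k y Uy; exact: YP.
- move=> x Ux; split; first by rewrite /E /= (le_lt_trans (Yr x Ux)) //; lra.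
  have H : X (Y x) *m B = x *m B.
    have := Yfix x Ux; rewrite /rho; move: (X (Y x) *m B) (x *m B) => a b.
    by move=> /(congr1 (fun w => w + (a - Y x))); rewrite subrK addrC subrK.
  by move: (congr1 (fun w => w *m A) H); rewrite /= -!mulmxA mulVmx // !mulmx1.
- move=> s Es Us; have Hs : s = X s *m B - rho s by rewrite /rho subKr.
  have [_ H] := rP _ _ (Yrr _ Us) (ltW Es).
  apply/eqP; rewrite -subr_eq0 -nr_eq0 eq_le nr_ge0 andbT.
  have E1 : Y (X s) - s = - (rho (Y (X s)) - rho s).
    rewrite {1}(Yfix _ Us) {3}Hs; move: (X s *m B) (rho (Y (X s))) (rho s) => a b c.
    by apply/rowP => j; rewrite !mxE; ring.
  have := nrN (rho (Y (X s)) - rho s); rewrite -E1 => E2.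
  have := nr_ge0 (Y (X s) - s); lra.
Qed.

End Limits.

(** * The Frobenius theorem *)

Section Rays.
Variable R : realType.
Local Notation C := (Cplx R).

Lemma holo_coord n m (D : set 'rV[C]_n) (f : 'rV[C]_n -> 'rV[C]_m) i :
  holo D f -> holo D (fun y => f y 0 i : C).
Proof. by move=> fD y Dy; move/differentiable_rVP: (fD y Dy). Qed.

Lemma holo_diff_rV n m (D : set 'rV[C]_n) (f : 'rV[C]_n -> 'rV[C]_m) v :
  open D -> holo D f -> holo D (fun x => 'd f x v).
Proof.
move=> oD fD x Dx; apply/differentiable_rVP => i.
have H := holo_diff v oD (holo_coord i fD).
have [d d0 dD] := (nbhs_nrP x D).1 (open_nbhs_nbhs (conj oD Dx)).
have fE y : D y -> 'd f y v 0 i = 'd (fun y => f y 0 i : C) y v.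
  by move=> Dy; exact: diff_coord (fD y Dy).
have := diff_has_diff (H x Dx) => H1.
have [||fd _] := @has_diffP _ _ _ (fun y => 'd f y v 0 i : C) x
  ('d (fun y => 'd (fun y => f y 0 i : C) y v : C) x); last exact: fd.
  exact: diff_continuous (H x Dx).
move=> e e0; have [d' d'0 d'P] := H1 e e0.
exists (Num.min d d'); first by rewrite lt_min d0.
move=> k; rewrite lt_min => /andP[kd kd'].
have E1 := fE x Dx; have E2 : 'd f (x + k) v 0 i = 'd (fun y => f y 0 i : C) (x + k) v.
  by apply: fE; apply: dD; rewrite addrC addKr.
have T (a b a' b' w : C) : a = a' -> b = b' -> nr (a' - b' - w) <= e * nr k ->
  nr (a - b - w) <= e * nr k by move=> -> ->.
exact: (T _ _ _ _ _ E2 E1 (d'P k kd')).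
Qed.

Lemma holo_bound n m (D : set 'rV[C]_n) (f : 'rV[C]_n -> 'rV[C]_m) x :
  open D -> holo D f -> D x ->
  exists r L : R, [/\ 0 < r, 0 < L & forall y, nr (y - x) <= r ->
    [/\ D y, nr (f y) <= L & forall v, nr ('d f y v) <= L * nr v]].
Proof.
move=> oD fD Dx.
(* With r^-1 as the bound, a single number is both radius and bound, and shrinking it weakens both
   requirements, as [finite_radius] demands. *)
pose P i r := forall y, nr (y - x) <= r -> nr (f y 0 i) <= r^-1 /\
  forall v, nr ('d (fun y => f y 0 i : C) y v : C) <= r^-1 * nr v.
have [|i r r' r'0 r'r Pr y yr'|r r0 rP] := @finite_radius R m P.
- move=> i; have [s [M [s0 [gM sD]]]] := nbhs_holo_le oD (holo_coord i fD) Dx.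
  have M0 : 0 <= M.
    by apply: le_trans (proj2 (gM x _)); rewrite ?nr_ge0 // subrr nr0 ltW.
  have s2 : 0 < s / 2 by rewrite divr_gt0.
  pose K := M + 2 * M / (s / 2) + 1.
  have k0 : 0 <= 2 * M / (s / 2) by rewrite !mulr_ge0 // invr_ge0 ltW.
  have K0 : 0 < K by rewrite ltr_wpDl // addr_ge0.
  have rK : K <= (Num.min (s / 2) K^-1)^-1.
    rewrite -[X in X <= _]invrK lef_pV2 ?posrE ?invr_gt0 ?lt_min ?s2 ?invr_gt0 //.
    by rewrite ge_min lexx orbT.
  exists (Num.min (s / 2) K^-1); first by rewrite lt_min s2 invr_gt0.
  move=> y; rewrite le_min => /andP[ys _]; split.
    by apply: le_trans rK; rewrite (le_trans (proj2 (gM y _))) /K //; lra.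
  move=> v; apply: (@le_trans _ _ (K * nr v)); last by rewrite ler_wpM2r.
  have H : holo_le (fun y => f y 0 i : C) y (s / 2) M by apply: (holo_le_sub _ gM); lra.
  apply: le_trans (cauchy_est v s2 H) _.
  by rewrite ler_wpM2r // /K; lra.
- have [H1 H2] := Pr y (le_trans yr' r'r).
  have rr : r^-1 <= r'^-1 by rewrite lef_pV2 ?posrE // (lt_le_trans r'0).
  split; first exact: le_trans rr.
  by move=> v; apply: le_trans (H2 v) _; rewrite ler_wpM2r.
have /nbhs_nrP[d d_gt0 dD] : nbhs x D by exact: open_nbhs_nbhs.
exists (Num.min r (d / 2)), r^-1; split; [by rewrite lt_min r0 divr_gt0|by rewrite invr_gt0|].
move=> y; rewrite le_min => /andP[yr yd].
have Dy : D y by apply: dD; rewrite (le_lt_trans yd) // ltr_pdivrMr // ltr_pMr ?ltr1n.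
have ri : 0 <= r^-1 by rewrite invr_ge0 ltW.
split; first exact: Dy.
  by apply: nr_mx_le => // i j; rewrite ord1; have [] := rP j y yr.
move=> v; apply: nr_mx_le; first by rewrite mulr_ge0.
move=> i j; rewrite ord1 (diff_coord v j (fD y Dy)).
exact: (proj2 (rP j y yr)).
Qed.

Lemma rV_MVI n m (f : 'rV[C]_n -> 'rV[C]_m) x v (K : R) : 0 <= K ->
  (forall t : R, 0 <= t <= 1 -> differentiable f (x + (t%:C%C : C) *: v) /\
    nr ('d f (x + (t%:C%C : C) *: v) v) <= K) -> nr (f (x + v) - f x) <= 2 * K.
Proof.
move=> K0 fK; apply: nr_mx_le; first by rewrite mulr_ge0.
move=> i j; rewrite ord1 !mxE.
apply: (@diff_MVI _ _ (fun y => f y 0 j : C) x v K) => t t01.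
have [fd fk] := fK t t01; split; first by move/differentiable_rVP: fd.
have H := nr_coord ('d f (x + (t%:C%C : C) *: v) v) 0 j.
apply: le_trans fk; apply: le_trans H.
by rewrite (diff_coord v j fd).
Qed.

Lemma holo_lipschitz n m (D : set 'rV[C]_n) (f : 'rV[C]_n -> 'rV[C]_m) x (r L : R) :
  0 < L -> holo D f -> (forall y, nr (y - x) <= r ->
    [/\ D y, nr (f y) <= L & forall v, nr ('d f y v) <= L * nr v]) ->
  forall y z, nr (y - x) <= r -> nr (z - x) <= r ->
    nr (f y - f z) <= 2 * L * nr (y - z).
Proof.
move=> L0 fD H y z yr zr; have zy : z + (y - z) = y by rewrite addrC subrK.
rewrite -mulrA -{1}zy; apply: rV_MVI; first by rewrite mulr_ge0 // ltW.
move=> t t01; have [Dt _ dt] := H _ (ball_segment yr zr t01).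
by split; [exact: fD|exact: dt].
Qed.

Lemma diff_eq_on n (W : normedModType C) (D : set 'rV[C]_n) (f g : 'rV[C]_n -> W) x :
  open D -> D x -> (forall y, D y -> f y = g y) -> differentiable g x ->
  differentiable f x /\ forall v, 'd f x v = 'd g x v.
Proof.
move=> oD Dx fg gx; have [d d0 dD] := (nbhs_nrP x D).1 (open_nbhs_nbhs (conj oD Dx)).
have [|fd dE] := @has_diff_rV _ _ _ f x ('d g x) (fun a u v => linearP ('d g x) a u v).
  move=> e e0; have [d' d'0 d'P] := diff_has_diff gx e0.
  exists (Num.min d d'); first by rewrite lt_min d0.
  move=> k; rewrite lt_min => /andP[kd kd'].
  have E1 := fg x Dx; have E2 : f (x + k) = g (x + k).
    by apply: fg; apply: dD; rewrite addrC addKr.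
  have T (a b a' b' w : W) : a = a' -> b = b' -> nr (a' - b' - w) <= e * nr k ->
    nr (a - b - w) <= e * nr k by move=> -> ->.
  exact: (T _ _ _ _ _ E2 E1 (d'P k kd')).
split; first exact: fd.
by move=> v; exact: (congr1 (fun F : 'rV[C]_n -> W => F v) dE).
Qed.

(** * Integrals of 1-forms along the rays from the origin *)

Section RayIntegral.
Variables (m : nat) (rho M : R) (Psi : 'rV[C]_m -> 'rV[C]_m).
Let B := [set y : 'rV[C]_m | nr y < rho].
Hypothesis Psi_holo : holo B Psi.
Hypothesis Psi_le : forall y, B y -> nr (Psi y) <= M.

(** The 1-form \sum_b Psi_b dy_b pulled back to the segment from 0 to y; [ray_int] is thus the
    homotopy operator of the Poincare lemma. *)
Definition ray_form (y : 'rV[C]_m) (t : R) : C :=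
  \sum_b y 0 b * Psi ((t%:C%C : C) *: y) 0 b.

Definition ray_diff (y v : 'rV[C]_m) (t : R) : C := \sum_b
  (v 0 b * Psi ((t%:C%C : C) *: y) 0 b +
   y 0 b * (t%:C%C * 'd Psi ((t%:C%C : C) *: y) v 0 b)).

Definition ray_int (y : 'rV[C]_m) : C := cint 0 1 (ray_form y).

Lemma ball0_open : open B.
Proof.
have -> : B = [set y | nr (y - 0) < rho] by apply/seteqP; split=> y; rewrite /B /= subr0.
exact: nr_open.
Qed.

Lemma ball0_scale y (t : R) : B y -> 0 <= t <= 1 -> B ((t%:C%C : C) *: y).
Proof. by move=> By t01; rewrite /B /= (le_lt_trans (nr_scale_le y t01)). Qed.

Lemma ccont_ray (y : 'rV[C]_m) : ccont 0 1 (fun t : R => (t%:C%C : C) *: y).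
Proof.
move=> t _ e e0; have y0 : 0 < nr y + 1 by rewrite ltr_wpDl.
exists (e / (nr y + 1)); first by rewrite divr_gt0.
move=> s _; rewrite ltr_pdivlMr // => st.
rewrite -scalerBl -rmorphB /= nrZ nr_real (le_lt_trans _ st) //.
by rewrite ler_wpM2l // lerDl.
Qed.

Lemma ccont_ray_comp y (g : 'rV[C]_m -> C) : holo B g -> B y ->
  ccont 0 1 (fun t : R => g ((t%:C%C : C) *: y)).
Proof.
move=> gB By; apply: (@ccont_comp _ _ C 0 1 g (fun t : R => (t%:C%C : C) *: y)).
  exact: ccont_ray.
by move=> t t01; apply/differentiable_continuous/gB/ball0_scale.
Qed.

Lemma ccont_real (a b : R) : ccont a b (fun t : R => t%:C%C : C).
Proof.
move=> t _ e e0; exists e => // s _ st.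
by rewrite -rmorphB /= nr_real.
Qed.

Lemma ccont_ray_form y : B y -> ccont 0 1 (ray_form y).
Proof.
move=> By; apply: ccont_sum => b; apply: ccontM; first exact: ccont_cst.
exact: (ccont_ray_comp (holo_coord b Psi_holo) By).
Qed.

Lemma ccont_ray_diff y v : B y -> ccont 0 1 (ray_diff y v).
Proof.
move=> By; apply: ccont_sum => b; apply: ccontD.
  apply: ccontM; first exact: ccont_cst.
  exact: (ccont_ray_comp (holo_coord b Psi_holo) By).
apply: ccontM; first exact: ccont_cst.
apply: ccontM; first exact: ccont_real.
exact: (ccont_ray_comp (holo_coord b (holo_diff_rV v ball0_open Psi_holo)) By).
Qed.

Lemma diff_at_scale n (x : 'rV[C]_n) (c : C) :
  diff_at (fun y : 'rV[C]_n => c *: y) x (fun v => c *: v).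
Proof. by apply: diff_at_lin => a u v; rewrite scalerDr !scalerA mulrC. Qed.

Lemma ray_form_diff y t : B y -> 0 <= t <= 1 ->
  diff_at (fun y => ray_form y t) y (fun v => ray_diff y v t).
Proof.
move=> By t01; have Bt := ball0_scale By t01.
apply: diff_at_sum => b.
have Pd := diff_at_coord b (diff_at_comp (diff_at_scale y (t%:C%C : C)) (diff_at_d (Psi_holo Bt))).
have id_d := diff_at_coord b (diff_at_id y).
apply: diff_at_eq (diff_at_mul id_d Pd) => v.
by rewrite linearZ mxE addrC [X in X + _]mulrC.
Qed.

Lemma ray_int_diff y : B y ->
  diff_at ray_int y (fun v => cint 0 1 (ray_diff y v)).
Proof.
(* The ball of radius 3 s around y, which [taylor2] needs, then stays inside [B]. *)
move=> By; pose s := (rho - nr y) / 4.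
have s0 : 0 < s by rewrite divr_gt0 // subr_gt0.
have Bs z : nr (z - y) <= 3 * s -> B z.
  move=> zs; rewrite /B /= -[z](subrK y) (le_lt_trans (nrD _ _)) //.
  by rewrite /s in zs *; have : nr y < rho by []; lra.
have rho0 : 0 <= rho by apply: le_trans (ltW By).
have M0 : 0 <= M by apply: le_trans (Psi_le By).
have hl t : 0 <= t <= 1 -> holo_le (fun y => ray_form y t) y (3 * s) (m%:R * (rho * M)).
  move=> t01 z /Bs Bz; split; first exact: (proj1 (ray_form_diff Bz t01)).
  rewrite (le_trans (nr_sum _ _ _)) // (@le_trans _ _ (\sum_(b < m) rho * M)) //.
    apply: ler_sum => b _; rewrite nrM ler_pM //.
      by rewrite (le_trans (nr_coord _ _ _)) // ltW.
    by rewrite (le_trans (nr_coord _ _ _)) //; apply/Psi_le/ball0_scale.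
  by rewrite sumr_const card_ord mulr_natl.
apply: (@cint_differentiable _ m 0 1 (fun t y => ray_form y t) (fun t v => ray_diff y v t)
  y (16 * (m%:R * (rho * M)) / s ^+ 2) s) => //.
- move=> t t01 c u v; have [_ dE] := ray_form_diff By t01.
  have E a1 a2 a3 b1 b2 b3 : a1 = b1 -> a2 = b2 -> a3 = b3 ->
    a1 = c *: a2 + a3 -> b1 = c *: b2 + b3 :> C by move=> -> -> ->.
  exact: E (dE _) (dE _) (dE _) (linearP _ c u v).
- by move=> v; exact: ccont_ray_diff.
- move=> h hs; apply: ccont_ray_form; apply: Bs; rewrite addrC addKr; lra.
- move=> t h t01 /ltW hs; have [_ dE] := ray_form_diff By t01.
  have E (p q q' : C) z : q = q' -> nr (p - q) <= z -> nr (p - q') <= z by move=> ->.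
  exact: E (dE h) (taylor2 s0 (hl t t01) hs).
Qed.

(** The integrand is the derivative of t |-> t Psi_b (t y). Writing Psi itself as a ray integral
    allows its comparison with the differential of [ray_int Psi]. *)
Lemma ray_FTC y b : B y ->
  cint 0 1 (fun t : R => Psi ((t%:C%C : C) *: y) 0 b +
    t%:C%C * 'd Psi ((t%:C%C : C) *: y) y 0 b) = Psi y 0 b.
Proof.
move=> By; pose g z : C := Psi z 0 b.
have gB := holo_coord b Psi_holo.
rewrite (@cint_FTC _ (fun t : R => t%:C%C * g ((t%:C%C : C) *: y))) //.
- by rewrite /g !scale1r mul1r mul0r subr0.
- apply: ccontD; first exact: (ccont_ray_comp gB By).
  apply: ccontM; first exact: ccont_real.
  exact: (ccont_ray_comp (holo_coord b (holo_diff_rV y ball0_open Psi_holo)) By).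
move=> t t01; have Bt := ball0_scale By t01.
apply: (@has_diff_cder _ (fun w : C => w * g (w *: y)) t).
have gd : differentiable g (0 + (t%:C%C : C) *: y) by rewrite add0r; exact: gB.
have ld : diff_at (fun w : C => g (0 + w *: y)) t%:C%C (fun k => k * 'd g (0 + (t%:C%C : C) *: y) y).
  exact: has_diff_C (has_diff_line gd).
have := diff_at_has (diff_at_mul (diff_at_id (t%:C%C : C)) ld).
have -> : (fun w : C => w * g (w *: y)) = fun w : C => w * g (0 + w *: y).
  by apply/funext => w; rewrite add0r.
have E k : t%:C%C * (k * 'd g (0 + (t%:C%C : C) *: y) y) + g (0 + (t%:C%C : C) *: y) * k =
    k * (Psi ((t%:C%C : C) *: y) 0 b + t%:C%C * 'd Psi ((t%:C%C : C) *: y) y 0 b).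
  have E1 := diff_coord y b (Psi_holo Bt); rewrite add0r -/(g _).
  have T (p q r s k' : C) : q = r -> s * (k' * r) + p * k' = k' * (p + s * q).
    by move=> ->; ring.
  exact: T E1.
by move=> H e e0; have [d d0 dP] := H e e0; exists d => // k /dP; rewrite E.
Qed.

End RayIntegral.
End Rays.

(** * Picard iteration for an involutive distribution *)

Section Frobenius.
Variable R : realType.
Local Notation C := (Cplx R).
Variables (m n : nat) (J : 'M[C]_(m, n)) (e x0 : 'rV[C]_n) (U : set 'rV[C]_n).
Variable h : 'rV[C]_n -> 'rV[C]_m.
Hypotheses (oU : open U) (h_holo : holo U h) (Ux0 : U x0).

Let pt (phi : 'rV[C]_m -> C) (y : 'rV[C]_m) : 'rV[C]_n := x0 + y *m J + phi y *: e.

(** The fields X_a = J_a + h_a e span the distribution, and [pt phi] parametrizes a candidate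
    integral submanifold as a graph in the direction [e]. The hypothesis [h_integrable] says that
    the brackets [X_a, X_b] = (X_a h_b - X_b h_a) e vanish. *)
Definition frame (x : 'rV[C]_n) (a : 'I_m) : 'rV[C]_n := delta_mx 0 a *m J + h x 0 a *: e.

Hypothesis h_integrable : forall x a b, U x ->
  'd h x (frame x a) 0 b = 'd h x (frame x b) 0 a.

Lemma pt_diff phi y dphi : diff_at phi y dphi ->
  diff_at (pt phi) y (fun v => v *m J + dphi v *: e).
Proof.
move=> fd; have lin : linear (fun v : 'rV[C]_m => v *m J).
  by move=> a u v; rewrite mulmxDl scalemxAl.
have l2 : diff_at (fun c : C => c *: e) (phi y) (fun c => c *: e).
  apply: has_diff_C => d d0; exists 1 => // k _.
  by rewrite scalerDl (addrC (phi y *: e)) addrK subrr nr0 mulr_ge0 // ltW.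
have := diff_at_add (diff_at_add (diff_at_cst x0 y) (diff_at_lin y lin)) (diff_at_comp fd l2).
by apply: diff_at_eq => v; rewrite add0r.
Qed.

Section Estimates.
(** [c1] keeps the graph of a function bounded by delta in the ball where h is controlled, [c2]
    makes the Picard map preserve the bound delta, and [c3] makes it contract by 1/2. *)
Variables (r L KJ delta rho : R).
Hypotheses (L_gt0 : 0 < L) (rho_gt0 : 0 < rho).
Hypothesis hL : forall x : 'rV[C]_n, nr (x - x0) <= r ->
  [/\ U x, nr (h x) <= L & forall v, nr ('d h x v) <= L * nr v].
Hypothesis JK : forall y : 'rV[C]_m, nr (y *m J) <= KJ * nr y.
Let N : R := m%:R.
Hypotheses (KJ_ge0 : 0 <= KJ)
  (c1 : KJ * rho + delta * nr e <= r) (c2 : 2 * (N * rho * L) <= delta)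
  (c3 : 2 * (N * rho * (2 * L * nr e)) <= 1 / 2).
Let B := [set y : 'rV[C]_m | nr y < rho].

Let oB : open B. Proof. exact: ball0_open. Qed.

Let good phi := holo B phi /\ forall y, B y -> nr (phi y : C) <= delta.

Lemma pt_ball phi y : good phi -> B y -> nr (pt phi y - x0) <= r.
Proof.
move=> [_ pd] By; rewrite /pt -(addrA x0) (addrC x0) addrK (le_trans (nrD _ _)) //.
apply: le_trans c1; apply: lerD.
  by rewrite (le_trans (JK _)) // ler_wpM2l // ltW.
by rewrite nrZ ler_wpM2r // pd.
Qed.

Let Psi phi y := h (pt phi y).

Lemma Psi_diff phi y : good phi -> B y ->
  diff_at (Psi phi) y (fun v => 'd h (pt phi y) (v *m J + 'd phi y v *: e)).
Proof.
move=> gphi By; have [Up _ _] := hL (pt_ball gphi By).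
exact: diff_at_comp (pt_diff (diff_at_d (proj1 gphi y By))) (diff_at_d (h_holo Up)).
Qed.

Lemma Psi_holo phi : good phi -> holo B (Psi phi).
Proof. by move=> gphi y By; exact: (proj1 (Psi_diff gphi By)). Qed.

Lemma Psi_le phi y : good phi -> B y -> nr (Psi phi y) <= L.
Proof. by move=> gphi By; have [] := hL (pt_ball gphi By). Qed.

Lemma ray_sum_le y (F : 'I_m -> C) (A : R) : B y -> (forall b, nr (F b) <= A) ->
  nr (\sum_b y 0 b * F b) <= N * rho * A.
Proof.
move=> By FA; rewrite (le_trans (nr_sum _ _ _)) //.
rewrite (@le_trans _ _ (\sum_(b < m) rho * A)) //.
  apply: ler_sum => b _; rewrite nrM ler_pM //.
  by rewrite (le_trans (nr_coord _ _ _)) // ltW.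
by rewrite sumr_const card_ord /N -mulrA mulr_natl.
Qed.

Lemma picard_good phi : good phi -> good (ray_int (Psi phi)).
Proof.
move=> gphi; have PB := Psi_holo gphi.
have PL y : B y -> nr (Psi phi y) <= L by exact: Psi_le.
split=> [y By|y By]; first exact: (proj1 (ray_int_diff PB PL By)).
apply: le_trans c2; have -> : 2 * (N * rho * L) = 2 * (N * rho * L) * (1 - 0) by ring.
apply: cint_bound => //; first exact: (ccont_ray_form PB By).
move=> t t01; apply: ray_sum_le => // b.
by rewrite (le_trans (nr_coord _ _ _)) //; apply/PL/ball0_scale.
Qed.

Lemma picard_contract phi psi (A : R) : good phi -> good psi ->
  (forall y, B y -> nr (phi y - psi y) <= A) ->
  forall y, B y -> nr (ray_int (Psi phi) y - ray_int (Psi psi) y) <= A / 2.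
Proof.
move=> gphi gpsi phA y By.
have A0 : 0 <= A by apply: le_trans (phA y By).
have Pc := ccont_ray_form (Psi_holo gphi) By.
have Qc := ccont_ray_form (Psi_holo gpsi) By.
rewrite /ray_int -cintB //.
apply: (@le_trans _ _ (2 * (N * rho * (2 * L * (A * nr e))) * (1 - 0))); last first.
  have -> : 2 * (N * rho * (2 * L * (A * nr e))) * (1 - 0) =
    A * (2 * (N * rho * (2 * L * nr e))) by ring.
  by have := ler_wpM2l A0 c3; rewrite mul1r.
apply: cint_bound => //; first exact: ccontB.
move=> t t01; have Bt := ball0_scale By t01.
rewrite /ray_form -sumrB.
under eq_bigr do rewrite -mulrBr.
apply: (ray_sum_le By) => b.
have -> : Psi phi ((t%:C%C : C) *: y) 0 b - Psi psi ((t%:C%C : C) *: y) 0 b =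
  (Psi phi ((t%:C%C : C) *: y) - Psi psi ((t%:C%C : C) *: y)) 0 b by rewrite !mxE.
rewrite (le_trans (nr_coord _ _ _)) //.
have := holo_lipschitz L_gt0 h_holo hL (pt_ball gphi Bt) (pt_ball gpsi Bt).
move=> /le_trans; apply; rewrite ler_wpM2l ?mulr_ge0 ?(ltW L_gt0) //.
have -> : pt phi ((t%:C%C : C) *: y) - pt psi ((t%:C%C : C) *: y) =
  (phi ((t%:C%C : C) *: y) - psi ((t%:C%C : C) *: y)) *: e.
  by rewrite /pt opprD addrACA subrr add0r scalerBl.
by rewrite nrZ ler_wpM2r // phA.
Qed.

Lemma picard_fixpoint : exists phi, good phi /\ forall y, B y -> phi y = ray_int (Psi phi) y.
Proof.
have delta0 : 0 <= delta.
  by apply: le_trans c2; rewrite !mulr_ge0 ?(ltW rho_gt0) ?(ltW L_gt0) // ler0n.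
pose f := fix f k := if k is k'.+1 then ray_int (Psi (f k')) else (fun=> 0 : C).
have fg k : good (f k).
  elim: k => [|k IH]; last exact: picard_good.
  by split=> [y By|y By]; [exact: differentiable_cst|rewrite nr0].
have fgeo k y : B y -> nr (f k.+1 y - f k y) <= delta / 2 ^+ k.
  elim: k y => [|k IH] y By.
    by rewrite expr0 divr1 subr0; exact: (proj2 (fg 1%N) y By).
  have -> : delta / 2 ^+ k.+1 = delta / 2 ^+ k / 2.
    by rewrite exprS; field; rewrite expf_neq0.
  exact: (picard_contract (fg k.+1) (fg k) IH By).
(* The limit is made a total function, with value 0 outside the ball. *)
have exl y : exists l : C, B y -> forall k, nr (l - f k y) <= 4 * delta / 2 ^+ k.
  have [By|nBy] := pselect (B y); last by exists 0.
  by have [l lP] := complete_geoC (fun k => fgeo k y By); exists l.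
have [phi phP] := choice exl.
have phig : good phi.
  split; last first.
    move=> y By; apply: (@le_geo _ _ _ (4 * delta)) => k.
    rewrite -[phi y](subrK (f k y)) (le_trans (nrD _ _)) // addrC lerD ?phP //.
    exact: (proj2 (fg k)).
  apply: (@holo_limitC _ _ B f phi delta (4 * delta) delta) => //.
  - by move=> k; exact: (proj1 (fg k)).
  - by move=> k; exact: (proj2 (fg k)).
  - by move=> k y By; exact: phP.
exists phi; split; first exact: phig.
move=> y By; apply: (@eq_geo _ _ _ _ (4 * delta + 4 * delta)) => k.
have H := picard_contract (fg k) phig (A := 4 * delta / 2 ^+ k).
have H1 : nr (ray_int (Psi (f k)) y - ray_int (Psi phi) y) <= 4 * delta / 2 ^+ k / 2.
  by apply: H => // z Bz; rewrite nr_dist phP.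
have H2 := phP y By k.+1; have E : f k.+1 y = ray_int (Psi (f k)) y by [].
have -> : phi y - ray_int (Psi phi) y = (phi y - f k.+1 y) +
  (ray_int (Psi (f k)) y - ray_int (Psi phi) y) by rewrite E addrA subrK.
have D0 : 0 <= 4 * delta / 2 ^+ k by rewrite !mulr_ge0 // invr_ge0 exprn_ge0.
rewrite (le_trans (nrD _ _)) // mulrDl lerD //; last first.
  by apply: le_trans H1 _; lra.
apply: le_trans H2 _; rewrite exprS invfM mulrA -[leRHS]mulr1 mulrAC ler_wpM2l //.
by rewrite invf_le1 ?ler1n.
Qed.

(** The defect [ee] on the smaller ball is bounded by Cauchy's estimate; its integral equation along
    the rays halves any bound on it, so it is zero. The half radius leaves room for that first
    estimate. *)
Lemma fixpoint_solves phi : good phi -> (forall y, B y -> phi y = ray_int (Psi phi) y) ->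
  forall y a, nr y < rho / 2 -> 'd phi y (delta_mx 0 a) = Psi phi y 0 a.
Proof.
move=> gphi phE.
have PB := Psi_holo gphi.
have PL y : B y -> nr (Psi phi y) <= L by exact: Psi_le.
have dphi y : B y -> forall v, 'd phi y v = cint 0 1 (ray_diff (Psi phi) y v).
  move=> By v; have [rd rE] := ray_int_diff PB PL By.
  have [_ E] := diff_eq_on oB By phE rd.
  exact: etrans (E v) (rE v).
pose ee a y : C := 'd phi y (delta_mx 0 a) - Psi phi y 0 a.
pose g1 a y t : C := ray_diff (Psi phi) y (delta_mx 0 a) t.
pose g2 a y t : C := Psi phi ((t%:C%C : C) *: y) 0 a +
  t%:C%C * 'd (Psi phi) ((t%:C%C : C) *: y) y 0 a.
have g1c a y : B y -> ccont 0 1 (g1 a y) by move=> By; exact: (ccont_ray_diff PB (delta_mx 0 a) By).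
have g2c a y : B y -> ccont 0 1 (g2 a y).
  move=> By; apply: ccontD; first exact: (ccont_ray_comp (holo_coord a PB) By).
  apply: ccontM; first exact: ccont_real.
  exact: (ccont_ray_comp (holo_coord a (holo_diff_rV y oB PB)) By).
have eeE a y : B y -> ee a y = cint 0 1 (fun t => g1 a y t - g2 a y t).
  move=> By; rewrite cintB; [|exact: g1c|exact: g2c].
  congr (_ - _); first exact: dphi.
  exact: esym (ray_FTC PB a By).
(* The derivative of Psi along a basis vector splits into a [frame] part and a part proportional to
   the defect; by integrability the frame parts of the two integrands cancel. *)
have gE a y t : B y -> 0 <= t <= 1 -> g1 a y t - g2 a y t =
    \sum_b y 0 b * (t%:C%C * (ee a ((t%:C%C : C) *: y) * 'd h (pt phi ((t%:C%C : C) *: y)) e 0 b -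
                     ee b ((t%:C%C : C) *: y) * 'd h (pt phi ((t%:C%C : C) *: y)) e 0 a)).
  move=> By t01; have Bt := ball0_scale By t01.
  rewrite /g1 /g2 /ray_diff; set z := (t%:C%C : C) *: y in Bt *.
  have [Up _ _] := hL (pt_ball gphi Bt).
  pose D (v : 'rV[C]_m) : 'rV[C]_m := 'd (Psi phi) z v.
  have DE a' : D (delta_mx 0 a') =
      'd h (pt phi z) (frame (pt phi z) a') + ee a' z *: 'd h (pt phi z) e.
    have [_ E] := Psi_diff gphi Bt.
    apply: etrans (E _) _.
    have -> : delta_mx 0 a' *m J + 'd phi z (delta_mx 0 a') *: e =
      ee a' z *: e + frame (pt phi z) a'.
      rewrite /frame /ee -/(Psi phi z) scalerBl addrCA; congr (_ + _).
      by rewrite subrK.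
    by rewrite [RHS]addrC; exact: (linearP ('d h (pt phi z)) (ee a' z) e _).
  have Dlin : D y = \sum_b y 0 b *: D (delta_mx 0 b).
    rewrite {1}[y]row_sum_delta /D linear_sum; apply: eq_bigr => b _.
    exact: linearZ.
  have intg b : 'd h (pt phi z) (frame (pt phi z) a) 0 b =
     'd h (pt phi z) (frame (pt phi z) b) 0 a by exact: h_integrable.
  have -> : 'd (Psi phi) z y 0 a = \sum_b y 0 b * D (delta_mx 0 b) 0 a.
    by rewrite -/(D y) Dlin summxE; apply: eq_bigr => b _; rewrite mxE.
  rewrite -/(D _) big_split /= (bigD1 a) //= mxE !eqxx mul1r big1 ?addr0; last first.
    by move=> b ba; rewrite mxE eqxx (negPf ba) mul0r.
  rewrite opprD addrACA subrr add0r mulr_sumr -sumrB; apply: eq_bigr => b _.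
  rewrite !DE.
  have T (A1 A2 E1 E2 d1 d2 yb tt : C) : A1 = A2 ->
    yb * (tt * (A1 + E1 * d1)) - tt * (yb * (A2 + E2 * d2)) = yb * (tt * (E1 * d1 - E2 * d2)).
    by move=> ->; ring.
  have mE (p q : 'rV[C]_m) (c : C) i : (p + c *: q) 0 i = p 0 i + c * q 0 i by rewrite !mxE.
  by rewrite !mE; exact: T (intg b).
have delta0 : 0 <= delta.
  by apply: le_trans c2; rewrite !mulr_ge0 ?(ltW rho_gt0) ?(ltW L_gt0) // ler0n.
have rho0 := rho_gt0; have rho2 : rho / 2 < rho by lra.
(* Cauchy's estimate for ['d phi] on balls of radius rho / 4, plus the bound of Psi. *)
pose K0 := 2 * delta / (rho / 4) + L.
have ee0 a y : nr y < rho / 2 -> nr (ee a y) <= K0.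
  move=> yr; have By : B y by exact: lt_trans yr rho2.
  rewrite /ee (le_trans (nrB _ _)) // lerD //; last first.
    by rewrite (le_trans (nr_coord _ _ _)) // PL.
  have s0 : 0 < rho / 4 by rewrite divr_gt0.
  have hl : holo_le phi y (rho / 4) delta.
    move=> z zy; have Bz : B z.
      by rewrite /B /= -[z](subrK y) (le_lt_trans (nrD _ _)) //; lra.
    by split; [exact: (proj1 gphi)|exact: (proj2 gphi)].
  apply: le_trans (cauchy_est (delta_mx 0 a) s0 hl) _.
  rewrite ler_piMr // ?mulr_ge0 ?invr_ge0 ?(ltW s0) //.
  apply: nr_mx_le => // i j; rewrite mxE.
  by case: (_ && _); rewrite ?nr1 ?nr0 ?ler01.
have eek k a y : nr y < rho / 2 -> nr (ee a y) <= K0 / 2 ^+ k.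
  elim: k a y => [|k IH] a y yr; first by rewrite expr0 divr1; exact: ee0.
  have By : B y by exact: lt_trans yr rho2.
  set K := K0 / 2 ^+ k in IH; have K_ge0 : 0 <= K by apply: le_trans (IH a y yr).
  have -> : K0 / 2 ^+ k.+1 = K * (1 / 2).
    by rewrite /K exprS; field; rewrite expf_neq0.
  rewrite eeE //; apply: (@le_trans _ _ (2 * (N * rho * (2 * K * (L * nr e))) * (1 - 0))).
    apply: cint_bound => //; first by apply: ccontB; [exact: g1c|exact: g2c].
    move=> t t01; rewrite gE //; apply: ray_sum_le => // b.
    have Bt := ball0_scale By t01; have tr : nr ((t%:C%C : C) *: y) < rho / 2.
      by rewrite (le_lt_trans (nr_scale_le y t01)).
    have [_ _ he] := hL (pt_ball gphi Bt).
    have hei i : nr ('d h (pt phi ((t%:C%C : C) *: y)) e 0 i) <= L * nr e.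
      exact: le_trans (nr_coord _ _ _) (he e).
    have Le : 0 <= L * nr e by rewrite mulr_ge0 // ltW.
    move: t01 => /andP[t0 t1].
    rewrite nrM nr_real ger0_norm // (@le_trans _ _ (1 * (2 * K * (L * nr e)))) ?mul1r //.
    rewrite -[leRHS]mul1r ler_pM //.
    rewrite (le_trans (nrB _ _)) // !nrM -mulrA mulr_natl mulr2n lerD // ler_pM //.
      exact: IH.
    exact: IH.
  have -> : 2 * (N * rho * (2 * K * (L * nr e))) * (1 - 0) =
    K * (2 * (N * rho * (2 * L * nr e))) by ring.
  by rewrite ler_wpM2l.
move=> y a yr; apply/eqP; rewrite -subr_eq0 -/(ee a y) -nr_eq0 eq_le nr_ge0 andbT.
by apply: (@le_geo _ _ _ K0) => k; rewrite add0r; exact: eek.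
Qed.

End Estimates.

(* Picard iteration along the rays from the origin gives phi with the right
   radial derivative; by integrability the defect d phi - h satisfies a linear
   integral equation on the rays, hence vanishes. *)
Lemma frobenius : exists (rho : R) (phi : 'rV[C]_m -> C),
  [/\ 0 < rho, phi 0 = 0, forall y, nr y < rho -> U (pt phi y) &
   forall y, nr y < rho ->
     diff_at phi y (fun v => \sum_b v 0 b * h (pt phi y) 0 b)].
Proof.
have [r [L [r0 L0 hL]]] := holo_bound oU h_holo Ux0.
have [KJ KJ0 JK] := linear_rV_bounded (mulmxr J).
set E := nr e + 1; have E0 : 0 < E by rewrite ltr_wpDl.
set N1 : R := m%:R + 1; have N0 : 0 < N1 by rewrite ltr_wpDl // ler0n.
have Nm : (m%:R : R) <= N1 by rewrite lerDl.
have eE : nr e <= E by rewrite lerDl.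
(* Each of the two terms of [c1] receives half of r. *)
pose delta := r / 2 / E; have d0 : 0 < delta by rewrite !divr_gt0.
(* The three entries of the minimum secure [c1], [c2] and [c3] in this order; the increments by 1 in
   [E] and [N1] avoid division by zero. *)
pose rho := Num.min (r / 2 / KJ) (Num.min (delta / (2 * (N1 * L))) (1 / (8 * (N1 * (L * E))))).
have rho0 : 0 < rho by rewrite !lt_min !divr_gt0 // !mulr_gt0.
have rho1 : rho <= r / 2 / KJ by rewrite ge_min lexx.
have rho2 : rho <= delta / (2 * (N1 * L)) by rewrite !ge_min lexx !orbT.
have rho3 : rho <= 1 / (8 * (N1 * (L * E))) by rewrite !ge_min lexx !orbT.
have c1 : KJ * rho + delta * nr e <= r.
  have h1 : KJ * rho <= r / 2 by rewrite mulrC -ler_pdivlMr.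
  have h2 : delta * nr e <= r / 2.
    rewrite (@le_trans _ _ (delta * E)) ?ler_wpM2l ?(ltW d0) //.
    by rewrite /delta divfK // gt_eqF.
  lra.
have c2 : 2 * (m%:R * rho * L) <= delta.
  have h1 : rho * (2 * (N1 * L)) <= delta by rewrite -ler_pdivlMr // !mulr_gt0.
  apply: le_trans h1; have -> : 2 * (m%:R * rho * L) = (m%:R : R) * (2 * rho * L) by ring.
  have -> : rho * (2 * (N1 * L)) = N1 * (2 * rho * L) by ring.
  by rewrite ler_wpM2r // !mulr_ge0 // ltW.
have c3 : 2 * (m%:R * rho * (2 * L * nr e)) <= 1 / 2.
  have h1 : rho * (8 * (N1 * (L * E))) <= 1 by rewrite -ler_pdivlMr // !mulr_gt0.
  have h2 : 2 * (m%:R * rho * (2 * L * nr e)) * 2 <= rho * (8 * (N1 * (L * E))).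
    have -> : 2 * (m%:R * rho * (2 * L * nr e)) * 2 = (8 * rho * L) * (m%:R * nr e) by ring.
    have -> : rho * (8 * (N1 * (L * E))) = (8 * rho * L) * (N1 * E) by ring.
    rewrite ler_wpM2l //; first by rewrite !mulr_ge0 // ltW.
    by rewrite ler_pM // ler0n.
  by rewrite ler_pdivlMr // (le_trans h2).
have [phi [gphi phE]] := picard_fixpoint L0 rho0 hL JK (ltW KJ0) c1 c2 c3.
have sol := fixpoint_solves L0 rho0 hL JK (ltW KJ0) c1 c2 c3 gphi phE.
have Bof y : nr y < rho / 2 -> [set y : 'rV[C]_m | nr y < rho] y.
  by move=> yr; apply: lt_trans yr _; lra.
exists (rho / 2), phi; split.
- by rewrite divr_gt0.
- rewrite phE /= ?nr0 // /ray_int (@cint_eq _ 0 1 _ (fun=> 0)) ?cint_cst ?mul0r //.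
  by move=> t _; rewrite /ray_form big1 // => b _; rewrite mxE mul0r.
- move=> y /Bof By.
  by have [] := hL _ (pt_ball JK (ltW KJ0) c1 gphi By).
move=> y yr; have pd := proj1 gphi _ (Bof _ yr).
split; first exact: pd.
move=> v; have T (s : 'rV[C]_m) : 'd phi y s = \sum_b s 0 b * 'd phi y (delta_mx 0 b).
  rewrite {1}[s]row_sum_delta linear_sum; apply: eq_bigr => b _; exact: linearZ.
apply: etrans (T v) _; apply: eq_bigr => b _; congr (_ * _); exact: sol.
Qed.

End Frobenius.

(** * Parametrizations and charts *)

Section Parametrizations.
Variable R : realType.
Local Notation C := (Cplx R).

Lemma left_inverse_diff n m (D : set 'rV[C]_n) (f : 'rV[C]_n -> 'rV[C]_m)
    (g : 'rV[C]_m -> 'rV[C]_n) t v : open D -> D t -> (forall s, D s -> g (f s) = s) ->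
  differentiable f t -> differentiable g (f t) -> 'd g (f t) ('d f t v) = v.
Proof.
move=> oD Dt gf fd gd; have H := diff_at_comp (diff_at_d fd) (diff_at_d gd).
have [id_d idE] := diff_at_id t.
have H2 : diff_at (fun s => g (f s)) t ('d (id : 'rV[C]_n -> 'rV[C]_n) t).
  exact: diff_eq_on oD Dt gf id_d.
exact: etrans (diff_at_unique H H2 v) (idE v).
Qed.

Lemma left_inverse_inj n m (D : set 'rV[C]_n) (f : 'rV[C]_n -> 'rV[C]_m)
    (g : 'rV[C]_m -> 'rV[C]_n) t v : open D -> D t -> (forall s, D s -> g (f s) = s) ->
  differentiable f t -> differentiable g (f t) -> 'd f t v = 0 -> v = 0.
Proof.
move=> oD Dt gf fd gd v0; have H := left_inverse_diff v oD Dt gf fd gd.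
exact: etrans (esym H) (etrans (congr1 ('d g (f t)) v0) (linear0 _)).
Qed.

Lemma open_preimage_holo n m (D : set 'rV[C]_n) (f : 'rV[C]_n -> 'rV[C]_m) (V : set 'rV[C]_m) :
  open D -> holo D f -> open V -> open (D `&` f @^-1` V).
Proof.
move=> oD fD oV; rewrite openE => x [Dx Vx]; apply: filterI.
  exact: open_nbhs_nbhs.
have fx : {for x, continuous f} by exact: differentiable_continuous (fD x Dx).
by apply: fx; exact: open_nbhs_nbhs.
Qed.

Lemma holo_sub (V W : normedModType C) (D E : set V) (f : V -> W) :
  E `<=` D -> holo D f -> holo E f.
Proof. by move=> ED fD x /ED; exact: fD. Qed.

Lemma inj_linear_le n m (L : 'rV[C]_n -> 'rV[C]_m) : linear L ->
  (forall v, L v = 0 -> v = 0) -> (n <= m)%N.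
Proof.
move=> lin inj; pose LM := GRing.isLinear.Build _ _ _ _ _ lin.
pose LL : {linear 'rV[C]_n -> 'rV[C]_m} := HB.pack L LM.
have : row_free (lin1_mx LL).
  by apply: inj_row_free => v; rewrite mul_rV_lin1; exact: inj.
by move=> /eqP <-; exact: rank_leq_col.
Qed.

Lemma inj_linear_bij n (L : 'rV[C]_n -> 'rV[C]_n) : linear L ->
  (forall v, L v = 0 -> v = 0) -> bijective L.
Proof.
move=> lin inj; pose LM := GRing.isLinear.Build _ _ _ _ _ lin.
pose LL : {linear 'rV[C]_n -> 'rV[C]_n} := HB.pack L LM.
have Au : lin1_mx LL \in unitmx.
  by rewrite -row_free_unit; apply: inj_row_free => v; rewrite mul_rV_lin1; exact: inj.
have LE v : L v = v *m lin1_mx LL by rewrite mul_rV_lin1.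
exists (fun v => v *m invmx (lin1_mx LL)) => v; rewrite ?LE.
  by rewrite -mulmxA mulmxV // mulmx1.
by rewrite -mulmxA mulVmx // mulmx1.
Qed.

Section LocalParam.
Variables (N k : nat) (A : set 'rV[C]_N) (D : set 'rV[C]_k).
Variables (psi : 'rV[C]_k -> 'rV[C]_N) (B : set 'rV[C]_N) (chi : 'rV[C]_N -> 'rV[C]_k).
Hypothesis lp : local_param A D psi B chi.

Lemma local_param_mem s : D s -> A (psi s) /\ B (psi s).
Proof.
case: lp => _ _ _ E _ Ds; have : (psi @` D) (psi s) by exists s.
by rewrite E.
Qed.

Lemma local_param_surj z : A z -> B z -> D (chi z) /\ psi (chi z) = z.
Proof.
case: lp => _ _ _ E K Az Bz; have : (A `&` B) z by [].
by rewrite -E => -[s Ds <-]; rewrite K.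
Qed.

Lemma local_param_diff_inj t v : D t -> 'd psi t v = 0 -> v = 0.
Proof.
case: lp => [[oD oB] pD cB _ K] Dt; have [_ Bt] := local_param_mem Dt.
exact: left_inverse_inj oD Dt K (pD t Dt) (cB _ Bt).
Qed.

Lemma local_param_restrict (E : set 'rV[C]_k) : open E ->
  local_param A (D `&` E) psi (B `&` chi @^-1` E) chi.
Proof.
case: lp => [[oD oB] pD cB im K] oE; split.
- by split; [exact: openI|exact: open_preimage_holo].
- by apply: holo_sub pD => x [].
- by apply: holo_sub cB => x [].
- apply/seteqP; split=> [_ [s [Ds Es] <-]|z [Az [Bz Ez]]].
    have [As Bs] := local_param_mem Ds; split=> //; split=> //=.
    by rewrite K.
  have [Dc cE] := local_param_surj Az Bz.
  by exists (chi z).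
- by move=> t [/K].
Qed.

(** Being a parametrization is local: it allows passing from W to its critical set, or from a
    component to W, wherever they agree. *)
Lemma local_param_change (A' V : set 'rV[C]_N) : open V ->
  (forall z, V z -> (A z <-> A' z)) ->
  local_param A' (D `&` psi @^-1` V) psi (B `&` V) chi.
Proof.
case: lp => [[oD oB] pD cB im K] oV AA'; split.
- by split; [exact: open_preimage_holo|exact: openI].
- by apply: holo_sub pD => x [].
- by apply: holo_sub cB => x [].
- apply/seteqP; split=> [_ [s [Ds Vs] <-]|z [Az [Bz Vz]]].
    have [As Bs] := local_param_mem Ds; split=> //.
    exact: (AA' _ Vs).1.
  have [Dc cE] := local_param_surj ((AA' _ Vz).2 Az) Bz.
  by exists (chi z) => //; split=> //=; rewrite cE.
- by move=> t [/K].
Qed.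

End LocalParam.

(** * Transition maps and independence of the parametrization *)

Section Atlas.
Variables (X : topologicalType) (N : nat) (I : Type) (par : I -> 'rV[C]_N -> X).

(** The inverse charts are defined everywhere, so [atlas_dom i i'] is the set of coordinates of
    points lying in both charts; [atlas_eq] yields at once membership in it, the value of the
    transition map and the injectivity of the charts. *)
Record atlas := Atlas {
  atlas_open : forall V : set X, open V <-> chart_open par V;
  atlas_dom : I -> I -> set 'rV[C]_N;
  atlas_tau : I -> I -> 'rV[C]_N -> 'rV[C]_N;
  atlas_dom_open : forall i i', open (atlas_dom i i');
  atlas_holo : forall i i', holo (atlas_dom i i') (atlas_tau i i');
  atlas_tauE : forall i i' z, atlas_dom i i' z -> par i' (atlas_tau i i' z) = par i z;
  atlas_eq : forall i i' z z', par i z = par i' z' ->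
    atlas_dom i i' z /\ atlas_tau i i' z = z' }.

Variable at_ : atlas.
Local Notation dom := (atlas_dom at_).
Local Notation tau := (atlas_tau at_).

Lemma atlas_inj i : injective (par i).
Proof.
move=> z z' e; have [_ <-] := atlas_eq at_ e.
by have [_ ->] := atlas_eq at_ (erefl (par i z)).
Qed.

Lemma atlas_preimage_open i (V : set X) : open V -> open (par i @^-1` V).
Proof. by move=> /(atlas_open at_); exact. Qed.

Lemma atlas_image_open i (B : set 'rV[C]_N) : open B -> open (par i @` B).
Proof.
move=> oB; apply/(atlas_open at_) => i'.
have -> : par i' @^-1` (par i @` B) = dom i' i `&` tau i' i @^-1` B.
  apply/seteqP; split=> [z [y By /esym/(atlas_eq at_)[dz tz]]|z [dz Bz]].
    by split=> //=; rewrite tz.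
  by exists (tau i' i z) => //; exact: atlas_tauE.
apply: open_preimage_holo => //; first exact: atlas_dom_open.
exact: atlas_holo.
Qed.

Lemma atlas_tau_inj i i' z v : dom i i' z -> 'd (tau i i') z v = 0 -> v = 0.
Proof.
move=> dz; have K s : dom i i' s -> dom i' i (tau i i' s) /\ tau i' i (tau i i' s) = s.
  by move=> /(atlas_tauE)/(atlas_eq at_).
exact: left_inverse_inj (@atlas_dom_open at_ i i') dz (fun s ds => proj2 (K s ds))
  (@atlas_holo at_ i i' z dz) (@atlas_holo at_ i' i _ (proj1 (K z dz))).
Qed.

(** L is the differential of the reparametrization chi' \o tau \o psi. Dimension and etaleness
    become intrinsic through its injectivity. *)
Lemma change_param (A : set X) w k l i i' D psi t D' psi' t' :
  @param_at R X N I par A w k i D psi t -> @param_at R X N I par A w l i' D' psi' t' ->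
  dom i i' (psi t) /\ exists L : 'rV[C]_k -> 'rV[C]_l,
    [/\ linear L, forall v, L v = 0 -> v = 0, tau i i' (psi t) = psi' t' &
        forall v, 'd (tau i i') (psi t) ('d psi t v) = 'd psi' t' (L v)].
Proof.
move=> [[B [chi lp]] Dt wt] [[B' [chi' lp']] Dt' wt'].
have [dt tt'] := atlas_eq at_ (etrans wt (esym wt')).
split=> //.
have [[oD oB] pD cB im K] := lp; have [[oD' oB'] pD' cB' im' K'] := lp'.
pose q s := tau i i' (psi s); pose theta s := chi' (q s).
pose E1 := D `&` psi @^-1` dom i i'.
have oE1 : open E1 by apply: open_preimage_holo => //; exact: atlas_dom_open.
have qd s : E1 s -> differentiable q s.
  move=> [Ds ds]; exact: (proj1 (diff_at_comp (diff_at_d (pD s Ds)) (diff_at_d (@atlas_holo at_ i i' _ ds)))).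
pose E := E1 `&` q @^-1` B'.
have oE : open E by exact: open_preimage_holo.
have [_ Bt'] := local_param_mem lp' Dt'.
have Et : E t by split=> //=; rewrite /q tt'.
have EP s : E s -> psi' (theta s) = q s.
  move=> [[Ds ds] B's]; have [As _] := local_param_mem lp Ds.
  have Aq : (par i' @^-1` A) (q s) by rewrite /= /q atlas_tauE.
  by have [_ ->] := local_param_surj lp' Aq B's.
have tht : theta t = t' by rewrite /theta /q tt' K'.
have qt : diff_at q t (fun v => 'd (tau i i') (psi t) ('d psi t v)).
  exact: diff_at_comp (diff_at_d (pD t Dt)) (diff_at_d (@atlas_holo at_ i i' _ dt)).
have cq : differentiable chi' (q t) by apply: cB'; rewrite /q tt'.
have th := diff_at_comp qt (diff_at_d cq).
have p't : diff_at psi' (theta t) ('d psi' t') by rewrite tht; exact: diff_at_d (pD' _ Dt').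
have pth := diff_at_comp th p't.
have [Ed EE] := diff_eq_on oE Et EP (proj1 qt).
have key v : 'd (tau i i') (psi t) ('d psi t v) =
    'd psi' t' ('d chi' (q t) ('d (tau i i') (psi t) ('d psi t v))).
  have H := diff_at_unique pth (conj Ed EE) v.
  exact: esym (etrans H (proj2 qt v)).
exists (fun v => 'd chi' (q t) ('d (tau i i') (psi t) ('d psi t v))); split=> //.
- move=> a u v; pose f1 := 'd psi t; pose f2 := 'd (tau i i') (psi t); pose f3 := 'd chi' (q t).
  exact: etrans (congr1 (fun x => f3 (f2 x)) (linearP f1 a u v))
    (etrans (congr1 f3 (linearP f2 a (f1 u) (f1 v))) (linearP f3 a (f2 (f1 u)) (f2 (f1 v)))).
- move=> v v0; apply: (local_param_diff_inj lp Dt).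
  apply: (atlas_tau_inj dt); apply: etrans (key v) _.
  exact: etrans (congr1 ('d psi' t') v0) (linear0 _).
Qed.

Lemma regular_dim_le (A : set X) w k l :
  @regular_at R X N I par A w k -> @regular_at R X N I par A w l -> (k <= l)%N.
Proof.
move=> [i [D [psi [t p]]]] [i' [D' [psi' [t' p']]]].
have [_ [L [lin inj _ _]]] := change_param p p'.
exact: inj_linear_le lin inj.
Qed.

End Atlas.
End Parametrizations.

Local Notation eta := Defs.eta.

(** * The atlases of projective space and of the contact elements *)

Section Charts.
Variables (R : realType) (n : nat).
Local Notation C := (Cplx R).
Implicit Types (X A : 'rV[C]_n.+1) (i : 'I_n.+1) (j : 'I_n) (x : 'rV[C]_n) (p : 'rV[C]_n.-1).

Lemma vline_eqP (u v : 'rV[C]_n.+1) : u != 0 ->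
  <[u]>%VS = <[v]>%VS <-> exists2 c, c != 0 & u = c *: v.
Proof.
move=> u0; split=> [e|[c c0 uE]].
  have /vlineP[c uE] : u \in <[v]>%VS by rewrite -e memv_line.
  exists c => //; apply: contraNneq u0 => c0.
  by rewrite uE c0 scale0r.
apply/eqP; rewrite eqEsubv -!memvE uE memvZ ?memv_line //=.
have {1}-> : v = c^-1 *: (c *: v) by rewrite scalerA mulVf // scale1r.
by rewrite memvZ // memv_line.
Qed.

Lemma projspace_eq (l l' : projspace R n) : line l = line l' -> l = l'.
Proof.
case: l l' => [l dl] [l' dl'] /= e; rewrite e in dl *.
by congr Projspace; exact: Prop_irrelevance.
Qed.

Lemma contact_eq (w w' : contact R n) : base w = base w' -> dir w = dir w' -> w = w'.
Proof.
case: w w' => [b d H] [b' d' H'] /= eb ed; rewrite eb ed in H *.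
by congr Contact; exact: Prop_irrelevance.
Qed.

Lemma projspace_rep (l : projspace R n) : exists2 X, X != 0 & line l = <[X]>%VS.
Proof.
exists (vpick (line l)); first by rewrite vpick0 -dimv_eq0 line_dim.
apply/esym/eqP; rewrite eqEdim -memvE memv_pick line_dim dim_vline.
by rewrite vpick0 -dimv_eq0 line_dim.
Qed.

Lemma aff_row_i i x : aff_row i x 0 i = 1.
Proof. by rewrite mxE unlift_none. Qed.

Lemma aff_row_lift i x l : aff_row i x 0 (lift i l) = x 0 l.
Proof. by rewrite mxE liftK. Qed.

Lemma aff_row_neq0 i x : aff_row i x != 0.
Proof.
by apply/eqP => /rowP/(_ i); rewrite aff_row_i mxE => /eqP; rewrite oner_eq0.
Qed.

Definition xco i (X : 'rV[C]_n.+1) : 'rV[C]_n := \row_l (X 0 (lift i l) / X 0 i).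

Lemma aff_row_xco i X : X 0 i != 0 -> aff_row i (xco i X) = (X 0 i)^-1 *: X.
Proof.
move=> Xi; apply/rowP => k; case: (unliftP i k) => [l ->|->].
  by rewrite aff_row_lift !mxE mulrC.
by rewrite aff_row_i mxE mulVf.
Qed.

Lemma xcoZ i (c : C) X : c != 0 -> xco i (c *: X) = xco i X.
Proof.
move=> c0; apply/rowP => l; rewrite !mxE invfM mulrACA divff // mul1r //.
Qed.

Lemma xco_aff_row i x : xco i (aff_row i x) = x.
Proof. by apply/rowP => l; rewrite mxE aff_row_i aff_row_lift divr1. Qed.

Lemma aff_eqP i i' x x' : aff i x = aff i' x' <->
  exists2 c, c != 0 & aff_row i x = c *: aff_row i' x'.
Proof.
split=> [e|H].
  apply/(vline_eqP _ (aff_row_neq0 i x)); exact: (congr1 (@line R n) e).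
by apply: projspace_eq; apply/(vline_eqP _ (aff_row_neq0 i x)).
Qed.

Lemma aff_cover (m : projspace R n) : exists i x, m = aff i x.
Proof.
have [X X0 Xm] := projspace_rep m.
have [i Xi] : exists i, X 0 i != 0.
  apply/existsP; apply: contraNT X0; rewrite negb_exists => /forallP H.
  by apply/eqP/rowP => i; rewrite mxE; apply/eqP; have := H i; rewrite negbK.
exists i, (xco i X); apply: projspace_eq; rewrite Xm /= aff_row_xco //.
by apply/vline_eqP => //; exists (X 0 i); rewrite // scalerA mulfV // scale1r.
Qed.

Lemma differentiable_aff_row i k x :
  differentiable (fun x => aff_row i x 0 k : C) x.
Proof.
case: (unliftP i k) => [l ->|->].
  have -> : (fun x => aff_row i x 0 (lift i l)) = (fun x => x 0 l : C).
    by apply/funext => y; rewrite aff_row_lift.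
  exact: differentiable_coord.
have -> : (fun x => aff_row i x 0 i) = fun=> 1 by apply/funext => y; rewrite aff_row_i.
exact: differentiable_cst.
Qed.

Lemma open_neq0 N (f : 'rV[C]_N -> C) : (forall z, differentiable f z) ->
  open [set z | f z != 0].
Proof.
move=> fd; have -> : [set z | f z != 0] = setT `&` f @^-1` [set c | c != 0].
  by apply/seteqP; split=> z /=; [split|case].
rewrite setTI; apply: open_comp => [z _|]; first exact: differentiable_continuous (fd z).
rewrite openE => c /= c0; apply/nbhs_nrP; exists (nr c); first by rewrite nr_gt0.
move=> d; apply: contraTneq => ->; rewrite sub0r nrN -leNgt //.
Qed.

Lemma differentiable_div N (f g : 'rV[C]_N -> C) z :
  differentiable f z -> differentiable g z -> g z != 0 ->
  differentiable (fun z => f z / g z : C) z.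
Proof.
move=> fd gd g0; have gi := diff_invE gd g0.
exact: (proj1 (diff_mulE fd gi)).
Qed.

Definition aff_dom i i' : set 'rV[C]_n := [set x | aff_row i x 0 i' != 0].
Definition aff_tau i i' x : 'rV[C]_n := xco i' (aff_row i x).

Lemma aff_tau_holo i i' : holo (aff_dom i i') (aff_tau i i').
Proof.
move=> x dx; apply/differentiable_rVP => l.
have -> : (fun y => aff_tau i i' y 0 l) =
    fun y => aff_row i y 0 (lift i' l) / aff_row i y 0 i' : C.
  by apply/funext => y; rewrite mxE.
by apply: differentiable_div => //; exact: differentiable_aff_row.
Qed.

Lemma aff_tauE i i' x : aff_dom i i' x -> aff i' (aff_tau i i' x) = aff i x.
Proof.
move=> dx; apply/aff_eqP; exists (aff_row i x 0 i')^-1; first by rewrite invr_eq0.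
exact: aff_row_xco.
Qed.

Lemma aff_tau_eq i i' x x' : aff i x = aff i' x' ->
  aff_dom i i' x /\ aff_tau i i' x = x'.
Proof.
move=> /aff_eqP[c c0 e]; rewrite /aff_dom /aff_tau /= e; split.
  by rewrite mxE aff_row_i mulr1.
by rewrite xcoZ // xco_aff_row.
Qed.

Lemma projspace_openE (V : set (projspace R n)) : open V <-> chart_open aff V.
Proof. by []. Qed.

Definition aff_atlas : atlas (@aff R n) := Atlas projspace_openE
  (fun i i' => @open_neq0 n _ (differentiable_aff_row i i')) aff_tau_holo aff_tauE aff_tau_eq.

Lemma eta_delta_j j p : eta j p (delta_mx 0 j) = 1.
Proof.
rewrite /eta !mxE !eqxx big1 ?subr0 // => a _.
by rewrite !mxE eq_sym (negPf (neq_lift j a)) mulr0.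
Qed.

Lemma eta_delta_lift j p a : eta j p (delta_mx 0 (lift j a)) = - p 0 a.
Proof.
rewrite /eta !mxE eqxx (negPf (neq_lift j a)) sub0r (bigD1 a) //= mxE !eqxx.
rewrite mulr1 big1 ?addr0 // => b ba.
by rewrite mxE eqxx (inj_eq lift_inj) (negPf ba) mulr0.
Qed.

Lemma con_row_j i j x p : con_row i j x p 0 (lift i j) = 1.
Proof. by rewrite mxE liftK eta_delta_j. Qed.

Lemma con_row_lift i j x p a : con_row i j x p 0 (lift i (lift j a)) = - p 0 a.
Proof. by rewrite mxE liftK eta_delta_lift. Qed.

Lemma con_row_neq0 i j x p : con_row i j x p != 0.
Proof.
by apply/eqP => /rowP/(_ (lift i j)); rewrite con_row_j mxE => /eqP; rewrite oner_eq0.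
Qed.

Lemma con_row_inc i j x p : \sum_k aff_row i x 0 k * con_row i j x p 0 k = 0.
Proof. by apply: con_inc; exact: memv_line. Qed.

Lemma incident_rep (l h : projspace R n) X A : line l = <[X]>%VS -> line h = <[A]>%VS ->
  \sum_k X 0 k * A 0 k = 0 <-> incident l h.
Proof.
move=> lX hA; split=> [H Y B|]; last by apply; rewrite ?lX ?hA memv_line.
rewrite lX hA => /vlineP[c ->] /vlineP[d ->].
transitivity (c * d * \sum_k X 0 k * A 0 k); last by rewrite H mulr0.
by rewrite mulr_sumr; apply: eq_bigr => k _; rewrite !mxE mulrACA.
Qed.

Lemma con_row_uniq i j x p (A : 'rV[C]_n.+1) :
  \sum_k aff_row i x 0 k * A 0 k = 0 -> A 0 (lift i j) = 1 ->
  (forall a, A 0 (lift i (lift j a)) = - p 0 a) -> A = con_row i j x p.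
Proof.
move=> inc Aj Aa.
have El l : A 0 (lift i l) = con_row i j x p 0 (lift i l).
  case: (unliftP j l) => [a ->|->]; first by rewrite Aa con_row_lift.
  by rewrite Aj con_row_j.
apply/rowP => k; case: (unliftP i k) => [l ->|->]; first exact: El.
have := con_row_inc i j x p; move: inc; rewrite !(bigD1_ord i) //= aff_row_i !mul1r.
under eq_bigr do rewrite El; move=> /eqP; rewrite addr_eq0 => /eqP ->.
by move=> /eqP; rewrite addr_eq0 => /eqP ->.
Qed.

(** The slopes p of the hyperplane with covector A, once its coefficient at ij.2 is scaled to 1;
    meaningful where that coefficient is nonzero. *)
Definition pco (ij : 'I_n.+1 * 'I_n) (A : 'rV[C]_n.+1) : 'rV[C]_n.-1 :=
  \row_a (- A 0 (lift ij.1 (lift ij.2 a)) / A 0 (lift ij.1 ij.2)).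

Lemma con_row_pco i j x A : \sum_k aff_row i x 0 k * A 0 k = 0 ->
  A 0 (lift i j) != 0 -> con_row i j x (pco (i, j) A) = (A 0 (lift i j))^-1 *: A.
Proof.
move=> inc Aj; apply/esym/con_row_uniq.
- transitivity ((A 0 (lift i j))^-1 * \sum_k aff_row i x 0 k * A 0 k); last by rewrite inc mulr0.
  by rewrite mulr_sumr; apply: eq_bigr => k _; rewrite [X in _ * X]mxE mulrCA.
- by rewrite mxE mulVf.
- by move=> a; rewrite !mxE /= mulNr opprK mulrC.
Qed.

Lemma pcoZ ij (c : C) A : c != 0 -> pco ij (c *: A) = pco ij A.
Proof.
by move=> c0; apply/rowP => l; rewrite !mxE invfM -mulrN mulrACA divff // mul1r.
Qed.

Lemma pco_con_row i j x p : pco (i, j) (con_row i j x p) = p.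
Proof. by apply/rowP => l; rewrite mxE /= con_row_j con_row_lift opprK divr1. Qed.

Local Notation crow ij z := (con_row ij.1 ij.2 (lsubmx z) (rsubmx z)).

Lemma con_eqP ij ij' (z z' : 'rV[C]_(n + n.-1)) : con ij z = con ij' z' <->
  (exists2 c, c != 0 & aff_row ij.1 (lsubmx z) = c *: aff_row ij'.1 (lsubmx z')) /\
  (exists2 d, d != 0 & crow ij z = d *: crow ij' z').
Proof.
split=> [e|[H1 H2]].
  split; first by apply/aff_eqP; exact: (congr1 (@base R n) e).
  apply/vline_eqP; first exact: con_row_neq0.
  exact: (congr1 (fun w => line (dir w)) e).
apply: contact_eq; first exact/aff_eqP.
by apply: projspace_eq; apply/vline_eqP => //; exact: con_row_neq0.
Qed.

Lemma base_con ij z : base (con ij z) = aff ij.1 (lsubmx z) :> projspace R n.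
Proof. by []. Qed.

(** Any affine chart containing the base point will do: a nonzero covector that annihilates the
    point has a nonzero coefficient off i, and this gives j. *)
Lemma con_cover (w : contact R n) i x : base w = aff i x ->
  exists j p, w = con (i, j) (row_mx x p).
Proof.
move=> bw; have [A A0 Aw] := projspace_rep (dir w).
have inc : \sum_k aff_row i x 0 k * A 0 k = 0.
  by apply/(incident_rep (l := aff i x) (h := dir w)) => //; rewrite -bw; exact: contact_inc.
have [j Aj] : exists j, A 0 (lift i j) != 0.
  apply/existsP; apply: contraNT A0; rewrite negb_exists => /forallP H.
  have Al l : A 0 (lift i l) = 0 by apply/eqP; have := H l; rewrite negbK.
  apply/eqP/rowP => k; rewrite mxE; case: (unliftP i k) => [l ->|->]; first exact: Al.
  move: inc; rewrite (bigD1_ord i) //= aff_row_i mul1r big1 ?addr0 // => l _.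
  by rewrite Al mulr0.
exists j, (pco (i, j) A); apply: contact_eq; first by rewrite bw base_con row_mxKl.
apply: projspace_eq; rewrite Aw /= row_mxKl row_mxKr con_row_pco //.
by apply/vline_eqP => //; exists (A 0 (lift i j)); rewrite // scalerA mulfV // scale1r.
Qed.

Lemma eq_differentiable N (f g : 'rV[C]_N -> C) z : f =1 g ->
  differentiable f z -> differentiable g z.
Proof. by move=> /funext ->. Qed.

Lemma differentiable_con_row ij k (z : 'rV[C]_(n + n.-1)) :
  differentiable (fun z => crow ij z 0 k : C) z.
Proof.
have dl l y : differentiable (fun z : 'rV[C]_(n + n.-1) => lsubmx z 0 l : C) y.
  have -> : (fun z : 'rV[C]_(n + n.-1) => lsubmx z 0 l) = (fun z => z 0 (lshift n.-1 l)).
    by apply/funext => u; rewrite mxE.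
  exact: differentiable_coord.
have dr l y : differentiable (fun z : 'rV[C]_(n + n.-1) => rsubmx z 0 l : C) y.
  have -> : (fun z : 'rV[C]_(n + n.-1) => rsubmx z 0 l) = (fun z => z 0 (rshift n l)).
    by apply/funext => u; rewrite mxE.
  exact: differentiable_coord.
have dN (f : 'rV[C]_(n + n.-1) -> C) y : differentiable f y -> differentiable (fun z => - f z) y.
  move=> fd; have -> : (fun z => - f z) = fun z => (0 : C) - f z.
    by apply/funext => u; rewrite sub0r.
  by have := diff_at_sub (diff_at_cst (0 : C) y) (diff_at_d fd) => -[].
have de y : differentiable (fun z : 'rV[C]_(n + n.-1) => eta ij.2 (rsubmx z) (lsubmx z)) y.
  have ds := diff_at_sum (fun a => diff_at_mul (diff_at_d (dr a y)) (diff_at_d (dl (lift ij.2 a) y))).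
  exact: (proj1 (diff_at_sub (diff_at_d (dl ij.2 y)) ds)).
case: (unliftP ij.1 k) => [l ->|->]; last first.
  apply: eq_differentiable (dN _ _ (de z)) => u.
  by rewrite [RHS]mxE unlift_none.
case: (unliftP ij.2 l) => [a ->|->].
  by apply: eq_differentiable (dN _ _ (dr a z)) => u; rewrite con_row_lift.
apply: eq_differentiable (differentiable_cst (1 : C) z) => u.
by rewrite con_row_j.
Qed.

Lemma differentiable_lsub k (f : 'rV[C]_n -> C) (z : 'rV[C]_(n + k)) :
  differentiable f (lsubmx z) -> differentiable (fun z => f (lsubmx z)) z.
Proof.
by move=> fd; have [] := diff_compE (differentiable_lsubmx z) fd.
Qed.

(** A product, so that both conditions amount to one function being nonzero and openness follows
    from [open_neq0]. *)
Definition con_dom ij ij' : set 'rV[C]_(n + n.-1) :=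
  [set z | aff_row ij.1 (lsubmx z) 0 ij'.1 * crow ij z 0 (lift ij'.1 ij'.2) != 0].

Definition con_tau ij ij' (z : 'rV[C]_(n + n.-1)) : 'rV[C]_(n + n.-1) :=
  row_mx (xco ij'.1 (aff_row ij.1 (lsubmx z))) (pco ij' (crow ij z)).

Lemma con_dom_open ij ij' : open (con_dom ij ij').
Proof.
apply: open_neq0 => z.
have H1 : differentiable (fun z : 'rV[C]_(n + n.-1) => aff_row ij.1 (lsubmx z) 0 ij'.1 : C) z.
  exact: (differentiable_lsub (differentiable_aff_row ij.1 ij'.1 (lsubmx z))).
exact: (proj1 (diff_mulE H1 (differentiable_con_row ij _ z))).
Qed.

Lemma con_tau_holo ij ij' : holo (con_dom ij ij') (con_tau ij ij').
Proof.
move=> z; rewrite /con_dom /= mulf_eq0 negb_or => /andP[dx dA].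
apply/differentiable_rVP => k; case: (splitP k) => [l kl|l kl].
  have -> : k = lshift n.-1 l by apply: val_inj.
  have H1 k' : differentiable (fun z : 'rV[C]_(n + n.-1) => aff_row ij.1 (lsubmx z) 0 k' : C) z.
    exact: (differentiable_lsub (differentiable_aff_row ij.1 k' (lsubmx z))).
  apply: eq_differentiable (differentiable_div (H1 (lift ij'.1 l)) (H1 ij'.1) dx) => y.
  by rewrite row_mxEl [RHS]mxE.
have -> : k = rshift n l by apply: val_inj.
have dd := differentiable_div (differentiable_con_row ij (lift ij'.1 (lift ij'.2 l)) z)
  (differentiable_con_row ij (lift ij'.1 ij'.2) z) dA.
have := proj1 (diff_at_sub (diff_at_cst (0 : C) z) (diff_at_d dd)).
by apply: eq_differentiable => y; rewrite row_mxEr [RHS]mxE sub0r mulNr.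
Qed.

Lemma con_tauE ij ij' z : con_dom ij ij' z -> con ij' (con_tau ij ij' z) = con ij z :> contact R n.
Proof.
rewrite /con_dom /= mulf_eq0 negb_or => /andP[dx dA].
apply/con_eqP; rewrite /con_tau row_mxKl row_mxKr aff_row_xco //; split.
  by exists (aff_row ij.1 (lsubmx z) 0 ij'.1)^-1; rewrite ?invr_eq0.
exists (crow ij z 0 (lift ij'.1 ij'.2))^-1; first by rewrite invr_eq0.
rewrite [pco _ _](_ : _ = pco (ij'.1, ij'.2) (crow ij z)); last by case: (ij').
apply: con_row_pco => //; rewrite aff_row_xco //.
transitivity ((aff_row ij.1 (lsubmx z) 0 ij'.1)^-1 *
   \sum_k aff_row ij.1 (lsubmx z) 0 k * crow ij z 0 k); last by rewrite con_row_inc mulr0.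
by rewrite mulr_sumr; apply: eq_bigr => k _; rewrite mxE mulrA.
Qed.

Lemma con_tau_eq ij ij' (z z' : 'rV[C]_(n + n.-1)) : con ij z = con ij' z' ->
  con_dom ij ij' z /\ con_tau ij ij' z = z'.
Proof.
move=> /con_eqP[[c c0 e1] [d d0 e2]]; rewrite /con_dom /con_tau /= e1 e2; split.
  by rewrite !mxE unlift_none liftK eta_delta_j !mulr1 mulf_neq0.
rewrite xcoZ // xco_aff_row pcoZ // -[RHS]hsubmxK; congr row_mx.
by rewrite -{2}(pco_con_row ij'.1 ij'.2 (lsubmx z') (rsubmx z')); case: (ij').
Qed.

Lemma contact_openE (V : set (contact R n)) : open V <-> chart_open con V.
Proof. by []. Qed.

Definition con_atlas : atlas (@con R n) := Atlas contact_openE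
  con_dom_open con_tau_holo con_tauE con_tau_eq.

Lemma base_open (U : set (projspace R n)) : open U -> open (@base R n @^-1` U).
Proof.
move=> oU; apply/(atlas_open con_atlas) => ij.
have -> : con ij @^-1` (@base R n @^-1` U) = lsubmx @^-1` (aff ij.1 @^-1` U) by [].
apply: open_comp; last exact: (atlas_preimage_open aff_atlas).
by move=> z _; exact: continuous_lsubmx.
Qed.

(** Two distinct hyperplanes through a point have covectors with a nonzero 2 x 2 minor. The minor
    stays nonzero for nearby pairs, whereas covectors of a common contact element are
    proportional. *)
Lemma fibre_separated (w w' : contact R n) : w <> w' -> base w = base w' ->
  exists V V', [/\ open V, open V', V w, V' w' & V `&` V' = set0].
Proof.
move=> ww' bb; have [i [x bx]] := aff_cover (base w).
have [j [p wE]] := con_cover bx; have [j' [p' wE']] := con_cover (etrans (esym bb) bx).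
set z := row_mx x p in wE; set z' := row_mx x p' in wE'.
pose F k l (z1 z2 : 'rV[C]_(n + n.-1)) := crow (i, j) z1 0 k * crow (i, j') z2 0 l -
  crow (i, j) z1 0 l * crow (i, j') z2 0 k.
have [k [l Fkl]] : exists k l, F k l z z' != 0.
  apply: contrapT => nF; apply: ww'; rewrite wE wE'; apply/con_eqP.
  have F0 k l : F k l z z' = 0.
    by apply/eqP; apply: contrapT => H; apply: nF; exists k, l; apply/negP.
  split; first by exists 1; rewrite ?oner_eq0 // scale1r /z /z' !row_mxKl.
  set A := crow (i, j) z; set A' := crow (i, j') z'.
  have Aj : A 0 (lift i j) = 1 by rewrite con_row_j.
  have AE l : A' 0 l = A' 0 (lift i j) * A 0 l.
    have := F0 (lift i j) l; rewrite /F -/A -/A' Aj mul1r => /eqP.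
    by rewrite subr_eq0 mulrC => /eqP.
  have d0 : A' 0 (lift i j) != 0.
    apply/eqP => e; have := con_row_neq0 i j' (lsubmx z') (rsubmx z').
    by move=> /eqP; apply; apply/rowP => l; rewrite -/A' AE e mul0r mxE.
  exists (A' 0 (lift i j))^-1; first by rewrite invr_eq0.
  by apply/rowP => l; rewrite [RHS]mxE (AE l) mulrA mulVf // mul1r.
pose G (y : 'rV[C]_((n + n.-1) + (n + n.-1))) : C := F k l (lsubmx y) (rsubmx y).
have dl m y : differentiable (fun y : 'rV[C]_((n + n.-1) + (n + n.-1)) => crow (i, j) (lsubmx y) 0 m : C) y.
  exact: (proj1 (diff_compE (differentiable_lsubmx y) (differentiable_con_row (i, j) m _))).
have dr m y : differentiable (fun y : 'rV[C]_((n + n.-1) + (n + n.-1)) => crow (i, j') (rsubmx y) 0 m : C) y.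
  exact: (proj1 (diff_compE (differentiable_rsubmx y) (differentiable_con_row (i, j') m _))).
have Gd y : differentiable G y.
  have H1 := diff_at_mul (diff_at_d (dl k y)) (diff_at_d (dr l y)).
  have H2 := diff_at_mul (diff_at_d (dl l y)) (diff_at_d (dr k y)).
  exact: (proj1 (diff_at_sub H1 H2)).
have G0 : G (row_mx z z') != 0 by rewrite /G row_mxKl row_mxKr.
have [d d0 dP] := (nbhs_nrP _ _).1 (open_nbhs_nbhs (conj (open_neq0 Gd) G0)).
exists (con (i, j) @` [set y | nr (y - z) < d]), (con (i, j') @` [set y | nr (y - z') < d]).
split.
- by apply: (atlas_image_open con_atlas); exact: nr_open.
- by apply: (atlas_image_open con_atlas); exact: nr_open.
- by exists z => //=; rewrite subrr nr0.
- by exists z' => //=; rewrite subrr nr0.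
apply/seteqP; split=> // _ [[y yz <-] [y' yz' e]].
have : G (row_mx y y') != 0.
  apply: dP; apply: nr_mx_lt => // a b; rewrite ord1 opp_row_mx add_row_mx.
  case: (splitP b) => [c bc|c bc].
    have -> : b = lshift _ c by apply: val_inj.
    by rewrite row_mxEl (le_lt_trans (nr_coord _ _ _)).
  have -> : b = rshift _ c by apply: val_inj.
  by rewrite row_mxEr (le_lt_trans (nr_coord _ _ _)).
rewrite /G row_mxKl row_mxKr /F.
move/con_eqP: e => [_ [c c0 e]].
have {}e k' : crow (i, j') y' 0 k' = c * crow (i, j) y 0 k' by rewrite e [LHS]mxE.
by rewrite !e mulrCA [X in _ - X]mulrCA [X in _ - c * X]mulrC subrr eqxx.
Qed.

End Charts.

(** * Etale points and the density of the complement of the caustic *)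

Section Etale.
Variables (R : realType) (n : nat).
Local Notation C := (Cplx R).
Implicit Types (W : set (contact R n)) (w : contact R n).

Lemma linear_lsubmx k l : linear (@lsubmx C 1 k l).
Proof. by move=> a u v; rewrite linearP. Qed.

Lemma linear_rsubmx k l : linear (@rsubmx C 1 k l).
Proof. by move=> a u v; rewrite linearP. Qed.

Lemma lsub_con_tau_diff ij ij' (z : 'rV[C]_(n + n.-1)) v : con_dom ij ij' z ->
  lsubmx ('d (con_tau ij ij') z v) = 'd (aff_tau ij.1 ij'.1) (lsubmx z) (lsubmx v).
Proof.
move=> dz; have Hl y := diff_at_lin y (@linear_lsubmx n n.-1).
have dx : aff_dom ij.1 ij'.1 (lsubmx z).
  by move: dz; rewrite /con_dom /aff_dom /= mulf_eq0 negb_or => /andP[].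
have H1 := diff_at_comp (diff_at_d (con_tau_holo dz)) (Hl (con_tau ij ij' z)).
have H2 := diff_at_comp (Hl z) (diff_at_d (aff_tau_holo dx)).
have e : (fun y => lsubmx (con_tau ij ij' y)) = fun y : 'rV[C]_(n + n.-1) => aff_tau ij.1 ij'.1 (lsubmx y).
  by apply/funext => y; rewrite /con_tau row_mxKl.
rewrite e in H1.
exact: diff_at_unique H1 H2 v.
Qed.

(** Etaleness, defined with one parametrization, holds for all of them because the base coordinates
    transform among themselves ([lsub_con_tau_diff]). *)
Lemma etale_param W w k ij D psi t : etale_at W w ->
  @param_at R _ _ _ con W w k ij D psi t ->
  k = n /\ forall v, lsubmx ('d psi t v) = 0 -> v = 0.
Proof.
move=> [ij' [D' [psi' [t' [p' bij]]]]] p.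
have [dt [L [Llin Linj tt' LE]]] := change_param (con_atlas R n) p p'.
have [_ [L' [L'lin L'inj _ _]]] := change_param (con_atlas R n) p' p.
have kn : k = n.
  by apply/eqP; rewrite eqn_leq (inj_linear_le Llin Linj) (inj_linear_le L'lin L'inj).
split=> // v v0; apply: Linj; apply: (bij_inj bij).
apply: etrans (congr1 lsubmx (esym (LE v))) _.
apply: etrans (lsub_con_tau_diff _ dt) _.
rewrite v0; apply: etrans (linear0 _) (esym _).
exact: etrans (congr1 lsubmx (linear0 ('d psi' t'))) (linear0 _).
Qed.

Lemma param_etale W w ij D psi t : @param_at R _ _ _ con W w n ij D psi t ->
  (forall v, lsubmx ('d psi t v) = 0 -> v = 0) -> etale_at W w.
Proof.
move=> p inj; exists ij, D, psi, t; split=> //.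
apply: inj_linear_bij inj => a u v; pose f := 'd psi t.
exact: etrans (congr1 lsubmx (linearP f a u v)) (linearP _ a (f u) (f v)).
Qed.

Lemma etale_mem W w : etale_at W w -> W w.
Proof.
move=> [ij [D [psi [t [[[B [chi lp]] Dt <-] _]]]]].
by have [] := local_param_mem lp Dt.
Qed.

(* Where X := lsubmx \o psi is invertible, A is the graph of rsubmx \o psi \o X^-1. *)
Lemma local_graph k (A : set 'rV[C]_(n + k)) (D : set 'rV[C]_n)
    (psi : 'rV[C]_n -> 'rV[C]_(n + k)) B chi t :
  local_param A D psi B chi -> D t -> (forall v, lsubmx ('d psi t v) = 0 -> v = 0) ->
  exists U (g : 'rV[C]_n -> 'rV[C]_k) B', [/\ U (lsubmx (psi t)), B' (psi t), B' `<=` B,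
    holo U g & local_param A U (fun x => row_mx x (g x)) B' lsubmx].
Proof.
move=> lp Dt inj; have [[oD oB] pD cB im K] := lp.
pose X s := lsubmx (psi s).
have Xd s : D s -> diff_at X s (fun v => lsubmx ('d psi s v)).
  move=> Ds; exact: diff_at_comp (diff_at_d (pD s Ds)) (diff_at_lin _ (@linear_lsubmx n k)).
have Xh : holo D X by move=> s /Xd[].
have Xinj v : 'd X t v = 0 -> v = 0.
  by move=> v0; apply: inj; apply: etrans (esym (proj2 (Xd t Dt) v)) v0.
have [E [U [Y [[oE oU Et ED UXt] YU XY YX]]]] := inverse_function oD Xh Dt Xinj.
pose g x : 'rV[C]_k := rsubmx (psi (Y x)).
have gE x : U x -> row_mx x (g x) = psi (Y x).
  by move=> Ux; have [_ {1}<-] := XY x Ux; rewrite hsubmxK.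
have pY x : U x -> differentiable (fun x => psi (Y x)) x.
  move=> Ux; have [EY _] := XY x Ux.
  exact: (proj1 (diff_at_comp (diff_at_d (YU x Ux)) (diff_at_d (pD _ (ED _ EY))))).
have [At Bt] := local_param_mem lp Dt.
have lcont (z : 'rV[C]_(n + k)) : {for z, continuous lsubmx} by exact: continuous_lsubmx.
exists U, g, ((B `&` chi @^-1` E) `&` lsubmx @^-1` U); split.
- exact: UXt.
- by split=> //; split=> //=; rewrite K.
- by move=> z [[]].
- move=> x Ux; exact: (proj1 (diff_at_comp (diff_at_d (pY x Ux)) (diff_at_lin _ (@linear_rsubmx n k)))).
split.
- split=> //; apply: openI; first exact: open_preimage_holo.
  by apply: open_comp => // z _; exact: lcont.
- move=> x Ux; exact: (proj1 (diff_eq_on oU Ux gE (pY x Ux))).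
- move=> z _; exact: (proj1 (diff_at_lin z (@linear_lsubmx n k))).
- apply/seteqP; split=> [_ [x Ux <-]|z [Az [[Bz Ez] Uz]]].
    have [EY XYx] := XY x Ux; have DY := ED _ EY.
    have [Ap Bp] := local_param_mem lp DY.
    rewrite gE //; split=> //; split; last by rewrite /= [lsubmx _]XYx.
    by split=> //=; rewrite K.
  have [Dc pc] := local_param_surj lp Az Bz.
  exists (lsubmx z) => //; rewrite gE // -[in LHS]pc -[lsubmx _]/(X (chi z)) YX //.
  by rewrite /X pc.
- by move=> x _; rewrite row_mxKl.
Qed.

Lemma graph_diff k (U : set 'rV[C]_n) (g : 'rV[C]_n -> 'rV[C]_k) x : holo U g -> U x ->
  diff_at (fun x => row_mx x (g x)) x (fun v => row_mx v ('d g x v)).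
Proof.
move=> gU Ux; apply: diff_at_rV => b; case: (splitP b) => [c bc|c bc].
  have -> : b = lshift _ c by apply: val_inj.
  have := diff_at_coord c (diff_at_id x).
  rewrite (_ : (fun y => row_mx y (g y) 0 (lshift k c)) = fun y => id y 0 c); last first.
    by apply/funext => y; rewrite row_mxEl.
  by apply: diff_at_eq => v; rewrite row_mxEl.
have -> : b = rshift _ c by apply: val_inj.
have := diff_at_coord c (diff_at_d (gU x Ux)).
rewrite (_ : (fun y => row_mx y (g y) 0 (rshift n c)) = fun y => g y 0 c); last first.
  by apply/funext => y; rewrite row_mxEr.
by apply: diff_at_eq => v; rewrite row_mxEr.
Qed.

Lemma graph_etale W ij U (g : 'rV[C]_n -> 'rV[C]_n.-1) B x : holo U g ->
  local_param (con ij @^-1` W) U (fun x => row_mx x (g x)) B lsubmx -> U x ->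
  etale_at W (con ij (row_mx x (g x))).
Proof.
move=> gU lp Ux; apply: (@param_etale W _ ij U (fun x => row_mx x (g x)) x).
  by split=> //; exists B, lsubmx.
move=> v; rewrite (proj2 (graph_diff gU Ux) v) row_mxKl //.
Qed.

(** The sheet through an etale point is a graph, which can be taken inside V. *)
Lemma etale_nbhd W w (V : set (contact R n)) : etale_at W w -> open V -> V w ->
  exists V' U, [/\ [/\ open V', V' `<=` V, V' w, open U & U (base w)],
    forall w', W w' -> V' w' -> etale_at W w' &
    forall m, U m -> exists w', [/\ W w', V' w' & base w' = m]].
Proof.
move=> ew oV Vw; have [ij [D [psi [t [p _]]]]] := ew.
have [_ inj] := etale_param ew p; case: p => -[B [chi lp]] Dt wt.
have oVij : open (con ij @^-1` V) by exact: (atlas_preimage_open (con_atlas R n)).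
have {}lp := local_param_change lp oVij (fun z _ => iff_refl ((con ij @^-1` W) z)).
have {}Dt : (D `&` psi @^-1` (con ij @^-1` V)) t by split=> //=; rewrite wt.
have [U [g [B' [Ut Bt BB gU lpg]]]] := local_graph lp Dt inj.
have [[oU oB'] _ _ _ _] := lpg.
exists (con ij @` B'), (aff ij.1 @` U); split.
- split.
  + exact: (atlas_image_open (con_atlas R n)).
  + by move=> _ [z /BB[_ Vz] <-].
  + by exists (psi t).
  + exact: (atlas_image_open (aff_atlas R n)).
  + by exists (lsubmx (psi t)) => //; rewrite -base_con wt.
- move=> w1 + [z Bz zw]; rewrite -zw => Wz.
  have [Uz zE] := local_param_surj lpg Wz Bz.
  by have := graph_etale gU lpg Uz; rewrite zE.
- move=> _ [x Ux <-]; have [Wx Bx] := local_param_mem lpg Ux.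
  exists (con ij (row_mx x (g x))); split=> //.
  by apply: projspace_eq; rewrite base_con row_mxKl.
Qed.

(** Without etale points in V, W would equal its critical set there, and a regular point of W in V
    would be a regular point of dimension n of a set of dimension at most n - 1. *)
Lemma etale_dense W (V : set (contact R n)) w : (0 < n)%N -> pure_dim con W n ->
  dim_le con (critical W) n.-1 -> open V -> V w -> W w ->
  exists2 w', V w' & etale_at W w'.
Proof.
move=> n0 Wn cW oV Vw Ww; have [+ _] := Wn w Ww.
move=> /(_ V oV Vw)[w1 Vw1 [ij [D [psi [t [[B [chi lp]] Dt wt]]]]]].
apply: contrapT => H; suff : (n <= n.-1)%N by rewrite -ltnS prednK // ltnn.
apply: (cW w1).
have oVij : open (con ij @^-1` V) by exact: (atlas_preimage_open (con_atlas R n)).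
have VE z : (con ij @^-1` V) z -> (con ij @^-1` W) z <-> (con ij @^-1` critical W) z.
  move=> Vz; split=> [Wz|[]//]; split=> // ez; apply: H; by exists (con ij z).
have lp' := local_param_change lp oVij VE.
exists ij, (D `&` psi @^-1` (con ij @^-1` V)), psi, t; split=> //.
  by exists (B `&` con ij @^-1` V), chi.
by split=> //=; rewrite wt.
Qed.

End Etale.

Section Topology.
Variable R : realType.
Local Notation C := (Cplx R).

Lemma open_ltn_bigcap (X : topologicalType) (N : nat -> set X) q :
  (forall a, (a < q)%N -> open (N a)) -> open [set x | forall a, (a < q)%N -> N a x].
Proof.
elim: q => [|q IH] oN.
  by rewrite (_ : [set x | _] = setT); [exact: openT|apply/seteqP; split].
have -> : [set x | forall a, (a < q.+1)%N -> N a x] =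
    [set x | forall a, (a < q)%N -> N a x] `&` N q.
  apply/seteqP; split=> x /=; first by move=> H; split=> [a aq|]; apply: H => //; exact: ltnW.
  by move=> [H Nq] a; rewrite ltnS leq_eqVlt => /orP[/eqP ->|/H].
by apply: openI; [apply: IH => a aq; apply: oN; exact: ltnW|exact: oN].
Qed.

Lemma connected_nr_ball k (t : 'rV[C]_k) (r : R) : connected [set s | nr (s - t) < r].
Proof.
have [r0|r0] := ltP 0 r; last first.
  have -> : [set s | nr (s - t) < r] = set0.
    by apply/seteqP; split=> // s /=; rewrite ltNge (le_trans r0).
  exact: connected0.
pose seg (s : 'rV[C]_k) := (fun a : R => t + (a%:C%C : C) *: (s - t)) @` `[0, 1].
have -> : [set s | nr (s - t) < r] = \bigcup_(s in [set s | nr (s - t) < r]) seg s.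
  apply/seteqP; split=> [s sr|u [s sr [a /= + uE]]].
    exists s => //; exists 1; first by rewrite /= in_itv /= lexx ler01.
    by rewrite scale1r addrC subrK.
  rewrite in_itv -uE /= => /andP[a0 a1]; rewrite addrC addKr nrZ nr_real ger0_norm //.
  by apply: le_lt_trans sr; rewrite ler_piMl.
apply: bigcup_connected.
  exists t => s _; exists 0; first by rewrite /= in_itv /= lexx ler01.
  by rewrite scale0r addr0.
move=> s sr; apply: connected_continuous_connected; first exact: segment_connected.
apply: continuous_subspaceT => a A /nbhs_nrP[e e0 eA].
have K0 : 0 < nr (s - t) + 1 by rewrite ltr_wpDl.
apply/nbhs_normP; exists (e / (nr (s - t) + 1)) => /=; first by rewrite divr_gt0.
move=> b /=; rewrite distrC ltr_pdivlMr // => ab; apply: eA.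
have -> : t + (b%:C%C : C) *: (s - t) - (t + (a%:C%C : C) *: (s - t)) =
    ((b - a)%:C%C : C) *: (s - t).
  by rewrite rmorphB /= scalerBl opprD addrACA subrr add0r.
rewrite nrZ nr_real (le_lt_trans _ ab) // ler_wpM2l // lerDl //.
Qed.

End Topology.

(** * Counting sheets over open sets of the base *)

Section Dense.
Variables (R : realType) (n : nat).
Local Notation C := (Cplx R).
Variables (d : nat) (M : set (projspace R n)) (W : set (contact R n)).
Hypotheses (n_gt0 : (0 < n)%N) (W_dim : pure_dim con W n) (W_crit : dim_le con (critical W) n.-1).
Hypotheses (W_surj : @base R n @` W = M) (W_deg : fibre_degree d M W) (oM : open M).

(** Multiplicities are positive, so a fibre has at most d points; disjoint sheets pick distinct
    ones. *)
Lemma sheets_bound q (V : nat -> set (contact R n)) m : M m ->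
  (forall a, (a < q)%N -> exists w, [/\ W w, V a w & base w = m]) ->
  (forall a b w, (a < q)%N -> (b < q)%N -> V a w -> V b w -> a = b) -> (q <= d)%N.
Proof.
move=> Mm Vq disj; have [s [mu [us sP mu0 sumd]]] := W_deg Mm.
case: q => // q in Vq disj *.
have H a : exists w, (a < q.+1)%N -> [/\ W w, V a w & base w = m].
  have [/Vq[w ?]|_] := ltnP a q.+1; first by exists w.
  by have [w _] := Vq 0%N isT; exists w.
have [f fP] := choice H.
have sz : (size s <= d)%N.
  rewrite -sumd -sum1_size big_seq [X in (_ <= X)%N]big_seq; apply: leq_sum => w /mu0[].
  by [].
apply: leq_trans sz; rewrite -(size_iota 0 q.+1) -(size_map f); apply: uniq_leq_size.
  rewrite map_inj_in_uniq ?iota_uniq // => a b; rewrite !mem_iota !add0n /= => aq bq e.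
  have [_ Va _] := fP a aq; have [_ Vb _] := fP b bq.
  by apply: (disj a b (f a)) => //; rewrite e.
move=> _ /mapP[a + ->]; rewrite mem_iota add0n /= => aq.
by apply/sP; have [] := fP a aq.
Qed.

(** Only what the induction preserves is recorded: the sheets meet every fibre over U', but need not
    be graphs, as each has just to contribute a point of the fibre. *)
Definition sheets (U : set (projspace R n)) q :=
  exists (V : nat -> set (contact R n)) (U' : set (projspace R n)),
  [/\ [/\ open U', U' `<=` U & U' !=set0],
      forall a, (a < q)%N -> open (V a) /\ forall w, W w -> V a w -> etale_at W w,
      forall a b w, (a < q)%N -> (b < q)%N -> V a w -> V b w -> a = b &
      forall a m, (a < q)%N -> U' m -> exists w, [/\ W w, V a w & base w = m]].

(* The number of pairwise disjoint sheets over a nonempty open subset of U is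
   at most d; if their number cannot be increased there, no point over that
   subset is critical. *)
Lemma M0_dense (U : set (projspace R n)) : open U -> U `<=` M -> U !=set0 ->
  exists U', [/\ open U', U' `<=` U, U' !=set0 & U' `<=` M0 M W].
Proof.
move=> oU UM U0; apply: contrapT => nex.
suff /(_ d.+1)[V [U' [[_ U'U [m U'm]] _ disj sec]]] : forall q, sheets U q.
  suff : (d.+1 <= d)%N by rewrite ltnn.
  apply: (@sheets_bound d.+1 V m) => // [|a aq]; first by apply: UM; exact: U'U.
  exact: sec.
elim=> [|q [V [U' [[oU' U'U U'0] et disj sec]]]].
  by exists (fun=> set0), U; split=> //; split.
(* Otherwise U' itself would lie outside the caustic. *)
have [m U'm mc] : exists2 m, U' m & caustic W m.
  apply: contrapT => H; apply: nex; exists U'; split=> // m U'm; split.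
    by apply: UM; exact: U'U.
  by move=> mc; apply: H; exists m.
have [w [Ww nw] wm] := mc.
(* The critical point w differs from the etale point of each sheet over m; the sheets are shrunk
   around these points so as to avoid neighbourhoods of w. *)
have H a : exists t : set (contact R n) * set (contact R n) * set (projspace R n),
    (a < q)%N -> let: (N, V', Ua) := t in
    [/\ [/\ open N, N w, open V', V' `<=` V a & N `&` V' = set0],
        open Ua, Ua m & forall m', Ua m' -> exists w', [/\ W w', V' w' & base w' = m']].
  have [aq|_] := ltnP a q; last by exists (set0, set0, set0).
  have [wa [Wwa Vwa bwa]] := sec a m aq U'm; have [oVa eVa] := et a aq.
  have ea := eVa _ Wwa Vwa.
  have wwa : w <> wa by move=> e; apply: nw; rewrite e.
  have [N [N' [oN oN' Nw N'wa NN']]] := fibre_separated wwa (etrans wm (esym bwa)).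
  have [V' [Ua [[oV' V'V V'wa oUa Uawa] _ secU]]] :=
    etale_nbhd ea (openI oVa oN') (conj Vwa N'wa).
  exists (N, V', Ua) => _; split=> //; last by rewrite -bwa.
  split=> //; first by move=> x /V'V[].
  by rewrite -subset0 -NN' => x [Nx /V'V[_]].
have [T TP] := choice H.
pose Nf a := (T a).1.1; pose Vf a := (T a).1.2; pose Uf a := (T a).2.
have {}TP a : (a < q)%N ->
    [/\ [/\ open (Nf a), Nf a w, open (Vf a), Vf a `<=` V a & Nf a `&` Vf a = set0],
        open (Uf a), Uf a m & forall m', Uf a m' -> exists w', [/\ W w', Vf a w' & base w' = m']].
  by move=> /(TP a); rewrite /Nf /Vf /Uf; case: (T a) => [[]].
pose U2 := U' `&` [set x | forall a, (a < q)%N -> Uf a x].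
have oU2 : open U2 by apply: openI => //; apply: open_ltn_bigcap => a /TP[].
pose V2 := [set x | forall a, (a < q)%N -> Nf a x] `&` (@base R n @^-1` U2).
have oV2 : open V2.
  apply: openI; last exact: base_open.
  by apply: open_ltn_bigcap => a /TP[[]].
have V2w : V2 w.
  by split=> [a /TP[[]]//|/=]; rewrite wm; split=> // a /TP[].
(* An etale point close to w, hence off the shrunken sheets and over U2, carries the additional
   sheet. *)
have [w1 V2w1 ew1] := etale_dense n_gt0 W_dim W_crit oV2 V2w Ww.
have [V3 [U3 [[oV3 V32 V3w1 oU3 U3w1] et3 sec3]]] := etale_nbhd ew1 oV2 V2w1.
exists (fun a => if (a < q)%N then Vf a else V3), (U3 `&` U2); split.
- split; first exact: openI.
  + by move=> x [_ [/U'U]].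
  + by exists (base w1); split=> //; case: V2w1.
- move=> a _; case: ifP => [aq|_]; last by split.
  have [[_ _ oVf VfV _] _ _ _] := TP a aq; have [_ eVa] := et a aq.
  by split=> // w' Ww' /VfV; exact: eVa.
- have dj a w' : (a < q)%N -> Vf a w' -> V3 w' -> False.
    move=> aq Vw' /V32[NN _]; have [[_ _ _ _ N0] _ _ _] := TP a aq.
    suff : (Nf a `&` Vf a) w' by rewrite N0.
    by split=> //; exact: NN.
  move=> a b w'; rewrite !ltnS => aq bq; have [a_q|a_q] := ltnP a q; have [b_q|b_q] := ltnP b q.
  + have [[_ _ _ Va _] _ _ _] := TP a a_q; have [[_ _ _ Vb _] _ _ _] := TP b b_q.
    by move=> /Va + /Vb; exact: disj.
  + by move=> Vw' V3w'; case: (dj a w').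
  + by move=> V3w' Vw'; case: (dj b w').
  + by move=> _ _; apply/eqP; rewrite eqn_leq (leq_trans aq b_q) (leq_trans bq a_q).
- move=> a m' _ [U3m' [_ Um']]; case: ifP => [aq|_]; last exact: sec3.
  by have [_ _ _ sec'] := TP a aq; apply: sec'; exact: Um'.
Qed.

(** An etale point may still lie over the caustic because of another point of its fibre; moving
    along its sheet leaves the caustic. *)
Lemma etale_M0_dense (V : set (contact R n)) w : open V -> V w -> W w ->
  exists w', [/\ V w', etale_at W w' & M0 M W (base w')].
Proof.
move=> oV Vw Ww; have [w1 Vw1 ew1] := etale_dense n_gt0 W_dim W_crit oV Vw Ww.
have [V' [U [[oV' V'V V'w1 oU Uw1] et sec]]] := etale_nbhd ew1 oV Vw1.
have Mw1 : M (base w1) by rewrite -W_surj; exists w1 => //; exact: etale_mem.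
have UM0 : U `&` M !=set0 by exists (base w1).
have UMM : U `&` M `<=` M by move=> x [].
have [U' [oU' U'U [m U'm] U'M0]] := M0_dense (openI oU oM) UMM UM0.
have [w' [Ww' V'w' bw']] := sec m (proj1 (U'U m U'm)).
by exists w'; split; [exact: V'V|exact: et|rewrite bw'; exact: U'M0].
Qed.

End Dense.

(** * Irreducible components near their generic points *)

Section Components.
Variables (R : realType) (n : nat).
Local Notation C := (Cplx R).
Variables (d : nat) (M : set (projspace R n)) (W : set (contact R n)).
Hypotheses (n_gt0 : (0 < n)%N) (oM : open M) (webW : web d M W).

Lemma M0_open : open (M0 M W).
Proof.
rewrite openE => m M0m; have [U [s [oU Um UM _ _]]] := web_covering webW M0m.
exact: filterS UM (open_nbhs_nbhs (conj oU Um)).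
Qed.

Lemma web_closed w : closure W w -> M (base w) -> W w.
Proof.
move=> clw Mw; have [i [x bw]] := aff_cover (base w).
have [j [p wE]] := con_cover bw; set z := row_mx x p in wE.
have [_ /(_ (i, j) z)] := web_analytic webW; rewrite -wE => /(_ Mw).
move=> [B [k [F [oB Bz FB WF]]]].
rewrite wE; apply/WF => //; apply: contrapT => Fz.
have oF : open (B `&` F @^-1` [set y | y <> 0]).
  apply: open_preimage_holo => //; rewrite openE => y /= y0.
  apply/nbhs_nrP; exists (nr y); first by rewrite nr_gt0; apply/eqP.
  by move=> u uy u0; move: uy; rewrite u0 sub0r nrN ltxx.
have oV := atlas_image_open (con_atlas R n) (i, j) oF.
have Vw : ((fun y => con (i, j) y) @` (B `&` F @^-1` [set y | y <> 0])) w by exists z.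
have [w' [Ww [y [By Fy] yw]]] := clw _ (open_nbhs_nbhs (conj oV Vw)).
by apply: Fy; apply/(WF y By); rewrite yw.
Qed.

Lemma con_continuous ij : continuous (@con R n ij).
Proof.
by apply/continuousP => V oV; exact: (atlas_preimage_open (con_atlas R n)).
Qed.

(** The regular part is locally the image of a ball, hence locally connected, so its components are
    open in W. *)
Lemma component_nbhd w0 w : connected_component (reg con W) w0 w ->
  exists V, [/\ open V, V w & W `&` V `<=` connected_component (reg con W) w0].
Proof.
move=> Kw; have [k [ij [D [psi [t [[B [chi lp]] Dt wt]]]]]] := connected_component_sub Kw.
have [[oD oB] pD cB im K] := lp.
have [r r0 rD] := (nbhs_nrP _ _).1 (open_nbhs_nbhs (conj oD Dt)).
pose b := [set s | nr (s - t) < r].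
have bt : b t by rewrite /b /= subrr nr0.
have [_ Bt] := local_param_mem lp Dt.
pose V := con ij @` (B `&` chi @^-1` b).
exists V; split.
- apply: (atlas_image_open (con_atlas R n)); apply: open_preimage_holo => //.
  exact: nr_open.
- by exists (psi t) => //; split=> //=; rewrite K.
have KE : connected_component (reg con W) w0 = connected_component (reg con W) w.
  exact: same_connected_component.
have S : (fun s => con ij (psi s)) @` b `<=` connected_component (reg con W) w.
  apply: connected_component_max.
  - by exists t.
  - move=> _ [s /rD Ds <-]; exists k, ij, D, psi, s; split=> //; by exists B, chi.
  - apply: connected_continuous_connected; first exact: connected_nr_ball.
    move=> s; apply: continuous_in_subspaceT => u; rewrite inE => /rD Du.
    apply: continuous_comp; first exact: differentiable_continuous (pD u Du).
    exact: con_continuous.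
move=> w' [+ [z [Bz bz] zw]]; rewrite -zw => Wz; rewrite KE; apply: S.
have [_ zE] := local_param_surj lp Wz Bz.
by exists (chi z) => //; rewrite zE.
Qed.

(** A point of Z is a limit of points of the connected component [Kc], near which W lies in [Kc] and
    so in Z. Conversely the closure of [Kc] over M lies in W, which is closed there. An etale point
    over [M0] is then chosen in such a neighbourhood. *)
Lemma component_generic (Z : set (contact R n)) k ij (D : set 'rV[C]_k) psi B chi
    (E : set 'rV[C]_k) : irreducible_component M W Z ->
  local_param (con ij @^-1` Z) D psi B chi -> open E -> E `<=` D -> E !=set0 ->
  exists s V, [/\ E s, open V, V (con ij (psi s)), etale_at W (con ij (psi s)) /\
    M0 M W (base (con ij (psi s))) & forall w, V w -> Z w <-> W w].
Proof.
move=> [w0 rw0 ZE] lp oE ED [s Es]; have [[oD oB] pD cB im K] := lp.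
set Kc := connected_component _ _ in ZE.
have [Zs Bs] := local_param_mem lp (ED _ Es).
pose VB := con ij @` (B `&` chi @^-1` E).
have oVB : open VB.
  by apply: (atlas_image_open (con_atlas R n)); exact: open_preimage_holo.
have VBs : VB (con ij (psi s)) by exists (psi s) => //; split=> //=; rewrite K // ; exact: ED.
have regW : reg con W `<=` W.
  move=> w [l [ij' [D' [psi' [t' [[B' [chi' lp']] Dt' <-]]]]]].
  by have [] := local_param_mem lp' Dt'.
have KW : Kc `<=` W by move=> w /connected_component_sub/regW.
have [clK _] : closure Kc (con ij (psi s)) /\ M (base (con ij (psi s))).
  by move: Zs; rewrite /= ZE => -[].
have [w1 [Kw1 VBw1]] := clK _ (open_nbhs_nbhs (conj oVB VBs)).
have [V [oV Vw1 VK]] := component_nbhd Kw1.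
have [w2 [[Vw2 VBw2] ew2 M0w2]] := etale_M0_dense n_gt0 (web_dim webW) (web_critical webW)
  (web_surj webW) (web_degree webW) oM (openI oV oVB) (conj Vw1 VBw1) (KW _ Kw1).
have ZW w : (V `&` @base R n @^-1` M) w -> Z w <-> W w.
  move=> [Vw Mw]; rewrite ZE; split=> [[clw _]|Ww]; last first.
    by split=> //; apply: subset_closure; exact: VK.
  by apply: web_closed => //; exact: closureS clw.
have Vw2' : (V `&` @base R n @^-1` M) w2 by split=> //; case: M0w2.
have Zw2 : Z w2 by apply/ZW => //; exact: etale_mem.
case: VBw2 => z [Bz Ez] zE.
have [Dz pz] : D (chi z) /\ psi (chi z) = z.
  by apply: (local_param_surj lp) => //=; rewrite zE.
exists (chi z), (V `&` @base R n @^-1` M); rewrite pz zE; split=> //.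
by apply: openI => //; exact: base_open.
Qed.

End Components.

(** * Plaques of a linear web *)

Lemma aff_continuous (R : realType) n i : continuous (@aff R n i).
Proof.
by apply/continuousP => V oV; exact: (atlas_preimage_open (aff_atlas R n)).
Qed.

Section Plaque.
Variables (R : realType) (n : nat).
Local Notation C := (Cplx R).
Variables (d : nat) (M : set (projspace R n)) (W : set (contact R n)).
Hypotheses (oM : open M) (webW : web d M W).
Variables (i : 'I_n.+1) (j : 'I_n) (U : set 'rV[C]_n) (g : 'rV[C]_n -> 'rV[C]_n.-1).
Variables (B : set 'rV[C]_(n + n.-1)) (x0 : 'rV[C]_n).
Hypotheses (lpg : local_param (con (i, j) @^-1` W) U (fun x => row_mx x (g x)) B lsubmx).
Hypotheses (gU : holo U g) (Ux0 : U x0) (UM0 : forall x, U x -> M0 M W (aff i x)).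

(** [J] embeds C^(n-1) as the hyperplane x_j = 0 and eta takes the value 1 on [e]; the kernel of eta
    is the graph over this hyperplane of the linear form with coefficients p, parametrized by
    [hlift]. *)
Let J : 'M[C]_(n.-1, n) := \matrix_(a, l) (l == lift j a)%:R.
Let e : 'rV[C]_n := delta_mx 0 j.

Definition off_coord (x : 'rV[C]_n) : 'rV[C]_n.-1 := \row_a x 0 (lift j a).
Definition hlift (p y : 'rV[C]_n.-1) : 'rV[C]_n :=
  y *m J + (\sum_b y 0 b * p 0 b) *: e.

Let mulJ_lift (y : 'rV[C]_n.-1) a : (y *m J) 0 (lift j a) = y 0 a.
Proof.
rewrite mxE (bigD1 a) //= mxE eqxx mulr1 big1 ?addr0 // => b ba.
by rewrite mxE (inj_eq lift_inj) eq_sym (negPf ba) mulr0.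
Qed.

Let mulJ_j (y : 'rV[C]_n.-1) : (y *m J) 0 j = 0.
Proof. by rewrite mxE big1 // => b _; rewrite mxE (negPf (neq_lift j b)) mulr0. Qed.

Let e_lift a : e 0 (lift j a) = 0.
Proof. by rewrite mxE eqxx eq_sym (negPf (neq_lift j a)). Qed.

Let e_j : e 0 j = 1. Proof. by rewrite mxE !eqxx. Qed.

Lemma eta_hlift p y : eta j p (hlift p y) = 0.
Proof.
rewrite /eta /hlift mxE mulJ_j mxE e_j mulr1 add0r; apply/eqP; rewrite subr_eq0; apply/eqP.
by apply: eq_bigr => a _; rewrite [in RHS]mxE mulJ_lift mxE e_lift mulr0 addr0 mulrC.
Qed.

Lemma hlift_off_coord p v : eta j p v = 0 -> hlift p (off_coord v) = v.
Proof.
move=> /eqP; rewrite /eta subr_eq0 => /eqP vj; apply/rowP => l.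
rewrite /hlift mxE [X in _ + X]mxE; case: (unliftP j l) => [a ->|->].
  by rewrite mulJ_lift e_lift mulr0 addr0 mxE.
rewrite mulJ_j e_j mulr1 add0r vj; apply: eq_bigr => a _.
by rewrite mxE mulrC.
Qed.

Lemma frame_hlift x a : frame J e g x a = hlift (g x) (delta_mx 0 a).
Proof.
rewrite /frame /hlift; congr (_ + _ *: _); rewrite (bigD1 a) //= mxE !eqxx mul1r.
by rewrite big1 ?addr0 // => b ba; rewrite mxE eqxx (negPf ba) mul0r.
Qed.

(** Evaluate eta /\ d eta = 0 on e and two frame vectors: eta is 1 on the first and 0 on the others,
    so only d eta (frame a, frame b) remains. *)
Lemma graph_integrable x a b : U x ->
  'd g x (frame J e g x a) 0 b = 'd g x (frame J e g x b) 0 a.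
Proof.
move=> Ux.
have p : param_at con W (con (i, j) (row_mx x (g x))) (i, j) U (fun x => row_mx x (g x)) x.
  by split=> //; exists B, lsubmx.
have T (L : 'rV[C]_n -> 'rV[C]_(n + n.-1)) (dg : 'rV[C]_n -> 'rV[C]_n.-1) q v1 v2 v3 :
    (forall v, L v = row_mx v (dg v)) ->
    eta j q (lsubmx (L v1)) * deta j (L v2) (L v3) -
    eta j q (lsubmx (L v2)) * deta j (L v1) (L v3) +
    eta j q (lsubmx (L v3)) * deta j (L v1) (L v2) = 0 ->
    eta j q v1 = 1 -> eta j q v2 = 0 -> eta j q v3 = 0 ->
    \sum_c (v2 0 (lift j c) * dg v3 0 c - dg v2 0 c * v3 0 (lift j c)) = 0.
  move=> LE; rewrite !LE !row_mxKl => H h1 h2 h3; move: H.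
  rewrite h1 h2 h3 !mul0r subr0 addr0 mul1r /deta => H; apply: etrans _ H; apply: eq_bigr => c _.
  by rewrite !row_mxKl !row_mxKr.
have I := web_integrable webW p e (frame J e g x a) (frame J e g x b).
have := T _ _ _ _ _ _ (proj2 (graph_diff gU Ux)) I; rewrite /= row_mxKr => {}I.
have fl a' c : frame J e g x a' 0 (lift j c) = (c == a')%:R.
  by rewrite /frame mxE mulJ_lift [X in _ + X]mxE e_lift mulr0 addr0 mxE eqxx.
have := I (eta_delta_j j (g x)).
rewrite !frame_hlift !eta_hlift -!frame_hlift => /(_ erefl erefl).
set da := 'd g x _; set db := 'd g x _.
rewrite sumrB (bigD1 a) //= fl eqxx mul1r big1 => [|c ca]; last first.
  by rewrite fl (negPf ca) mul0r.
rewrite addr0 (bigD1 b) //= fl eqxx mulr1 big1 => [|c cb]; last first.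
  by rewrite fl (negPf cb) mulr0.
by rewrite addr0 => /eqP; rewrite subr_eq0 => /eqP ->.
Qed.

Section Leaf.
Variables (rho : R) (phi : 'rV[C]_n.-1 -> C).
Let pt (y : 'rV[C]_n.-1) : 'rV[C]_n := x0 + y *m J + phi y *: e.
Hypotheses (rho0 : 0 < rho) (ptU : forall y, nr y < rho -> U (pt y)).
Hypothesis phi_diff : forall y, nr y < rho ->
  diff_at phi y (fun v => \sum_b v 0 b * g (pt y) 0 b).

Let ball := [set y : 'rV[C]_n.-1 | nr y < rho].
Let chi (x : 'rV[C]_n) : 'rV[C]_n.-1 := \row_a (x 0 (lift j a) - x0 0 (lift j a)).
(** In N the plaque S is the graph x_j = x0_j + phi, with phi evaluated only inside its ball. *)
Let N := U `&` chi @^-1` ball.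
Let S := (fun y => aff i (pt y)) @` ball.

Let oU : open U. Proof. by case: lpg => -[]. Qed.

Let ball_open : open ball.
Proof.
have -> : ball = [set y | nr (y - 0) < rho] by apply/funext => y; rewrite /ball /= subr0.
exact: nr_open.
Qed.

Let ptE y l : pt y 0 l = x0 0 l + (y *m J) 0 l + phi y * e 0 l.
Proof.
have T (A E : 'rV[C]_n) c : (x0 + A + c *: E) 0 l = x0 0 l + A 0 l + c * E 0 l by rewrite !mxE.
exact: T.
Qed.

Let pt_j y : pt y 0 j = x0 0 j + phi y.
Proof. by rewrite ptE mulJ_j addr0 e_j mulr1. Qed.

Let pt_lift y a : pt y 0 (lift j a) = x0 0 (lift j a) + y 0 a.
Proof. by rewrite ptE mulJ_lift e_lift mulr0 addr0. Qed.

Let chi_pt y : chi (pt y) = y.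
Proof. by apply/rowP => a; rewrite mxE pt_lift addrC addKr. Qed.

Let pt_chi (x : 'rV[C]_n) : x 0 j = x0 0 j + phi (chi x) -> pt (chi x) = x.
Proof.
move=> xj; apply/rowP => l; case: (unliftP j l) => [a ->|->]; last by rewrite pt_j xj.
by rewrite pt_lift mxE addrC subrK.
Qed.

Lemma plaque_diff y : nr y < rho -> diff_at pt y (hlift (g (pt y))).
Proof. by move=> yr; exact: (pt_diff J e x0 (phi_diff yr)). Qed.

Let chi_holo : holo setT chi.
Proof.
move=> x _; apply/differentiable_rVP => a.
have H := diff_at_sub (diff_at_coord (lift j a) (diff_at_id x)) (diff_at_cst (x0 0 (lift j a)) x).
by apply: eq_differentiable (proj1 H) => y; rewrite mxE.
Qed.

Let N_open : open N.
Proof. by apply: open_preimage_holo => //; exact: (holo_sub _ chi_holo). Qed.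

Let S_aff x : N x -> S (aff i x) <-> x 0 j = x0 0 j + phi (chi x).
Proof.
move=> [Ux Nx]; split=> [[y yr /(atlas_inj (aff_atlas R n)) <-]|/pt_chi xE].
  by rewrite chi_pt pt_j.
by exists (chi x) => //; rewrite xE.
Qed.

Let plaque_param : local_param (aff i @^-1` S) ball pt N chi.
Proof.
split.
- by split.
- by move=> y /plaque_diff[].
- exact: holo_sub chi_holo.
- apply/seteqP; split=> [_ [y yr <-]|x [Sx Nx]].
    by split; [exists y|split; [exact: ptU|rewrite /= chi_pt]].
  by exists (chi x); [case: Nx|rewrite pt_chi //; exact/S_aff].
- by move=> y _.
Qed.

Let plaque_regular m : S m -> regular_at aff S m n.-1.
Proof.
move=> [y yr <-]; exists i, ball, pt, y; split=> //.
by exists N, chi; exact: plaque_param.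
Qed.

Let SM0 : S `<=` M0 M W.
Proof. by move=> _ [y yr <-]; apply: UM0; exact: ptU. Qed.

Let SM0E : S `&` M0 M W = S.
Proof. by apply/setIidPl. Qed.

Let phi_holo : holo ball phi.
Proof. by move=> y /phi_diff[]. Qed.

Let plaque_analytic : exists Om, [/\ open Om, Om `<=` M & analytic_subset aff Om S].
Proof.
exists (aff i @` N); split.
- exact: (atlas_image_open (aff_atlas R n)).
- by move=> _ [x [Ux _] <-]; have [] := UM0 Ux.
split.
  by move=> _ [y yr <-]; exists (pt y) => //; split; [exact: ptU|rewrite /= chi_pt].
(* Equations are required in every affine chart; the equation of the graph is pulled back by the
   transition map to the chart i. *)
move=> i' z [x Nx xz].
have [dz tz] := atlas_eq (aff_atlas R n) (esym xz).
pose F (y : 'rV[C]_n) : 'rV[C]_1 := \row__ (aff_tau i' i y 0 j - (x0 0 j + phi (chi (aff_tau i' i y)))).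
have FE y l : F y 0 l = aff_tau i' i y 0 j - (x0 0 j + phi (chi (aff_tau i' i y))).
  by rewrite /F mxE.
pose D := aff_dom i' i `&` aff_tau i' i @^-1` N.
have th := @atlas_holo _ _ _ _ _ (aff_atlas R n) i' i.
have oD : open D by apply: open_preimage_holo => //; exact: (@atlas_dom_open _ _ _ _ _ (aff_atlas R n)).
exists D, 1%N, F; split=> //.
- by split=> //=; rewrite -[aff_tau i' i z]/(atlas_tau (aff_atlas R n) i' i z) tz.
- move=> y [dy [Uy Ny]]; apply/differentiable_rVP => l.
  have H1 := diff_at_d (th y dy).
  have H2 := diff_at_comp H1 (diff_at_d (chi_holo (x := aff_tau i' i y) I)).
  have H3 := diff_at_comp H2 (diff_at_d (phi_holo Ny)).
  have H4 := diff_at_sub (diff_at_coord j H1) (diff_at_add (diff_at_cst (x0 0 j) y) H3).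
  by apply: eq_differentiable (proj1 H4) => u; rewrite FE.
- move=> y [dy Ny]; rewrite -(aff_tauE dy); split.
    by move=> /(S_aff Ny) E; apply/rowP => l; rewrite FE E subrr [RHS]mxE.
  move=> /rowP/(_ 0); rewrite FE [RHS]mxE => /eqP; rewrite subr_eq0 => /eqP E.
  exact/(S_aff Ny).
Qed.

Let sheet (m : projspace R n) : contact R n :=
  let x := xget 0 [set x | aff i x = m] in con (i, j) (row_mx x (g x)).

Let sheetE x : sheet (aff i x) = con (i, j) (row_mx x (g x)).
Proof.
rewrite /sheet; set P := [set _ | _]; have Px : P (xget 0 P) by apply: (@xgetPex _ 0 P); exists x.
by have -> : xget 0 P = x by exact: (atlas_inj (aff_atlas R n)) Px.
Qed.

Let sheet_continuous x : U x -> {for (aff i x), continuous sheet}.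
Proof.
move=> Ux A; rewrite sheetE => nA.
have : nbhs x [set x | A (con (i, j) (row_mx x (g x)))].
  have c1 : {for x, continuous (fun x => row_mx x (g x) : 'rV[C]_(n + n.-1))}.
    exact: differentiable_continuous (proj1 (graph_diff gU Ux)).
  exact: (continuous_comp c1 (@con_continuous R n (i, j) _)) nA.
move=> /nbhs_nrP[r r0 rA].
have oB : open (aff i @` [set y | nr (y - x) < r]).
  by apply: (atlas_image_open (aff_atlas R n)); exact: nr_open.
apply: filterS (open_nbhs_nbhs (conj oB _)); last by exists x => //=; rewrite subrr nr0.
by move=> _ [y yr <-]; rewrite /= sheetE; exact: rA.
Qed.

Lemma plaque_leaf : leaf M W S.
Proof.
have S0 : S (aff i (pt 0)) by exists 0 => //; rewrite /ball /= nr0.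
split.
- exact: plaque_analytic.
- move=> m Sm; split.
    by move=> V oV Vm; exists m => //; exact: plaque_regular.
  exists setT; split=> [|//|m' l _ rl]; first exact: openT.
  have Sm' : S m'.
    have [i' [D [psi [t [[B' [chi' lp']] Dt <-]]]]] := rl.
    by have [] := local_param_mem lp' Dt.
  have := regular_dim_le (aff_atlas R n) rl (plaque_regular Sm').
  by [].
- rewrite SM0E; split; first by exists (aff i (pt 0)).
  apply: connected_continuous_connected.
    have -> : ball = [set y | nr (y - 0) < rho] by apply/funext => y; rewrite /ball /= subr0.
    exact: connected_nr_ball.
  apply: continuous_in_subspaceT => y; rewrite inE => yr.
  apply: continuous_comp; first exact: differentiable_continuous (proj1 (plaque_diff yr)).
  exact: aff_continuous.
- by rewrite SM0E; exact: subset_closure.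
move=> m [[y yr <-] _].
exists (aff i @` U), sheet; split.
- exact: (atlas_image_open (aff_atlas R n)).
- by exists (pt y) => //; exact: ptU.
- by move=> _ [x Ux <-]; exact: UM0.
- move=> _ [x Ux <-]; split; first exact: sheet_continuous.
    by rewrite sheetE; have [] := local_param_mem lpg Ux.
  by rewrite sheetE; apply: projspace_eq; rewrite base_con row_mxKl.
move=> _ [[y' yr' <-] _]; exists (i, j), (row_mx (pt y') (g (pt y'))), ball, pt, y'; split.
- exact: sheetE.
- by split=> //; exists N, chi; exact: plaque_param.
move=> v; apply: etrans (eta_hlift (g (pt y')) v).
rewrite row_mxKr; congr (eta j _ _); exact: (proj2 (plaque_diff yr') v).
Qed.

End Leaf.

Lemma sum_hlift (c : 'I_n -> C) p b :
  \sum_l c l * hlift p (delta_mx 0 b) 0 l = c j * p 0 b + c (lift j b).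
Proof.
have hj : hlift p (delta_mx 0 b) 0 j = p 0 b.
  rewrite /hlift mxE mulJ_j add0r [LHS]mxE e_j mulr1 (bigD1 b) //= mxE !eqxx mul1r.
  by rewrite big1 ?addr0 // => a ab; rewrite mxE eqxx (negPf ab) mul0r.
have hl a : hlift p (delta_mx 0 b) 0 (lift j a) = (a == b)%:R.
  by rewrite /hlift mxE mulJ_lift [X in _ + X]mxE e_lift mulr0 addr0 mxE eqxx.
rewrite (bigD1_ord j) //= hj; congr (_ + _).
rewrite (bigD1 b) //= hl eqxx mulr1 big1 ?addr0 // => a ab.
by rewrite hl (negPf ab) mulr0.
Qed.

(* The plaque through x0 lies in a hyperplane, to which it is tangent
   everywhere, so that g is constant along it. *)
Lemma linear_flat : (forall S, leaf M W S -> exists h, S `<=` hyperplane h) ->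
  forall v, eta j (g x0) v = 0 -> 'd g x0 v = 0.
Proof.
move=> lin v v0; have oU : open U by case: lpg => -[].
have [rho [phi [rho0 phi0 ptU phid]]] :=
  frobenius oU gU Ux0 (fun x a b Ux => graph_integrable a b Ux).
pose pt (y : 'rV[C]_n.-1) : 'rV[C]_n := x0 + y *m J + phi y *: e.
have pt0 : pt 0 = x0 by rewrite /pt mul0mx phi0 scale0r !addr0.
have ptd y : nr y < rho -> diff_at pt y (hlift (g (pt y))).
  by move=> yr; exact: (pt_diff J e x0 (phid y yr)).
have [h hS] := lin _ (plaque_leaf rho0 ptU phid).
have [A A0 hA] := projspace_rep h.
have inc y : nr y < rho -> \sum_l A 0 (lift i l) * pt y 0 l = - A 0 i.
  move=> yr; have ip : incident (aff i (pt y)) h by apply: hS; exists y.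
  have := (incident_rep (erefl (line (aff i (pt y)))) hA).2 ip.
  rewrite (bigD1_ord i) //= aff_row_i mul1r => /eqP; rewrite addrC addr_eq0 => /eqP <-.
  by apply: eq_bigr => l _; rewrite aff_row_lift mulrC.
have b0 : nr (0 : 'rV[C]_n.-1) < rho by rewrite nr0.
have ob : open [set y : 'rV[C]_n.-1 | nr y < rho].
  have -> : [set y : 'rV[C]_n.-1 | nr y < rho] = [set y | nr (y - 0) < rho].
    by apply/funext => y /=; rewrite subr0.
  exact: nr_open.
(* The equation [inc] of the hyperplane, differentiated along the plaque in the direction over the
   b-th basis vector. *)
have Ag y b : nr y < rho -> A 0 (lift i j) * g (pt y) 0 b = - A 0 (lift i (lift j b)).
  move=> yr; apply/eqP; rewrite -addr_eq0 -(sum_hlift (fun l => A 0 (lift i l))); apply/eqP.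
  have H1 := diff_at_sum (fun l => diff_at_mul (diff_at_cst (A 0 (lift i l)) y) (diff_at_coord l (ptd y yr))).
  have [cd cE] := diff_at_cst (- A 0 i : C) y.
  have H2 := diff_eq_on ob yr inc cd.
  have := etrans (diff_at_unique H1 H2 (delta_mx 0 b)) (cE _).
  by move=> E; apply: etrans E; apply: eq_bigr => l _; rewrite mulr0 addr0.
(* If it vanished, [Ag] would annihilate the other affine coefficients and then [inc] the last
   one. *)
have Aj : A 0 (lift i j) != 0.
  apply: contra_neq A0 => Aj.
  have Al l : A 0 (lift i l) = 0.
    case: (unliftP j l) => [b ->|->//]; apply/eqP; rewrite -oppr_eq0 -(Ag 0 b b0) Aj mul0r.
    by [].
  apply/rowP => k; rewrite mxE; case: (unliftP i k) => [l ->|->]; first exact: Al.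
  apply/eqP; rewrite -oppr_eq0 -(inc 0 b0) big1 // => l _.
  by rewrite Al mul0r.
have gc y : nr y < rho -> g (pt y) = g (pt 0).
  by move=> yr; apply/rowP => b; apply: (mulfI Aj); rewrite (Ag _ b yr) (Ag _ b b0).
have [cd cE] := diff_at_cst (g (pt 0)) (0 : 'rV[C]_n.-1).
have H2 := diff_eq_on ob b0 gc cd.
(* Every vector of the kernel of eta at x0 has the form [hlift (g x0) y], hence is tangent to the
   plaque, along which g is constant. *)
have key x : pt 0 = x -> 'd g x (hlift (g x) (off_coord v)) = 0.
  move=> <-; have H1 := diff_at_comp (ptd 0 b0) (diff_at_d (gU (ptU 0 b0))).
  exact: etrans (diff_at_unique H1 H2 _) (cE _).
by have := key x0 pt0; rewrite hlift_off_coord.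
Qed.

End Plaque.

(** * Dicriticity and total linearizability *)

Section Dicritical.
Variables (R : realType) (n : nat).
Local Notation C := (Cplx R).

Lemma eta_lin j (p : 'rV[C]_n.-1) a b u v :
  eta j p (a *: u + b *: v) = a * eta j p u + b * eta j p v.
Proof.
have T (x y s t : C) : a * x + b * y - (a * s + b * t) = a * (x - s) + b * (y - t) by ring.
have E l : (a *: u + b *: v) 0 l = a * u 0 l + b * v 0 l by rewrite !mxE.
rewrite /eta E -T; congr (_ - _).
rewrite !mulr_sumr -big_split; apply: eq_bigr => c _ /=.
by rewrite E; ring.
Qed.

Lemma eta_differentiable k j (P : 'rV[C]_k -> 'rV[C]_n.-1) (Q : 'rV[C]_k -> 'rV[C]_n) s :
  differentiable P s -> differentiable Q s ->
  differentiable (fun s => eta j (P s) (Q s) : C) s.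
Proof.
move=> Pd Qd.
have ds := diff_at_sum (fun a => diff_at_mul (diff_at_coord a (diff_at_d Pd))
  (diff_at_coord (lift j a) (diff_at_d Qd))).
exact: (proj1 (diff_at_sub (diff_at_coord j (diff_at_d Qd)) ds)).
Qed.

Lemma open_holo_neq0 k (D : set 'rV[C]_k) (f : 'rV[C]_k -> C) : open D -> holo D f ->
  open (D `&` [set s | f s != 0]).
Proof.
move=> oD fD; rewrite openE => s [Ds fs]; apply: filterI; first exact: open_nbhs_nbhs.
have fc : {for s, continuous f} by exact: differentiable_continuous (fD s Ds).
have nf : nbhs (f s) [set c | c != 0].
  apply/nbhs_nrP; exists (nr (f s)); first by rewrite nr_gt0.
  by move=> y; apply: contraTneq => ->; rewrite sub0r nrN ltxx.
exact: fc nf.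
Qed.

Variables (d : nat) (M : set (projspace R n)) (W : set (contact R n)).
Hypotheses (oM : open M) (linW : linear_web d M W).

(** Near s, psi is its base part composed with the graph map of g, so the fibre part of ['d psi] is
    ['d g] applied to the base part, and [linear_flat] applies. The base part being bijective, some
    vector has eta equal to 1. *)
Lemma etale_flat ij (D : set 'rV[C]_n) (psi : 'rV[C]_n -> 'rV[C]_(n + n.-1)) B chi s :
  local_param (con ij @^-1` W) D psi B chi -> D s ->
  (forall v, lsubmx ('d psi s v) = 0 -> v = 0) -> M0 M W (aff ij.1 (lsubmx (psi s))) ->
  (forall v, eta ij.2 (rsubmx (psi s)) (lsubmx ('d psi s v)) = 0 -> rsubmx ('d psi s v) = 0) /\
  exists v, eta ij.2 (rsubmx (psi s)) (lsubmx ('d psi s v)) != 0.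
Proof.
case: ij => i j /=; move=> lp Ds inj M0s; have [webW lin] := linW; have [[oD oB] pD _ _ _] := lp.
have [As Bs] := local_param_mem lp Ds.
have [U [g [B' [Us B's _ gU lpg]]]] := local_graph lp Ds inj.
pose E0 := aff i @^-1` M0 M W.
have oE0 : open E0 by exact: (atlas_preimage_open (aff_atlas R n)) (M0_open webW).
have lpg0 := local_param_restrict lpg oE0.
have gU0 : holo (U `&` E0) g by apply: holo_sub gU => x [].
have Us0 : (U `&` E0) (lsubmx (psi s)) by [].
have UM0 x : (U `&` E0) x -> M0 M W (aff i x) by case.
have flat := linear_flat webW lpg0 gU0 Us0 UM0 lin.
pose D1 := D `&` psi @^-1` B'.
have oD1 : open D1 by apply: open_preimage_holo => //; case: lpg => -[].
have graphE y : D1 y -> psi y = row_mx (lsubmx (psi y)) (g (lsubmx (psi y))).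
  move=> [Dy B'y]; have [Ay _] := local_param_mem lp Dy.
  by have [_ ->] := local_param_surj lpg Ay B'y.
have D1s : D1 s by [].
have Hl := diff_at_comp (diff_at_d (pD s Ds)) (diff_at_lin (psi s) (@linear_lsubmx R n n.-1)).
have HG := diff_at_comp Hl (graph_diff gU Us).
have H := diff_at_unique (diff_at_d (pD s Ds)) (diff_eq_on oD1 D1s graphE (proj1 HG)).
have dpsi v : 'd psi s v = row_mx (lsubmx ('d psi s v)) ('d g (lsubmx (psi s)) (lsubmx ('d psi s v))).
  exact: etrans (H v) (proj2 HG v).
have rpsi : rsubmx (psi s) = g (lsubmx (psi s)) by rewrite [in LHS]graphE // row_mxKr.
split=> [v v0|].
  apply: etrans (congr1 rsubmx (dpsi v)) _; apply: etrans (row_mxKr _ _) _.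
  by apply: flat; rewrite -rpsi.
have [b _ bK] : bijective (fun v => lsubmx ('d psi s v)).
  apply: inj_linear_bij inj => a u v; pose f := 'd psi s.
  exact: etrans (congr1 lsubmx (linearP f a u v)) (linearP _ a (f u) (f v)).
exists (b (delta_mx 0 j)).
have -> : eta j (rsubmx (psi s)) (lsubmx ('d psi s (b (delta_mx 0 j)))) = 1.
  exact: etrans (congr1 (eta j _) (bK _)) (eta_delta_j _ _).
exact: oner_neq0.
Qed.

(** At a generic point a parametrization of Z is one of W, which is etale there; this also forces
    its dimension to be n. *)
Lemma generic_flat Z k ij (D : set 'rV[C]_k) (psi : 'rV[C]_k -> 'rV[C]_(n + n.-1)) B chi E :
  irreducible_component M W Z -> local_param (con ij @^-1` Z) D psi B chi ->
  open E -> E `<=` D -> E !=set0 ->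
  exists s, [/\ E s, k = n,
    forall v, eta ij.2 (rsubmx (psi s)) (lsubmx ('d psi s v)) = 0 -> rsubmx ('d psi s v) = 0 &
    exists v, eta ij.2 (rsubmx (psi s)) (lsubmx ('d psi s v)) != 0].
Proof.
move=> compZ lp oE ED E0; have [webW lin] := linW.
have n_gt0 : (0 < n)%N by apply: leq_ltn_trans (ltn_ord ij.2).
have [s [V [Es oV Vs [es M0s] ZW]]] := component_generic n_gt0 oM webW compZ lp oE ED E0.
have oV' : open (con ij @^-1` V) by exact: (atlas_preimage_open (con_atlas R n)).
have lpW := local_param_change lp oV' (fun z Vz => ZW _ Vz).
have Ds : (D `&` psi @^-1` (con ij @^-1` V)) s by split=> //; exact: ED.
have p : param_at con W (con ij (psi s)) ij (D `&` psi @^-1` (con ij @^-1` V)) psi s.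
  by split=> //; exists (B `&` con ij @^-1` V), chi.
have [kn inj] := etale_param es p; exists s.
subst k; have [? ?] := etale_flat lpW Ds inj M0s.
by split.
Qed.

Lemma linear_web_dicritical : dicritical M W.
Proof.
move=> Z compZ w [k [ij [D [psi [t [[B [chi lp]] Dt wt]]]]]].
have [[oD oB] pD _ _ _] := lp.
have D0 : D !=set0 by exists t.
have [_ [_ kn _ _]] := generic_flat compZ lp oD (fun x Dx => Dx) D0.
subst k; pose j := ij.2.
(* [e] and [q a] are the pullbacks by psi of eta and dp_a. *)
pose e s v : C := eta j (rsubmx (psi s)) (lsubmx ('d psi s v)).
pose q a s v : C := rsubmx ('d psi s v) 0 a.
have dh v : holo D (fun s => 'd psi s v) by exact: holo_diff_rV.
have lh v s : D s -> differentiable (fun s => lsubmx ('d psi s v)) s.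
  move=> Ds; exact: (proj1 (diff_at_comp (diff_at_d (dh v s Ds)) (diff_at_lin _ (@linear_lsubmx R n n.-1)))).
have rh v s : D s -> differentiable (fun s => rsubmx ('d psi s v)) s.
  move=> Ds; exact: (proj1 (diff_at_comp (diff_at_d (dh v s Ds)) (diff_at_lin _ (@linear_rsubmx R n n.-1)))).
have ph s : D s -> differentiable (fun s => rsubmx (psi s)) s.
  move=> Ds; exact: (proj1 (diff_at_comp (diff_at_d (pD s Ds)) (diff_at_lin _ (@linear_rsubmx R n n.-1)))).
have eh v : holo D (fun s => e s v).
  by move=> s Ds; exact: eta_differentiable (ph s Ds) (lh v s Ds).
have qh a v : holo D (fun s => q a s v).
  move=> s Ds; exact: (proj1 (diff_at_coord a (diff_at_d (rh v s Ds)))).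
have elin s a b u v : e s (a *: u + b *: v) = a * e s u + b * e s v.
  have T (f : {linear 'rV[C]_n -> 'rV[C]_(n + n.-1)}) p :
      eta j p (lsubmx (f (a *: u + b *: v))) = a * eta j p (lsubmx (f u)) + b * eta j p (lsubmx (f v)).
    by rewrite linearP linearZ /= linearP linearZ /= eta_lin.
  exact: T ('d psi s) _.
have qlin c s a b u v : q c s (a *: u + b *: v) = a * q c s u + b * q c s v.
  have T (f : {linear 'rV[C]_n -> 'rV[C]_(n + n.-1)}) :
      rsubmx (f (a *: u + b *: v)) 0 c = a * rsubmx (f u) 0 c + b * rsubmx (f v) 0 c.
    have E (x y : 'rV[C]_n.-1) l : (a *: x + b *: y) 0 l = a * x 0 l + b * y 0 l by rewrite !mxE.
    by rewrite linearP linearZ /= linearP linearZ /= E.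
  exact: T ('d psi s).
(* The open set where this minor is nonzero would contain a generic point; there e (v1) v2 - e (v2)
   v1 lies in the kernel of eta, so dp_a vanishes on it, which is the vanishing of the minor. *)
have minor s v1 v2 a : D s -> e s v1 * q a s v2 = e s v2 * q a s v1.
  move=> Ds; apply/eqP; rewrite -subr_eq0; apply/negPn/negP => ns.
  pose F s := e s v1 * q a s v2 - e s v2 * q a s v1.
  have Fh : holo D F.
    move=> y Dy; have H1 := diff_at_mul (diff_at_d (eh v1 y Dy)) (diff_at_d (qh a v2 y Dy)).
    have H2 := diff_at_mul (diff_at_d (eh v2 y Dy)) (diff_at_d (qh a v1 y Dy)).
    exact: (proj1 (diff_at_sub H1 H2)).
  have [||s' [[_ Fs'] _ flat _]] := generic_flat compZ lp (open_holo_neq0 oD Fh).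
  - by move=> y [].
  - by exists s.
  move/eqP: Fs'; apply.
  have e0 : e s' (e s' v1 *: v2 + (- e s' v2) *: v1) = 0 by rewrite elin mulNr mulrC subrr.
  have : q a s' (e s' v1 *: v2 + (- e s' v2) *: v1) = 0.
    by have := flat _ e0; rewrite /q => ->; rewrite mxE.
  by rewrite qlin mulNr.
have expand (L : 'rV[C]_n -> C) v : (forall a b u v, L (a *: u + b *: v) = a * L u + b * L v) ->
    L v = \sum_l (\row_l L (delta_mx 0 l)) 0 l * v 0 l.
  move=> Ll; have LD u u' : L (u + u') = L u + L u'.
    by rewrite -[u]scale1r -[u']scale1r Ll !scale1r !mul1r.
  have L0 : L 0 = 0 by rewrite -(scale0r v) -[0 *: v]addr0 -(scale0r v) Ll !mul0r addr0.
  rewrite {1}(row_sum_delta v) (big_morph L LD L0); apply: eq_bigr => l _.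
  by rewrite mxE -[v 0 l *: _]addr0 -(scale0r v) Ll mul0r addr0 mulrC.
have param (P : set 'rV[C]_n) : open (D `&` P) -> P t ->
    param_at con Z w ij (D `&` (D `&` P)) psi t.
  move=> oP Pt; have lp' := local_param_restrict lp oP.
  by split=> //; exists (B `&` chi @^-1` (D `&` P)), chi.
(* Where the pullback of eta is nonzero it serves as omega, with f = 1. *)
have [[v0 ev0]|et0] := pselect (exists v, e t v != 0).
  have oE := open_holo_neq0 oD (eh v0).
  exists n, ij, (D `&` (D `&` [set s | e s v0 != 0])), psi, t,
    (fun s => \row_l e s (delta_mx 0 l)), (fun=> 1); split.
  - exact: param.
  - split=> s; last by move=> _; exact: differentiable_cst.
    move=> [Ds _]; apply/differentiable_rVP => l.
    by apply: eq_differentiable (eh (delta_mx 0 l) s Ds) => y; rewrite mxE.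
  - move=> s [Ds [_ es]]; apply: contra_neq es => o0.
    by rewrite (expand _ v0 (elin s)) o0 big1 // => l _; rewrite mxE mul0r.
  - by move=> s v _; rewrite mul1r; exact: expand _ v (elin s).
  - by move=> E _ _ [s Es]; exists s => //; exact: oner_neq0.
have {}et0 v : e t v = 0 by apply/eqP/negPn/negP => h; apply: et0; exists v.
(* Otherwise ['d psi t] maps into the vectors with eta = 0 and dp = 0, which are determined by their
   n - 1 base coordinates off j; but it is injective on C^n. *)
have [v0 [a qv0]] : exists v a, q a t v != 0.
  apply: contrapT => nq.
  have n_gt0 : (0 < n)%N by apply: leq_ltn_trans (ltn_ord j).
  suff : (n <= n.-1)%N by rewrite -ltnS prednK // ltnn.
  apply: (@inj_linear_le R n n.-1 (fun v => off_coord j (lsubmx ('d psi t v)))).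
    have T (f : {linear 'rV[C]_n -> 'rV[C]_(n + n.-1)}) :
      linear (fun v => off_coord j (lsubmx (f v))).
      by move=> c u v; rewrite !linearP; apply/rowP => b; rewrite !mxE.
    exact: T ('d psi t).
  move=> v v0; apply: (local_param_diff_inj lp Dt).
  have l0 : lsubmx ('d psi t v) = 0.
    apply: etrans (esym (hlift_off_coord (et0 v))) _; rewrite v0.
    by rewrite /hlift mul0mx add0r big1 ?scale0r // => b _; rewrite mxE mul0r.
  have r0 : rsubmx ('d psi t v) = 0.
    apply/rowP => b; rewrite [RHS]mxE; apply/eqP/negPn/negP => h; apply: nq.
    by exists v, b.
  apply: etrans (esym (hsubmxK _)) _; rewrite l0 r0.
  exact: row_mx0.
have oE := open_holo_neq0 oD (qh a v0).
(* Here omega is dp_a, and the minors give eta = f omega with f the ratio of both forms on v0. *)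
exists n, ij, (D `&` (D `&` [set s | q a s v0 != 0])), psi, t,
  (fun s => \row_l q a s (delta_mx 0 l)), (fun s => e s v0 / q a s v0); split.
- exact: param.
- split=> s [Ds [_ qs]].
    apply/differentiable_rVP => l.
    by apply: eq_differentiable (qh a (delta_mx 0 l) s Ds) => y; rewrite mxE.
  exact: differentiable_div (eh v0 s Ds) (qh a v0 s Ds) qs.
- move=> s [Ds [_ qs]]; apply: contra_neq qs => o0.
  by rewrite (expand _ v0 (qlin a s)) o0 big1 // => l _; rewrite mxE mul0r.
- move=> s v [Ds [_ qs]]; rewrite -(expand _ v (qlin a s)) mulrAC.
  by apply: (mulIf qs); rewrite divfK // -[LHS]/(e s v * q a s v0) minor.
move=> E oE' ED E0.
(* At a generic point of E eta is nonzero on some v1; if f vanished there, the minor on v1 and v0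
   would force dp_a (v0) = 0. *)
have [|s [Es _ _ [v1 ev1]]] := generic_flat compZ lp oE' _ E0.
  by move=> y /ED[].
exists s => //; have [Ds [_ qs]] := ED s Es.
rewrite mulf_neq0 ?invr_eq0 //; apply: contraTneq ev1 => e0.
have := minor s v1 v0 a Ds; rewrite e0 mul0r => /eqP.
by rewrite mulf_eq0 (negPf qs) orbF => h; rewrite negbK.
Qed.

Lemma linear_web_totally_linearizable : totally_linearizable M W.
Proof.
have [webW lin] := linW.
move=> m Mm; have [i [x mx]] := aff_cover m.
have oB : open (aff i @^-1` M) by exact: (atlas_preimage_open (aff_atlas R n)).
exists i, (aff i @^-1` M), (aff i @^-1` M), id, id; split.
- split=> //; try by move=> z _; exact: (proj1 (diff_at_id z)).
  by rewrite image_id setTI.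
- by exists x; rewrite /= -mx.
- by move=> _ [z Mz <-].
move=> S leafS SB; have [h Sh] := lin S leafS.
have [A A0 hA] := projspace_rep h.
have inc z : S (aff i z) -> \sum_l A 0 (lift i l) * z 0 l = - A 0 i.
  move=> /Sh ip; have := (incident_rep (erefl (line (aff i z))) hA).2 ip.
  rewrite (bigD1_ord i) //= aff_row_i mul1r => /eqP; rewrite addrC addr_eq0 => /eqP <-.
  by apply: eq_bigr => l _; rewrite aff_row_lift mulrC.
exists (\row_l A 0 (lift i l)), (- A 0 i); split; last first.
  by move=> z _ /inc <-; apply: eq_bigr => l _; rewrite mxE.
(* The linear part of the equation vanishes only for the hyperplane at infinity of the chart, which
   misses the chart; a point of the leaf in the chart excludes it. *)
have [_ _ [[m' [Sm' _]] _] _ _] := leafS.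
have [z Mz zm'] := SB m' Sm'; rewrite -zm' in Sm'.
apply: contra_neq A0 => a0.
have Al l : A 0 (lift i l) = 0 by move/rowP/(_ l): a0; rewrite !mxE.
apply/rowP => k; rewrite mxE; case: (unliftP i k) => [l ->|->]; first exact: Al.
apply/eqP; rewrite -oppr_eq0 -(inc z Sm') big1 // => l _.
by rewrite Al mul0r.
Qed.

End Dicritical.

Theorem proposition7p1 (R : realType) (n : nat) (hn : (2 <= n)%N) :
  (forall (d : nat) (M : set (projspace R n)) (W : set (contact R n)),
     (1 <= d)%N -> open M -> linear_web d M W ->
     totally_linearizable M W /\ dicritical M W) /\
  (forall (d : nat) (W : set (contact R n)),
     (1 <= d)%N -> algebraic_web d W ->
     totally_linearizable setT W /\ dicritical setT W).
Proof.
have main d (M : set (projspace R n)) (W : set (contact R n)) : open M -> linear_web d M W ->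
    totally_linearizable M W /\ dicritical M W.
  move=> oM linW; split; first exact: linear_web_totally_linearizable oM linW.
  exact: linear_web_dicritical oM linW.
split=> [d M W _|d W _ [webW [Z [_ leafZ _]]]]; first exact: main.
apply: (main d); first exact: openT.
by split=> // S /leafZ[h _ Sh]; exists h.
Qed.
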